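(* Let $A$ be an Arens-Michael algebra and $I\subset A_+$ a closed left ideal. Let $X=(A_+/I)^{\sim}$ be the completion of $A_+/I$, regarded as a left $A$-$\widehat\otimes$-module. Then the following conditions are equivalent: (i) $I$ has a right locally bounded approximate identity; (ii) the functor $(\,\cdot\,)\mathbin{\widehat\otimes}_A X$ from the category of all right $A$-$\widehat\otimes$-modules to the category of complete locally convex spaces is exact, i.e. it takes every exact pair of right $A$-$\widehat\otimes$-modules to an exact pair of complete locally convex spaces; (iii) the functor $(\,\cdot\,)\mathbin{\widehat\otimes}_A X$ from the category of all right Banach $A$-modules to the category of Banach spaces is exact, i.e. it takes every exact pair of right Banach $A$-modules to an exact pair of Banach spaces.
   Context: All spaces are over $\mathbb C$. Complete locally convex spaces (l.c.s.) are Hausdorff by convention; the completion $E^{\sim}$ of an l.c.s. $E$ is the completion of its associated Hausdorff space. A topological algebra is a topological vector space with an associative, separately continuous product. An Arens-Michael algebra is a complete algebra whose topology is given by a family of submultiplicative seminorms ($\|ab\|\le\|a\|\|b\|$). $A_+$ is the unitization of $A$ (an identity is always adjoined). A $\widehat\otimes$-algebra is a complete locally convex algebra with jointly continuous product; a (left or right) $A$-$\widehat\otimes$-module is a complete l.c.s. with a jointly continuous $A$-module structure. A Banach $A$-module is an $A$-$\widehat\otimes$-module whose underlying l.c.s. is a Banach space. Morphisms are continuous $A$-module maps. $\widehat\otimes$ is the completed projective tensor product. For a right module $Y$ and a left module $X$, $Y\mathbin{\widehat\otimes}_A X=((Y\mathbin{\widehat\otimes}X)/N)^{\sim}$, where $N$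 is the closed linear span of all $y\cdot a\otimes x-y\otimes a\cdot x$ ($y\in Y$, $x\in X$, $a\in A$). An exact pair in an additive category with kernels and cokernels is a sequence $Y_1\xrightarrow{i}Y_2\xrightarrow{p}Y_3$ with $i=\ker p$ and $p=\operatorname{coker} i$. For complete l.c.s.'s and for right $A$-$\widehat\otimes$-modules this means: $i$ is a homeomorphism onto $p^{-1}(0)$, and $p$ is an open map onto a dense subspace of $Y_3$. For Banach spaces and Banach modules it means that $0\to Y_1\to Y_2\to Y_3\to 0$ is algebraically exact. A topological algebra $B$ (here $B=I$ with the subspace topology) has a right locally bounded approximate identity if for each $0$-neighborhood $U\subset B$ there exists $C>0$ such that for each finite subset $F\subset B$ there exists $b\in CU$ with $a-ab\in U$ for all $a\in F$. *)

(* Defs.v *)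
From HB Require Import structures.
From mathcomp Require Import all_boot all_order all_algebra.
From mathcomp Require Import all_classical all_reals all_analysis.
From mathcomp Require Import complex.

Set Implicit Arguments.
Unset Strict Implicit.
Unset Printing Implicit Defensive.

Import Order.TTheory GRing.Theory Num.Theory.
Import numFieldNormedType.Exports.

Local Open Scope classical_set_scope.
Local Open Scope ring_scope.
Local Open Scope complex_scope.

Section LocallyConvexSpaces.
Context {R : realType}.
Implicit Types E F G : tvsType R[i].

(* [tvsType] only asks its entourages to induce the vector topology, not to be
   translation invariant; completeness is therefore stated for the additive
   uniformity, determined by the neighbourhoods of 0, and not with [cauchy]. *)
Definition add_cauchy E (Fi : set_system E) :=
  forall U : set E, nbhs 0 U ->
    exists2 S : set E, Fi S & forall x y, S x -> S y -> U (x - y).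

Definition complete_lcs E :=
  hausdorff_space E /\
  forall Fi : set_system E, ProperFilter Fi -> add_cauchy Fi ->
    exists x : E, Fi --> x.

Definition is_seminorm E (p : E -> R) :=
  (forall x y, p (x + y) <= p x + p y) /\
  (forall (a : R[i]) x, p (a *: x) = Normc.normc a * p x).

Definition topology_given_by E (P : set (E -> R)) :=
  forall U : set E, nbhs 0 U <->
    exists S : set (E -> R), exists e : R,
      [/\ finite_set S, S `<=` P, 0 < e &
          [set x | forall p, S p -> p x < e] `<=` U].

Definition is_banach E :=
  complete_lcs E /\
  exists n : E -> R,
    [/\ is_seminorm n, forall x, n x = 0 -> x = 0 &
        topology_given_by [set n]].

Definition bilinear_map E F G (b : E -> F -> G) :=
  (forall x, linear (b x)) /\ (forall y, linear (b^~ y)).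

Definition jointly_continuous E F G (b : E -> F -> G) :=
  continuous (fun z : E * F => b z.1 z.2).

Definition continuous_linear E F (f : E -> F) := linear f /\ continuous f.

Definition is_subspace E (S : set E) :=
  S 0 /\ forall (a : R[i]) x y, S x -> S y -> S (a *: x + y).

Definition closed_span E (S : set E) : set E :=
  closure (smallest (@is_subspace E) S).

(* [f] is open as a map onto its range with the subspace topology. *)
Definition open_onto_range E F (f : E -> F) :=
  forall U : set E, open U -> exists2 V : set F, open V & f @` U = V `&` range f.

(* [q] exhibits [F] as the completion of [E / N], for a closed subspace [N]:
   the map induced by [q] is a homeomorphism of the (Hausdorff) space [E / N]
   with the quotient topology onto a dense subspace of the complete space [F]. *)
Definition completes_quotient E (N : set E) F (q : E -> F) :=
  [/\ complete_lcs F, continuous_linear q, q @^-1` [set 0] = N,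
      open_onto_range q & dense (range q)].

Definition exact_pair_maps E F G (i : E -> F) (p : F -> G) :=
  [/\ injective i, open_onto_range i, range i = p @^-1` [set 0],
      open_onto_range p & dense (range p)].

Definition exact_pair_lcs E F G (i : E -> F) (p : F -> G) :=
  [/\ complete_lcs E, complete_lcs F & complete_lcs G] /\
  [/\ continuous_linear i, continuous_linear p & exact_pair_maps i p].

Definition short_exact E F G (i : E -> F) (p : F -> G) :=
  [/\ injective i, range i = p @^-1` [set 0] & range p = setT].

Definition exact_pair_banach E F G (i : E -> F) (p : F -> G) :=
  [/\ is_banach E, is_banach F & is_banach G] /\
  [/\ continuous_linear i, continuous_linear p & short_exact i p].

(* The completed projective tensor product, by its universal property. *)
Definition is_tensor E F G (t : E -> F -> G) :=
  [/\ complete_lcs G, bilinear_map t, jointly_continuous t &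
      forall (Z : tvsType R[i]) (b : E -> F -> Z), complete_lcs Z ->
        bilinear_map b -> jointly_continuous b ->
        exists! g : G -> Z, continuous_linear g /\ forall x y, g (t x y) = b x y].

Definition right_locally_bounded_ai E (mul : E -> E -> E) (B : set E) :=
  (* [within B (nbhs 0)] restricted to subsets of [B]: the 0-neighbourhoods of
     [B] in the subspace topology *)
  forall U : set E, U `<=` B -> within B (nbhs 0) U ->
    exists2 c : R, 0 < c &
      forall S : set E, finite_set S -> S `<=` B ->
        exists2 b : E, B b /\ (exists2 u, U u & b = c%:C *: u) &
          forall a, S a -> U (a - mul a b).

End LocallyConvexSpaces.

Record arens_michael (R : realType) := ArensMichael {
  am_space :> tvsType R[i];
  am_mul : am_space -> am_space -> am_space;
  am_complete : complete_lcs am_space;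
  am_bilinear : bilinear_map am_mul;
  am_assoc : associative am_mul;
  am_submul : exists2 P : set (am_space -> R),
    (forall p, P p ->
       is_seminorm p /\ forall a b, p (am_mul a b) <= p a * p b) &
    topology_given_by P }.

Section Modules.
Context {R : realType}.

Definition unitization (A : arens_michael R) : tvsType R[i] :=
  (A * R[i]^o)%type.

Definition unitization_mul (A : arens_michael R) (u v : unitization A) :
    unitization A :=
  (am_mul u.1 v.1 + u.2 *: v.1 + v.2 *: u.1, u.2 * v.2).

Definition closed_left_ideal (A : arens_michael R) (I : set (unitization A)) :=
  [/\ closed I, is_subspace I &
      forall u v, I v -> I (unitization_mul u v)].

Record rmodule (A : arens_michael R) := RModule {
  rm_space :> tvsType R[i];
  ract : rm_space -> A -> rm_space;
  rm_complete : complete_lcs rm_space;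
  ract_bilinear : bilinear_map ract;
  ract_assoc : forall y a b, ract (ract y a) b = ract y (am_mul a b);
  ract_continuous : jointly_continuous ract }.

Record lmodule (A : arens_michael R) := LModule {
  lm_space :> tvsType R[i];
  lact : A -> lm_space -> lm_space;
  lm_complete : complete_lcs lm_space;
  lact_bilinear : bilinear_map lact;
  lact_assoc : forall a b x, lact a (lact b x) = lact (am_mul a b) x;
  lact_continuous : jointly_continuous lact }.

Variable A : arens_michael R.

Definition rmodule_morphism (Y Z : rmodule A) (f : Y -> Z) :=
  continuous_linear f /\ forall y a, f (ract y a) = ract (f y) a.

Definition exact_pair_rmodule (Y1 Y2 Y3 : rmodule A) (i : Y1 -> Y2)
    (p : Y2 -> Y3) :=
  [/\ rmodule_morphism i, rmodule_morphism p & exact_pair_maps i p].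

Definition exact_pair_banach_rmodule (Y1 Y2 Y3 : rmodule A) (i : Y1 -> Y2)
    (p : Y2 -> Y3) :=
  [/\ is_banach Y1, is_banach Y2 & is_banach Y3] /\
  [/\ rmodule_morphism i, rmodule_morphism p & short_exact i p].

(* [q] exhibits the left module [X] as the completion of [A_+ / I]. *)
Definition is_cyclic_completion (I : set (unitization A)) (X : lmodule A)
    (q : unitization A -> X) :=
  completes_quotient I q /\
  forall (a : A) (u : unitization A),
    q (unitization_mul (a, 0) u) = lact a (q u).

Definition balanced_relations (Y : rmodule A) (X : lmodule A)
    (P : tvsType R[i]) (t : Y -> X -> P) : set P :=
  [set z | exists y a x, z = t (ract y a) x - t y (lact a x)].

(* A model of the tensor product over [A] of [Y] and [X], i.e. of the
   completion of the quotient of the completed projective tensor product by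
   the closed span of the balancing relations; like the latter product, it is
   unique up to a unique isomorphism. *)
Record tensor_over (Y : rmodule A) (X : lmodule A) := TensorOver {
  to_tensor : tvsType R[i];
  to_pure : Y -> X -> to_tensor;
  to_space :> tvsType R[i];
  to_quot : to_tensor -> to_space;
  to_tensorP : is_tensor to_pure;
  to_quotP : completes_quotient (closed_span (balanced_relations to_pure))
               to_quot }.

Definition pure (Y : rmodule A) (X : lmodule A) (T : tensor_over Y X)
    (y : Y) (x : X) : T := to_quot (to_pure T y x).

(* [g] is the map induced by [f] on tensor products; it is uniquely determined,
   since the pure tensors span a dense subspace. *)
Definition is_tensor_map (Y Z : rmodule A) (X : lmodule A)
    (T : tensor_over Y X) (T' : tensor_over Z X) (f : Y -> Z) (g : T -> T') :=
  continuous_linear g /\ forall y x, g (pure T y x) = pure T' (f y) x.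

Definition tensor_exact (X : lmodule A) :=
  forall (Y1 Y2 Y3 : rmodule A) (i : Y1 -> Y2) (p : Y2 -> Y3),
    exact_pair_rmodule i p ->
  forall (T1 : tensor_over Y1 X) (T2 : tensor_over Y2 X)
    (T3 : tensor_over Y3 X) (iX : T1 -> T2) (pX : T2 -> T3),
    is_tensor_map i iX -> is_tensor_map p pX -> exact_pair_lcs iX pX.

Definition tensor_exact_banach (X : lmodule A) :=
  forall (Y1 Y2 Y3 : rmodule A) (i : Y1 -> Y2) (p : Y2 -> Y3),
    exact_pair_banach_rmodule i p ->
  forall (T1 : tensor_over Y1 X) (T2 : tensor_over Y2 X)
    (T3 : tensor_over Y3 X) (iX : T1 -> T2) (pX : T2 -> T3),
    is_tensor_map i iX -> is_tensor_map p pX -> exact_pair_banach iX pX.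

End Modules.

(* Main.v *)
(** For X = (A_+ / I)^~ the space Y (x)_A X is the completion of Y / cl(Y I),
    the class of y being y (x) (1 + I).  In terms of continuous seminorms, the
    functor therefore always preserves cokernels, and it is exact on a pair
    (i, p) as soon as the distance of y to Y1 I is controlled by the distance
    of i y to Y2 I.

    If b in I satisfies u b ~ u for the finitely many u in I occurring in
    m = sum_k y_k u_k, then y b lies in Y1 I while i y - i y b is close to
    (i y + m) - (i y + m) b, so the control holds with a constant that depends
    only on the bound of b.  The open mapping theorem makes an exact pair of
    Banach modules an exact pair of (x)-modules.

    For the converse no duality is needed.  Fix a submultiplicative seminorm
    |.| on A_+.  For a finite S in I and d > 0, send a in A_+ to the family
    (d a, (u a)_(u in S)); doing this for all (S, d) at once embeds a Banach
    module Y1 into a module Y2 of bounded families.  The image of the element 1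
    placed at (S, d) has distance at most d to Y2 I, because S lies in I, while
    the distance of that element to Y1 I is at least the infimum over b in I of
    max (d |1 - b|, |u - u b|).  Exactness gives one constant K comparing the
    two distances, whence some b in I with |1 - b| <= K and |u - u b| <= K d. *)

Require Import Defs.
From HB Require Import structures.
From mathcomp Require Import all_boot all_order all_algebra.
From mathcomp Require Import all_classical all_reals all_analysis.
From mathcomp Require Import complex ring lra.

Set Implicit Arguments.
Unset Strict Implicit.
Unset Printing Implicit Defensive.

Import Order.TTheory GRing.Theory Num.Theory.
Import numFieldNormedType.Exports.

Local Open Scope classical_set_scope.
Local Open Scope ring_scope.
Local Open Scope complex_scope.

(** The statement fixes tensor products and completions only by characterizing properties and
    quantifies over all their models. Conditions (ii) and (iii) would hold vacuously without models,
    so the step from (iii) to (i) has to construct them: completions, free modules and projective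
    tensor products are built here from vector spaces with seminorms.

    Throughout, topology is replaced by continuous seminorms. An embedding [i] becomes: every
    continuous [r] satisfies [r x <= s (i x)] for some continuous [s]; openness of [p] onto its
    range becomes the same kind of bound for the distance to the kernel. Such inequalities pass from
    a dense subspace to the whole space, so they are checked only on elements [y (x) (1 + I)], where
    they speak of distances to [Y I].

    In the converse, separate pairs for separate [(S, d)] would each give their own constant.
    Placing all of them in one sup-normed module forces a common one, and the weight [d] on the
    first coordinate makes the distance to [Y2 I] small while only bounding [|1 - b|]. *)

Section LinearMaps.
Context {R : realType}.
Implicit Types U V W : lmodType R[i].

Lemma linD U V (f : U -> V) : linear f -> forall x y, f (x + y) = f x + f y.
Proof. by move=> lf x y; have := lf 1 x y; rewrite !scale1r. Qed.

Lemma lin0 U V (f : U -> V) : linear f -> f 0 = 0.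
Proof. by move=> lf; have := lf (-1) 0 0; rewrite !scaleN1r oppr0 addr0 addNr. Qed.

Lemma linZ U V (f : U -> V) : linear f -> forall a x, f (a *: x) = a *: f x.
Proof. by move=> lf a x; have := lf a x 0; rewrite (lin0 lf) !addr0. Qed.

Lemma linN U V (f : U -> V) : linear f -> forall x, f (- x) = - f x.
Proof. by move=> lf x; rewrite -scaleN1r linZ// scaleN1r. Qed.

Lemma linB U V (f : U -> V) : linear f -> forall x y, f (x - y) = f x - f y.
Proof. by move=> lf x y; rewrite linD// linN. Qed.

Lemma lin_comp U V W (f : U -> V) (g : V -> W) :
  linear f -> linear g -> linear (g \o f).
Proof. by move=> lf lg a x y /=; rewrite lf lg. Qed.

Definition linsub V (S : set V) :=
  S 0 /\ forall (a : R[i]) x y, S x -> S y -> S (a *: x + y).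

Definition linspan V (S : set V) : set V := smallest (@linsub V) S.

Lemma linspan_subspace V (S : set V) : linsub (linspan S).
Proof.
split; first by move=> T [[]].
by move=> a x y Sx Sy T TS; apply: TS.1.2; [exact: Sx|exact: Sy].
Qed.

Lemma sub_linspan V (S : set V) : S `<=` linspan S.
Proof. by move=> x Sx T [_]; apply. Qed.

Lemma linspan_min V (S T : set V) : linsub T -> S `<=` T -> linspan S `<=` T.
Proof. by move=> sT ST x; apply. Qed.

Lemma subspaceD V (S : set V) x y : linsub S -> S x -> S y -> S (x + y).
Proof. by move=> sS Sx Sy; rewrite -[x]scale1r; apply: sS.2. Qed.

Lemma subspaceZ V (S : set V) a x : linsub S -> S x -> S (a *: x).
Proof. by move=> sS Sx; rewrite -[_ *: _]addr0; apply: sS.2 => //; case: sS. Qed.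

Lemma subspaceN V (S : set V) x : linsub S -> S x -> S (- x).
Proof. by move=> sS Sx; rewrite -scaleN1r; apply: subspaceZ. Qed.

Lemma subspaceB V (S : set V) x y : linsub S -> S x -> S y -> S (x - y).
Proof. by move=> sS Sx Sy; apply: subspaceD => //; apply: subspaceN. Qed.

Lemma range_subspace U V (f : U -> V) : linear f -> linsub (range f).
Proof.
move=> lf; split; first by exists 0 => //; rewrite lin0.
by move=> a _ _ [x _ <-] [y _ <-]; exists (a *: x + y) => //; exact: lf.
Qed.

Lemma kernel_subspace U V (f : U -> V) : linear f -> linsub (f @^-1` [set 0]).
Proof.
move=> lf; split; first by rewrite /= lin0.
by move=> a x y /= fx fy; rewrite lf fx fy scaler0 addr0.
Qed.

Lemma preimage_subspace U V (f : U -> V) (S : set V) :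
  linear f -> linsub S -> linsub (f @^-1` S).
Proof.
move=> lf sS; split; first by rewrite /= (lin0 lf); case: sS.
by move=> a x y /= fx fy; rewrite lf; apply: sS.2.
Qed.

End LinearMaps.

(** * Seminorms and quotient seminorms *)

Section Seminorms.
Context {R : realType}.
Implicit Types U V W : lmodType R[i].

Definition seminorm V (p : V -> R) :=
  (forall x y, p (x + y) <= p x + p y) /\
  (forall (a : R[i]) x, p (a *: x) = Normc.normc a * p x).

Lemma normc_ge0 (a : R[i]) : 0 <= Normc.normc a.
Proof. by case: a => a b; apply: sqrtr_ge0. Qed.

Lemma normc_real (t : R) : 0 <= t -> Normc.normc t%:C = t.
Proof. by move=> t0; rewrite /= expr0n addr0 sqrtr_sqr ger0_norm. Qed.

Section Basics.
Variables (V : lmodType R[i]) (p : V -> R).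
Hypothesis sp : seminorm p.

Lemma snD x y : p (x + y) <= p x + p y. Proof. by case: sp. Qed.
Lemma snZ a x : p (a *: x) = Normc.normc a * p x. Proof. by case: sp. Qed.
Lemma sn0 : p 0 = 0.
Proof. by rewrite -(scale0r 0) snZ Normc.normc0 mul0r. Qed.
Lemma snN x : p (- x) = p x.
Proof. by rewrite -scaleN1r snZ normcN Normc.normc1 mul1r. Qed.
Lemma sn_ge0 x : 0 <= p x.
Proof. by have := snD x (- x); rewrite subrr sn0 snN; lra. Qed.
Lemma snB x y : p (x - y) <= p x + p y.
Proof. by rewrite -(snN y) snD. Qed.
Lemma snC x y : p (x - y) = p (y - x).
Proof. by rewrite -snN opprB. Qed.
Lemma sn_tri y x z : p (x - z) <= p (x - y) + p (y - z).
Proof. by rewrite -[x - z](subrKA y) snD. Qed.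
Lemma sn_le_sub x y : p x <= p y + p (x - y).
Proof. by rewrite -[in p x](subrK y x) addrC snD. Qed.
Lemma snZr t x : 0 <= t -> p (t%:C *: x) = t * p x.
Proof. by move=> t0; rewrite snZ normc_real. Qed.
Lemma sn_eqN x y : p (x - y) = 0 -> p x = p y.
Proof.
move=> h; have := sn_le_sub x y; have := sn_le_sub y x.
by rewrite (snC y) h; lra.
Qed.
Lemma sn_addr0 x m : p m = 0 -> p (x + m) = p x.
Proof. by move=> pm; apply: sn_eqN; rewrite addrC addKr. Qed.

End Basics.

Lemma seminormD V (p q : V -> R) :
  seminorm p -> seminorm q -> seminorm (fun x => p x + q x).
Proof.
move=> sp sq; split => [x y|a x]; last by rewrite !snZ// mulrDr.
by have := snD sp x y; have := snD sq x y; lra.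
Qed.

Lemma seminormZ V (c : R) (p : V -> R) :
  0 <= c -> seminorm p -> seminorm (fun x => c * p x).
Proof.
move=> c0 sp; split => [x y|a x]; last by rewrite snZ// mulrCA.
by rewrite -mulrDr ler_wpM2l ?snD.
Qed.

Lemma seminorm_comp V W (f : V -> W) (p : W -> R) :
  linear f -> seminorm p -> seminorm (p \o f).
Proof.
by move=> lf sp; split => [x y|a x] /=; rewrite ?linD// ?snD// linZ// snZ.
Qed.

(** Homogeneity: rescale [x] by [1 / (q (f x) + e)]; the extra [e] also covers [q (f x) = 0]. *)
Lemma sn_le_of_ball V W (p : V -> R) (q : W -> R) (f : V -> W) :
  seminorm p -> seminorm q -> linear f ->
  (forall x, q (f x) < 1 -> p x <= 1) -> forall x, p x <= q (f x).
Proof.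
move=> sp sq lf h x; apply/ler_addgt0Pr => e e0.
have d0 : 0 < q (f x) + e by rewrite ltr_wpDl// sn_ge0.
have di : 0 <= (q (f x) + e)^-1 by rewrite invr_ge0 ltW.
have := h ((q (f x) + e)^-1%:C *: x).
rewrite (linZ lf) !snZr//.
rewrite mulrC ltr_pdivrMr// mul1r ltrDl => /(_ e0).
by rewrite mulrC ler_pdivrMr// mul1r.
Qed.

Lemma sn_homog V (p : V -> R) :
  (forall x, 0 <= p x) -> (forall a x, p (a *: x) <= Normc.normc a * p x) ->
  forall a x, p (a *: x) = Normc.normc a * p x.
Proof.
move=> p0 pZ a x; apply/eqP; rewrite eq_le pZ /=.
have [->|a0] := eqVneq a 0; first by rewrite Normc.normc0 mul0r.
have na : 0 < Normc.normc a.
  rewrite lt_neqAle normc_ge0 andbT eq_sym.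
  by apply: contra a0 => /eqP/Normc.eq0_normc ->.
have := pZ a^-1 (a *: x); rewrite scalerA mulVf// scale1r Normc.normcV => h.
by rewrite mulrC -ler_pdivlMr// mulrC.
Qed.

Section Quotient.
Variables (V : lmodType R[i]) (N : set V) (p : V -> R).
Hypotheses (sN : linsub N) (sp : seminorm p).

(** The quotient seminorm, that is the distance to [N], kept as a seminorm on [V] so that quotients
    can be estimated without forming them. *)
Definition qsn (x : V) : R := inf [set p (x + m) | m in N].

Let qlb x : has_lbound [set p (x + m) | m in N].
Proof. by exists 0 => _ [m _ <-]; apply: sn_ge0. Qed.
Let qne x : [set p (x + m) | m in N] !=set0.
Proof. by exists (p (x + 0)); exists 0 => //; case: sN. Qed.

Lemma qsn_le x m : N m -> qsn x <= p (x + m).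
Proof. by move=> Nm; apply: ge_inf => //; exists m. Qed.

Lemma qsn_le_sn x : qsn x <= p x.
Proof. by rewrite -{2}[x]addr0; apply: qsn_le; case: sN. Qed.

Lemma qsn_ge x (c : R) : (forall m, N m -> c <= p (x + m)) -> c <= qsn x.
Proof. by move=> h; apply: lb_le_inf => // _ [m Nm <-]; apply: h. Qed.

Lemma qsn_approx x (e : R) : 0 < e -> exists2 m, N m & p (x + m) < qsn x + e.
Proof.
move=> e0; have [_ [m Nm <-] lt] := inf_adherent e0 (conj (qne x) (qlb x)).
by exists m.
Qed.

Lemma qsn_ge_mul x (a c : R) : 0 <= c ->
  (forall m, N m -> a <= c * p (x + m)) -> a <= c * qsn x.
Proof.
move=> c0 h; have [c00|cn] := eqVneq c 0.
  by have := h 0 (proj1 sN); rewrite c00 !mul0r.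
have cp : 0 < c by rewrite lt_neqAle eq_sym cn.
by rewrite -ler_pdivrMl//; apply: qsn_ge => m /h; rewrite ler_pdivrMl.
Qed.

Lemma qsn_seminorm : seminorm qsn.
Proof.
split => [x y|]; last first.
  apply: sn_homog => [x|a x]; first by apply: qsn_ge => m _; apply: sn_ge0.
  apply: qsn_ge_mul => [|m Nm]; first exact: normc_ge0.
  by apply: le_trans (qsn_le _ (subspaceZ a sN Nm)) _; rewrite -scalerDr snZ.
apply/ler_addgt0Pr => e e0.
have [|m Nm ltm] := @qsn_approx x (e / 2); first by lra.
have [|n Nn ltn] := @qsn_approx y (e / 2); first by lra.
apply: le_trans (qsn_le _ (subspaceD sN Nm Nn)) _.
rewrite addrACA; apply: le_trans (snD sp _ _) _; lra.
Qed.

Lemma qsn_null m : N m -> qsn m = 0.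
Proof.
move=> Nm; apply/eqP; rewrite eq_le (sn_ge0 qsn_seminorm) andbT.
by apply: le_trans (qsn_le _ (subspaceN sN Nm)) _; rewrite subrr sn0.
Qed.

Lemma qsn_id : (forall m, N m -> p m = 0) -> forall x, qsn x = p x.
Proof.
move=> pN x; apply/eqP; rewrite eq_le qsn_le_sn /=.
by apply: qsn_ge => m Nm; rewrite sn_addr0// pN.
Qed.

End Quotient.

Lemma qsn_le_mono V (N M : set V) (p q : V -> R) (c : R) x : 
  linsub N -> linsub M -> seminorm p -> seminorm q -> 0 <= c ->
  M `<=` N -> (forall x, p x <= c * q x) -> qsn N p x <= c * qsn M q x.
Proof.
move=> sN sM sp sq c0 MN pq; apply: qsn_ge_mul => // m Mm.
by apply: le_trans (qsn_le sp x (MN _ Mm)) (pq _).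
Qed.

End Seminorms.

(** * Continuous seminorms on locally convex spaces *)

Section Gauge.
Context {R : realType}.

Lemma real_complex_eq0 (t : R) : (t%:C == 0 :> R[i]) = (t == 0).
Proof. exact: (fmorph_eq0 (real_complex R)). Qed.

Lemma nbhs_complexP (a : R[i]^o) (B : set R[i]^o) :
  nbhs a B <-> exists2 e : R, 0 < e & forall c, Normc.normc (a - c) < e -> B c.
Proof.
rewrite nbhs_ballP; split => [[[e e'] /= e0 eB]|[e e0 eB]].
  move: e0; rewrite ltcE /= => /andP[/eqP e'0 e0]; exists e => // c ce.
  apply: eB; rewrite -ball_normE /= e'0.
  by rewrite -[X in X < _]/((Normc.normc (a - c))%:C) ltcR.
exists e%:C; first by rewrite /= ltcR.
move=> c; rewrite -ball_normE /=.
by rewrite -[X in X < _]/((Normc.normc (a - c))%:C) ltcR; apply: eB.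
Qed.

Lemma convex_real_comb (V : lmodType R[i]) (A : set V) (t : R) x y :
  convex_set A -> 0 <= t <= 1 -> A x -> A y ->
  A (t%:C *: x + (1 - t)%:C *: y).
Proof.
move=> cA /andP[t0 t1] Ax Ay.
have t0' : 0 <= t%:C by rewrite lecR.
have t1' : t%:C <= 1 by rewrite (lecR t 1).
have := cA x y (Itv01 t0' t1'); rewrite !inE => /(_ Ax Ay).
rewrite /conv /= /unstable.onem.
suff -> : (1 - t)%:C = 1 - t%:C by [].
by rewrite rmorphB.
Qed.

Variable E : tvsType R[i].

(** Continuous seminorms: for a seminorm, continuity amounts to its open unit ball being a
    0-neighbourhood. *)
Definition cs (p : E -> R) := seminorm p /\ nbhs 0 [set x | p x < 1].

(** [D] is the balanced core of a convex basic neighbourhood [b]: the points whose multiples by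
    scalars of modulus at most 1 all stay in [b]. Continuity of scalar multiplication at [(0, 0)]
    makes it a neighbourhood of 0. *)
Lemma nbhs_balanced_convex (U : set E) : nbhs 0 U ->
  exists D : set E, [/\ nbhs 0 D, D `<=` U,
    forall (c : R[i]) x, Normc.normc c <= 1 -> D x -> D (c *: x) &
    forall (t : R) x y, 0 <= t <= 1 -> D x -> D y ->
      D (t%:C *: x + (1 - t)%:C *: y)].
Proof.
move=> U0; have [Bs Bc [Bo Bn]] := @locally_convex _ E.
have [b [Bsb b0] bU] := Bn _ _ U0.
have nb : nbhs 0 b by apply: open_nbhs_nbhs; split => //; exact: Bo.
exists [set x | forall c : R[i], Normc.normc c <= 1 -> b (c *: x)]; split.
- have := scale_continuous ((0 : R[i]^o), (0 : E)) b.
  rewrite /= scaler0 => /(_ nb) [[B1 B2] /= [nB1 nB2] B12].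
  have [d d0 dB] := (nbhs_complexP 0 B1).1 nB1.
  have dn0 : (d / 2)%:C != 0 :> R[i] by rewrite real_complex_eq0; apply: lt0r_neq0; lra.
  apply: filterS (nbhs0Z dn0 nB2) => _ [x B2x <-] c c1.
  rewrite scalerA; apply: (B12 (c * (d / 2)%:C, x)); split => //=; apply: dB.
  rewrite sub0r normcN Normc.normcM normc_real; last lra.
  by apply: le_lt_trans (ler_wpM2r _ c1) _; lra.
- by move=> x /(_ 1); rewrite Normc.normc1 scale1r => /(_ (lexx _)) /bU.
- move=> c x c1 Dx c' c'1; rewrite scalerA; apply: Dx.
  rewrite Normc.normcM.
  by rewrite mulr_ile1// normc_ge0.
- move=> t x y t01 Dx Dy c c1; rewrite scalerDr !scalerA ![c * _]mulrC -!scalerA.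
  by apply: convex_real_comb => //; [apply: Bc; rewrite inE|exact: Dx|exact: Dy].
Qed.

Lemma scale_nbhs0 (D : set E) (x : E) :
  nbhs 0 D -> exists2 t : R, 0 < t & D (t^-1%:C *: x).
Proof.
move=> nD; have := scale_continuous ((0 : R[i]^o), x) D.
rewrite /= scale0r => /(_ nD) [[B1 B2] /= [nB1 nB2] B12].
have [d d0 dB] := (nbhs_complexP 0 B1).1 nB1.
exists (d / 2)^-1; first by rewrite invr_gt0; lra.
rewrite invrK; apply: (B12 ((d/2)%:C, x)); split => /=; last exact: nbhs_singleton.
by apply: dB; rewrite sub0r normcN normc_real; lra.
Qed.

(** [p] is the Minkowski functional of a balanced convex neighbourhood contained in [U]. *)
Lemma gauge (U : set E) : nbhs 0 U -> exists2 p, cs p & [set x | p x < 1] `<=` U.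
Proof.
move=> /nbhs_balanced_convex [D [nD DU Dbal Dconv]].
pose G x := [set t : R | 0 < t /\ D (t^-1%:C *: x)].
have Gne x : G x !=set0 by have [t t0 Dt] := scale_nbhs0 x nD; exists t.
have Glb x : has_lbound (G x) by exists 0 => t [/ltW].
pose p x := inf (G x).
have p0 x : 0 <= p x by apply: lb_le_inf => // t [/ltW].
have ple x t : 0 < t -> D (t^-1%:C *: x) -> p x <= t by move=> *; apply: ge_inf.
have pap x e : 0 < e -> exists t, [/\ 0 < t, D (t^-1%:C *: x) & t < p x + e].
  move=> e0; have [t [t0 Dt] lt] := inf_adherent e0 (conj (Gne x) (Glb x)).
  by exists t.
have pD x : p x < 1 -> D x.
  move=> px; have [|t [t0 Dt tlt]] := pap x (1 - p x); first lra.
  rewrite -[x]scale1r -(@divff _ t%:C) -?scalerA ?real_complex_eq0 ?gt_eqF//.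
  rewrite -[X in _ *: X](_ : t^-1%:C *: x = _); last by rewrite fmorphV.
  by apply: Dbal => //; rewrite normc_real; lra.
have D0 : D 0 by apply: nbhs_singleton.
have sp : seminorm p.
  split; last first.
    apply: sn_homog => // a x.
    have [->|a0] := eqVneq a 0.
      rewrite scale0r Normc.normc0 mul0r; apply/ler_addgt0Pr => e e0.
      by rewrite add0r; apply: ple => //; rewrite scaler0.
    have na : 0 < Normc.normc a.
      rewrite lt_neqAle normc_ge0 andbT eq_sym.
      by apply: contra a0 => /eqP/Normc.eq0_normc ->.
    rewrite -ler_pdivrMl//; apply/ler_addgt0Pr => e e0.
    have [t [t0 Dt tlt]] := pap x e e0.
    rewrite ler_pdivrMl//; apply: (@le_trans _ _ (Normc.normc a * t)); last first.
      by rewrite ler_pM2l// ltW.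
    apply: ple; first exact: mulr_gt0.
    rewrite scalerA; set k := (k in D (k *: _)).
    have -> : k = k / t^-1%:C * t^-1%:C.
      by rewrite divfK// real_complex_eq0 invr_eq0 gt_eqF.
    rewrite -scalerA; apply: Dbal => //.
    rewrite Normc.normcM Normc.normcV /k Normc.normcM !normc_real ?invr_ge0 ?mulr_ge0 ?normc_ge0 ?(ltW t0)//.
    rewrite invfM invrK.
    have -> : (Normc.normc a)^-1 / t * Normc.normc a * t = 1; last by [].
    by field; rewrite !gt_eqF.
  move=> x y; apply/ler_addgt0Pr => e e0.
  have [|s [s0 Ds slt]] := pap x (e / 2); first lra.
  have [|t [t0 Dt tlt]] := pap y (e / 2); first lra.
  apply: (@le_trans _ _ (s + t)); last lra.
  have st : 0 < s + t by lra.
  apply: ple => //.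
  (* [(x + y) / (s + t)] is the convex combination of [x / s] and [y / t] with weights [s / (s + t)]
     and [t / (s + t)]. *)
  have := Dconv (s / (s + t)) _ _ _ Ds Dt.
  have h : 0 <= s / (s + t) <= 1.
    by apply/andP; split; [apply: divr_ge0; lra|rewrite ler_pdivrMr// mul1r; lra].
  move=> /(_ h).
  rewrite !scalerA scalerDr -!rmorphM.
  have -> : s / (s + t) / s = (s + t)^-1 by field; rewrite !gt_eqF.
  have -> : (1 - s / (s + t)) / t = (s + t)^-1; last by [].
  by field; rewrite !gt_eqF.
exists p; last by move=> x /pD /DU.
split => //.
(* On [D] itself only [p <= 1] is known, so the open unit ball is shown to contain [D / 2]. *)
have h2 : (2^-1 : R)%:C != 0 :> R[i] by rewrite real_complex_eq0; apply: lt0r_neq0; lra.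
apply: filterS (nbhs0Z h2 nD) => _ [x Dx <-] /=.
rewrite (snZr sp); last lra.
suff : p x <= 1 by lra.
by apply: ple => //; rewrite invr1 scale1r.
Qed.

Lemma cs_ball p (e : R) : cs p -> 0 < e -> nbhs 0 [set x | p x < e].
Proof.
move=> [sp np] e0; have en : e%:C != 0 :> R[i] by rewrite real_complex_eq0 gt_eqF.
apply: filterS (nbhs0Z en np) => _ [x /= px <-].
by rewrite snZr ?ltW// gtr_pMr.
Qed.

Lemma cs_of_le p q (c : R) : seminorm p -> 0 <= c -> cs q ->
  (forall x, p x <= c * q x) -> cs p.
Proof.
move=> sp c0 cq pq; split => //.
have c1 : 0 < (c + 1)^-1 by rewrite invr_gt0; lra.
apply: filterS (cs_ball cq c1) => x /= qx.
apply: le_lt_trans (pq x) _.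
apply: le_lt_trans (ler_wpM2l c0 (ltW qx)) _.
by rewrite ltr_pdivrMr; lra.
Qed.

Lemma csD p q : cs p -> cs q -> cs (fun x => p x + q x).
Proof.
move=> cp cq; split; first by apply: seminormD; [case: cp|case: cq].
have h : 0 < (2^-1 : R) by lra.
by apply: filterS (filterI (cs_ball cp h) (cs_ball cq h)) => x /= []; lra.
Qed.

Lemma csZ (c : R) p : 0 <= c -> cs p -> cs (fun x => c * p x).
Proof.
by move=> c0 cp; apply: (cs_of_le _ c0 cp) => //; apply: seminormZ => //; case: cp.
Qed.

Lemma cs0 : cs (fun=> 0).
Proof.
split; first by split => [x y|a x]; rewrite ?addr0// mulr0.
by apply: filterS filterT => x _ /=; apply: ltr01.
Qed.

Lemma nbhs_shift (x : E) (U : set E) : nbhs x U -> nbhs 0 [set z | U (x + z)].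
Proof.
move=> /(nbhsB (- x)); rewrite addNr.
by apply: filterS => _ [y Uy <-] /=; rewrite addNKr.
Qed.

Lemma nbhs_csP (x : E) (U : set E) :
  nbhs x U <-> exists2 p, cs p & forall y, p (y - x) < 1 -> U y.
Proof.
split => [/nbhs_shift /gauge [p cp pU]|[p [sp np] pU]].
  by exists p => // y /pU /=; rewrite addrC subrK.
apply: filterS (nbhsT x np) => _ [y /= py <-].
by apply: pU; rewrite addrC addKr.
Qed.

Lemma nbhs_cs_ball (x : E) p (e : R) :
  cs p -> 0 < e -> nbhs x [set y | p (y - x) < e].
Proof.
move=> cp e0; apply/nbhs_csP; exists (fun z => e^-1 * p z).
  by apply: csZ => //; rewrite invr_ge0 ltW.
by move=> y; rewrite mulrC ltr_pdivrMr// mul1r.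
Qed.

Lemma closure_csP (S : set E) (x : E) :
  closure S x <-> forall p, cs p -> exists2 y, S y & p (y - x) < 1.
Proof.
split => [cl p cp|h B /nbhs_csP [p cp pB]].
  by have [y [Sy py]] := cl _ (nbhs_cs_ball x cp ltr01); exists y.
by have [y Sy /pB By] := h p cp; exists y.
Qed.

Lemma closure_cs_ball (S : set E) (x : E) p (e : R) :
  closure S x -> cs p -> 0 < e -> exists2 y, S y & p (y - x) < e.
Proof.
move=> cl cp e0; have [y [Sy py]] := cl _ (nbhs_cs_ball x cp e0).
by exists y.
Qed.

Lemma dense_closureP (S : set E) : dense S <-> forall x, closure S x.
Proof.
split => [dS x B|cS O [x Ox] oO].
  rewrite nbhsE => -[B' [oB' B'x] B'B].
  have [|y [B'y Sy]] := dS B' _ oB'; first by exists x.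
  by exists y; split => //; apply: B'B.
by have [|y []] := cS x O; [exact: open_nbhs_nbhs|exists y].
Qed.

Lemma hausdorff_csP :
  hausdorff_space E <-> forall x, (forall p, cs p -> p x = 0) -> x = 0.
Proof.
split => [hE x px|h x y cxy].
  apply: hE => A B /nbhs_csP [p cp pA] /nbhs_csP [q cq qB].
  exists x; split; first by apply: pA; rewrite subrr sn0//; case: cp.
  by apply: qB; rewrite subr0 px.
apply/eqP; rewrite -subr_eq0; apply/eqP; apply: h => p cp.
apply/eqP; rewrite eq_le sn_ge0 ?andbT; last by case: cp.
apply/ler_addgt0Pr => e e0.
have e2 : 0 < e / 2 by lra.
have [z [/= zx zy]] := cxy _ _ (nbhs_cs_ball x cp e2) (nbhs_cs_ball y cp e2).
rewrite add0r; have := sn_tri (proj1 cp) z x y.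
by rewrite [p (x - z)]snC; [lra|case: cp].
Qed.

(** The means by which estimates in completions and tensor products are reduced to elements of a
    dense range. *)
Lemma dense_le (S : set E) (p q : E -> R) : dense S -> cs p -> cs q ->
  (forall x, S x -> p x <= q x) -> forall x, p x <= q x.
Proof.
move=> /dense_closureP dS cp cq pq x; apply/ler_addgt0Pr => e e0.
have e2 : 0 < e / 2 by lra.
have [y Sy] := closure_cs_ball (dS x) (csD cp cq) e2.
have := sn_le_sub (proj1 cp) x y; have := sn_le_sub (proj1 cq) y x.
have := sn_ge0 (proj1 cp) (y - x); have := sn_ge0 (proj1 cq) (y - x).
rewrite [p (x - y)]snC; last by case: cp.
by have := pq y Sy; lra.
Qed.

Lemma subspace_closure (S : set E) : linsub S -> linsub (closure S).
Proof.
move=> sS; split; first by apply: subset_closure; case: sS.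
move=> a x y cx cy; apply/closure_csP => p cp.
have a1 : 0 < (Normc.normc a + 1)^-1 / 2.
  by rewrite divr_gt0// invr_gt0 ltr_wpDl// normc_ge0.
have [x' Sx' px'] := closure_cs_ball cx cp a1.
have h : 0 < (2^-1 : R) by lra.
have [y' Sy' py'] := closure_cs_ball cy cp h.
exists (a *: x' + y'); first exact: sS.2.
rewrite opprD addrACA -scalerBr.
apply: le_lt_trans (snD (proj1 cp) _ _) _; rewrite snZ; last by case: cp.
have : Normc.normc a * p (x' - x) <= Normc.normc a * ((Normc.normc a + 1)^-1 / 2).
  by rewrite ler_wpM2l ?normc_ge0 ?ltW.
have : Normc.normc a * ((Normc.normc a + 1)^-1 / 2) <= 2^-1.
  rewrite mulrA -[leRHS]mul1r ler_pM2r// ler_pdivrMr ?mul1r; last by rewrite ltr_wpDl// normc_ge0.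
  by lra.
lra.
Qed.

Lemma closure_sn0 (S : set E) (p : E -> R) x : cs p ->
  (forall y, S y -> p y = 0) -> closure S x -> p x = 0.
Proof.
move=> cp pS cl; apply/eqP; rewrite eq_le sn_ge0 ?andbT; last by case: cp.
apply/ler_addgt0Pr => e e0; have [y Sy py] := closure_cs_ball cl cp e0.
have := sn_le_sub (proj1 cp) x y; rewrite (pS y Sy) snC; last by case: cp.
by lra.
Qed.

Lemma cs_qsn (N : set E) p : linsub N -> cs p -> cs (qsn N p).
Proof.
move=> sN cp; apply: (cs_of_le _ ler01 cp).
  by apply: qsn_seminorm => //; case: cp.
by move=> x; rewrite mul1r; apply: qsn_le_sn => //; case: cp.
Qed.

End Gauge.

(** * Linear and bilinear maps in terms of continuous seminorms *)

Section Maps.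
Context {R : realType}.
Implicit Types E F G Z : tvsType R[i].

Lemma cs_comp E F (f : E -> F) s : continuous_linear f -> cs s -> cs (s \o f).
Proof.
move=> [lf cf] cS; split; first by apply: seminorm_comp => //; case: cS.
by have := cf 0 [set y | s y < 1]; rewrite /= (lin0 lf) => /(_ (proj2 cS)).
Qed.

Lemma continuous_of_cs E F (f : E -> F) :
  linear f -> (forall s, cs s -> cs (s \o f)) -> continuous_linear f.
Proof.
move=> lf h; split => // x U /nbhs_csP [s cS sU].
apply/nbhs_csP; exists (s \o f); first exact: h.
by move=> y; rewrite /= (linB lf); apply: sU.
Qed.

Lemma continuous_linear_comp E F G (f : E -> F) (g : F -> G) :
  continuous_linear f -> continuous_linear g -> continuous_linear (g \o f).
Proof.
move=> cf cg; apply: continuous_of_cs; first by apply: lin_comp; [case: cf|case: cg].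
by move=> s cS; apply: (cs_comp cf (s := s \o g)); apply: cs_comp.
Qed.

Lemma dense_eq E F (S : set E) (f g : E -> F) : hausdorff_space F -> dense S ->
  continuous_linear f -> continuous_linear g -> (forall x, S x -> f x = g x) ->
  f =1 g.
Proof.
move=> /hausdorff_csP hF dS cf cg fg x; apply/eqP; rewrite -subr_eq0; apply/eqP.
apply: hF => p cp.
have cfg : continuous_linear (fun x => f x - g x).
  apply: continuous_of_cs => [a u v|s cS].
    by rewrite (proj1 cf) (proj1 cg) scalerBr opprD addrACA.
  apply: (cs_of_le _ ler01 (csD (cs_comp cf cS) (cs_comp cg cS))).
    split => [u v|a u] /=.
      rewrite (linD (proj1 cf)) (linD (proj1 cg)) opprD addrACA.
      exact: snD (proj1 cS) _ _.
    by rewrite (linZ (proj1 cf)) (linZ (proj1 cg)) -scalerBr (snZ (proj1 cS)).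
  by move=> u; rewrite mul1r; apply: snB (proj1 cS) _ _.
apply: (closure_sn0 (cs_comp cfg cp) _ ((dense_closureP S).1 dS x)).
by move=> y Sy /=; rewrite fg// subrr (sn0 (proj1 cp)).
Qed.

(** Continuity at the origin gives a bound on unit balls, and homogeneity in each variable spreads
    it; conversely the bound controls the three terms in the expansion of [b x y - b x0 y0]. *)
Lemma jointly_continuous_csP E F G (b : E -> F -> G) : bilinear_map b ->
  jointly_continuous b <-> forall r, cs r -> exists p q,
    [/\ cs p, cs q & forall x y, r (b x y) <= p x * q y].
Proof.
move=> [bl br]; split => [cb r cr|h].
  have := cb (0, 0) [set z | r z < 1].
  rewrite /= (lin0 (bl 0)) => /(_ (proj2 cr)) [[B1 B2] /= [/nbhs_csP [p cp pB] /nbhs_csP [q cq qB]] B12].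
  have h1 x y : p x < 1 -> q y < 1 -> r (b x y) < 1.
    move=> px qy; apply: (B12 (x, y)); split => /=.
      by apply: pB; rewrite subr0.
    by apply: qB; rewrite subr0.
  have h2 x y : q y < 1 -> r (b x y) <= p x.
    move=> qy; apply: (@sn_le_of_ball _ _ _ (fun x => r (b x y)) p id).
    - exact: (seminorm_comp (br y) (proj1 cr)).
    - by case: cp.
    - by [].
    - by move=> u pu; apply: ltW; apply: h1.
  exists p, q; split => // x y.
  (* If [p x = 0] there is no dividing by it; [h2] applied to small multiples of [y] gives
     [r (b x y) <= 0] instead. *)
  have [px0|px0] := eqVneq (p x) 0.
    rewrite px0 mul0r.
    apply: (@sn_le_of_ball _ _ _ (fun y => r (b x y)) (fun=> 0) id).
    - exact: (seminorm_comp (bl x) (proj1 cr)).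
    - by case: (@cs0 R F).
    - by [].
    move=> u _; have qu : 0 < (q u + 1)^-1.
      by rewrite invr_gt0 ltr_wpDl// sn_ge0//; case: cq.
    have := @h2 x ((q u + 1)^-1%:C *: u).
    rewrite (snZr (proj1 cq)) ?(ltW qu)// (linZ (bl x)) (snZr (proj1 cr)) ?(ltW qu)// px0.
    rewrite mulrC ltr_pdivrMr ?mul1r ?ltrDl ?ltr01; last first.
      by rewrite ltr_wpDl// sn_ge0//; case: cq.
    by move=> /(_ isT); rewrite pmulr_rle0// => /le_trans; apply.
  have ppx : 0 < p x by rewrite lt_neqAle eq_sym px0 sn_ge0//; case: cp.
  rewrite -ler_pdivrMl//.
  apply: (@sn_le_of_ball _ _ _ (fun y => (p x)^-1 * r (b x y)) q id) => //.
  - apply: seminormZ; first by rewrite invr_ge0 ltW.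
    exact: (seminorm_comp (bl x) (proj1 cr)).
  - by case: cq.
  - by move=> u /h2; rewrite ler_pdivrMl// mulr1.
move=> [x0 y0] U /nbhs_csP [r cr rU].
have [p [q [cp cq pq]]] := h r cr.
have P0 := sn_ge0 (proj1 cp); have Q0 := sn_ge0 (proj1 cq).
(* With this [e] the three error terms sum to at most [e * (1 + p x0 + q y0) = 1 - e]. *)
pose e := (p x0 + q y0 + 2)^-1.
have e0 : 0 < e by rewrite invr_gt0; have := P0 x0; have := Q0 y0; lra.
have e1 : e * (p x0 + q y0 + 2) = 1.
  by rewrite mulVf// gt_eqF//; have := P0 x0; have := Q0 y0; lra.
exists ([set x | p (x - x0) < e], [set y | q (y - y0) < e]).
  by split; apply: nbhs_cs_ball.
move=> [x y] [/= px qy]; apply: rU => /=.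
have -> : b x y - b x0 y0 = b (x - x0) (y - y0) + b (x - x0) y0 + b x0 (y - y0).
  rewrite (linB (bl x0)) (linB (bl (x - x0))) subrK.
  by rewrite -[b (x - x0) y](_ : b x y - b x0 y = _) ?subrKA// (linB (br y)).
have := snD (proj1 cr) (b (x - x0) (y - y0) + b (x - x0) y0) (b x0 (y - y0)).
have := snD (proj1 cr) (b (x - x0) (y - y0)) (b (x - x0) y0).
have := pq (x - x0) (y - y0); have := pq (x - x0) y0; have := pq x0 (y - y0).
have a1 : p (x - x0) * q (y - y0) <= e * e by apply: ler_pM => //; apply: ltW.
have a2 : p (x - x0) * q y0 <= e * q y0 by rewrite ler_wpM2r// ltW.
have a3 : p x0 * q (y - y0) <= p x0 * e by rewrite ler_wpM2l// ltW.
have a4 : e * e <= e * 1.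
  rewrite ler_wpM2l ?(ltW e0)// -e1 -[leLHS]mulr1 ler_wpM2l ?(ltW e0)//.
  by have := P0 x0; have := Q0 y0; lra.
move: e1 a1 a2 a3 a4; rewrite !mulrDr [p x0 * e]mulrC; lra.
Qed.

(** If [s (f x) < 1] then [f x = f u] for some [u] in the unit ball of [r], and [u - x] lies in the
    kernel; so openness yields a bound on the distance to the kernel. *)
Lemma open_onto_range_cs E F (f : E -> F) r : linear f -> open_onto_range f ->
  cs r -> exists2 s, cs s & forall x, qsn (f @^-1` [set 0]) r x <= s (f x).
Proof.
move=> lf fo cr.
have := proj2 cr; rewrite nbhsE => -[U [oU U0] Ur].
have [V oV fUV] := fo U oU.
have : V 0.
  have : (f @` U) 0 by exists 0; rewrite ?(lin0 lf).
  by rewrite fUV => -[].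
move=> V0; have /gauge [s cS sV] : nbhs 0 V by apply: open_nbhs_nbhs.
have sN := kernel_subspace lf.
exists s => //; apply: sn_le_of_ball => //.
- by apply: qsn_seminorm => //; case: cr.
- by case: cS.
move=> x /sV Vfx.
have : (f @` U) (f x) by rewrite fUV; split => //; exists x.
move=> [u Uu fux]; apply: le_trans (ltW (Ur _ Uu)).
rewrite -[u in leRHS](subrK x) addrC; apply: qsn_le; first by case: cr.
by rewrite /= (linB lf) fux subrr.
Qed.

(** Here [N] is any subspace on which [f] vanishes. This suits exactness proofs, where the kernel is
    identified with [range i] separately. *)
Lemma open_onto_range_of_cs E F (f : E -> F) (N : set E) :
  linear f -> linsub N -> (forall x, N x -> f x = 0) ->
  (forall r, cs r -> exists2 s, cs s & forall x, qsn N r x <= s (f x)) ->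
  open_onto_range f.
Proof.
move=> lf sN Nf h U oU.
(* The union of those [s]-balls around points [f x] whose trace on the range of [f] lies in the
   image of [U]. *)
exists [set y | exists x s, [/\ cs s, s (y - f x) < 1 &
    forall x', s (f x' - f x) < 1 -> exists2 u, U u & f u = f x']].
  rewrite openE => y [x [s [cS sy sU]]].
  have d0 : 0 < 1 - s (y - f x) by lra.
  apply: filterS (nbhs_cs_ball y cS d0) => z /= sz; exists x, s; split => //.
  by have := sn_tri (proj1 cS) y z (f x); lra.
apply/seteqP; split => [_ [x Ux <-]|y [[x [s [cS sy sU]]] [x' _ fx']]]; last first.
  rewrite -fx' in sy *.
  by have [u Uu fu] := sU x' sy; exists u.
split; last by exists x.
have /nbhs_csP [r cr rU] : nbhs x U by apply: open_nbhs_nbhs.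
have [s cS rs] := h r cr.
exists x, s; split => //; first by rewrite subrr (sn0 (proj1 cS)).
move=> x'; rewrite -(linB lf) => sx'.
have := rs (x' - x) => /le_lt_trans /(_ sx') q1.
have d0 : 0 < 1 - qsn N r (x' - x) by lra.
have [m Nm rm] := qsn_approx sN (proj1 cr) (x' - x) d0.
exists (x' + m); last by rewrite (linD lf) (Nf m Nm) addr0.
by apply: rU; rewrite addrAC; lra.
Qed.

Lemma open_onto_range_descend E F (f : E -> F) r : linear f -> open_onto_range f ->
  cs r -> (forall x, f x = 0 -> r x = 0) ->
  exists2 s, cs s & forall x, r x <= s (f x).
Proof.
move=> lf fo cr rf; have [s cS rs] := open_onto_range_cs lf fo cr.
exists s => // x; rewrite -(@qsn_id _ _ (f @^-1` [set 0]) r) //.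
  exact: kernel_subspace.
by case: cr.
Qed.

End Maps.

(** * Extension by continuity *)

Section Extension.
Context {R : realType}.
Variables (V : lmodType R[i]) (W Z : tvsType R[i]).
Variables (iota : V -> W) (f : V -> Z).
Hypotheses (li : linear iota) (lf : linear f) (cZ : complete_lcs Z).
Hypothesis fi : forall s, cs s -> exists2 t, cs t & forall x, s (f x) <= t (iota x).

(* [z] is the limit of [f x] as [iota x] tends to [w]. *)
Definition limit_pair (w : W) (z : Z) := forall s t, cs s -> cs t ->
  exists x, t (iota x - w) < 1 /\ s (f x - z) < 1.

Lemma limit_pair_eps w z s t (e : R) : limit_pair w z -> cs s -> cs t -> 0 < e ->
  exists x, t (iota x - w) < e /\ s (f x - z) < e.
Proof.
move=> L cS ct e0.
have e1 : 0 <= e^-1 by rewrite invr_ge0 ltW.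
have [x []] := L _ _ (csZ e1 cS) (csZ e1 ct).
by rewrite ![e^-1 * _]mulrC !ltr_pdivrMr// !mul1r; exists x.
Qed.

(** One estimate for two purposes: [w = w'] gives uniqueness of limits, [w' = 0] gives the bounds
    for the extension. *)
Lemma limit_pair_le w z w' z' s t : limit_pair w z -> limit_pair w' z' ->
  cs s -> cs t -> (forall x, s (f x) <= t (iota x)) -> s (z - z') <= t (w - w').
Proof.
move=> L L' cS ct st; apply/ler_addgt0Pr => e e0.
have e4 : 0 < e / 4 by lra.
have [x [tx sx]] := limit_pair_eps L cS ct e4.
have [x' [tx' sx']] := limit_pair_eps L' cS ct e4.
have ss := proj1 cS; have ts := proj1 ct.
have := sn_tri ss (f x) z z'; have := sn_tri ss (f x') (f x) z'.
rewrite [s (z - f x)](snC ss) -(linB lf).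
have := st (x - x'); rewrite (linB li).
have := sn_tri ts w (iota x) (iota x'); have := sn_tri ts w' w (iota x').
rewrite [t (w' - iota x')](snC ts); lra.
Qed.

Lemma limit_pair_uniq w z z' : limit_pair w z -> limit_pair w z' -> z = z'.
Proof.
move=> L L'; apply/eqP; rewrite -subr_eq0; apply/eqP.
have /hausdorff_csP hZ := proj1 cZ; apply: hZ => s cS.
have [t ct st] := fi cS; have := limit_pair_le L L' cS ct st.
rewrite subrr (sn0 (proj1 ct)) => sle; apply/eqP; rewrite eq_le sle.
exact: sn_ge0 (proj1 cS) _.
Qed.

Lemma limit_pair_lin a w z w' z' : limit_pair w z -> limit_pair w' z' ->
  limit_pair (a *: w + w') (a *: z + z').
Proof.
move=> L L' s t cS ct.
have a0 : 0 < Normc.normc a + 1 by rewrite ltr_wpDl// normc_ge0.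
have e0 : 0 < (Normc.normc a + 1)^-1 / 2 by rewrite divr_gt0// invr_gt0.
have e2 : 0 < (2^-1 : R) by lra.
have [x [tx sx]] := limit_pair_eps L cS ct e0.
have [x' [tx' sx']] := limit_pair_eps L' cS ct e2.
have k (r e1 : R) : r < (Normc.normc a + 1)^-1 / 2 -> e1 < 2^-1 ->
    Normc.normc a * r + e1 < 1.
  move=> hr he; apply: (@lt_le_trans _ _ (Normc.normc a * ((Normc.normc a + 1)^-1 / 2) + 2^-1)).
    by apply: ler_ltD => //; rewrite ler_wpM2l ?normc_ge0 ?ltW.
  have : Normc.normc a * ((Normc.normc a + 1)^-1 / 2) <= 2^-1.
    rewrite mulrA -[leRHS]mul1r ler_pM2r// ler_pdivrMr// mul1r; lra.
  lra.
exists (a *: x + x'); rewrite li lf; split.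
  rewrite opprD addrACA -scalerBr; apply: le_lt_trans (snD (proj1 ct) _ _) _.
  by rewrite (snZ (proj1 ct)); apply: k.
rewrite opprD addrACA -scalerBr; apply: le_lt_trans (snD (proj1 cS) _ _) _.
by rewrite (snZ (proj1 cS)); apply: k.
Qed.

Lemma limit_pair_iota x : limit_pair (iota x) (f x).
Proof.
by move=> s t cS ct; exists x; rewrite !subrr (sn0 (proj1 cS)) (sn0 (proj1 ct)) ltr01.
Qed.

Lemma limit_pair_exists w : closure (range iota) w -> exists z, limit_pair w z.
Proof.
move=> cw.
(* The filter of images under [f] of the sets of [x] with [iota x] near [w]; it is proper because
   [w] is in the closure of the range, and Cauchy by [fi]. *)
pose Fi : set_system Z :=
  [set A | exists2 t, cs t & forall x, t (iota x - w) < 1 -> A (f x)].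
have FF : ProperFilter Fi.
  split.
    move=> [t ct /= h]; have [_ [x _ <-] tx] := (closure_csP _ _).1 cw t ct.
    exact: h x tx.
  split.
  - by exists (fun=> 0); [exact: cs0|].
  - move=> A B [t ct tA] [t' ct' tB].
    exists (fun x => t x + t' x); first exact: csD.
    move=> x; have := sn_ge0 (proj1 ct) (iota x - w).
    have := sn_ge0 (proj1 ct') (iota x - w) => h h' hh.
    by split; [apply: tA|apply: tB]; lra.
  - by move=> A B AB [t ct tA]; exists t => // x /tA /AB.
have cF : add_cauchy Fi.
  move=> U /gauge [s cS sU].
  have [t ct st] := fi cS.
  exists [set y | exists2 x, 2 * t (iota x - w) < 1 & y = f x].
    exists (fun x => 2 * t x); first by apply: csZ => //; lra.
    by move=> x tx; exists x.
  move=> _ _ [x tx ->] [y ty ->]; apply: sU; rewrite /= -(linB lf).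
  apply: le_lt_trans (st _) _; rewrite (linB li).
  have := sn_tri (proj1 ct) w (iota x) (iota y).
  by rewrite [t (w - _)](snC (proj1 ct)); lra.
have [z zF] := proj2 cZ Fi FF cF.
exists z => s t cS ct.
have [t' ct' ht'] := zF _ (nbhs_cs_ball z cS ltr01).
have [_ [x _ <-] tx] := (closure_csP _ _).1 cw _ (csD ct ct').
exists x; have := sn_ge0 (proj1 ct) (iota x - w).
have := sn_ge0 (proj1 ct') (iota x - w) => h h'.
by split; [lra|apply: ht'; lra].
Qed.

(** The last clause transports each individual estimate; norm bounds of extended maps come from
    it. *)
Lemma extension : dense (range iota) -> exists g : W -> Z,
  [/\ continuous_linear g, forall x, g (iota x) = f x &
    forall s t, cs s -> cs t -> (forall x, s (f x) <= t (iota x)) ->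
      forall w, s (g w) <= t w].
Proof.
move=> /dense_closureP di.
have [g gL] := choice (fun w => limit_pair_exists (di w)).
have gi x : g (iota x) = f x := limit_pair_uniq (gL _) (limit_pair_iota x).
have lg : linear g.
  by move=> a x y; apply: limit_pair_uniq (gL _) (limit_pair_lin _ (gL x) (gL y)).
have gb s t : cs s -> cs t -> (forall x, s (f x) <= t (iota x)) ->
    forall w, s (g w) <= t w.
  move=> cS ct st w; have := limit_pair_le (gL w) (gL 0) cS ct st.
  by rewrite (lin0 lg) !subr0.
exists g; split => //; apply: continuous_of_cs => // s cS.
have [t ct st] := fi cS; apply: (cs_of_le _ ler01 ct).
  exact: seminorm_comp (proj1 cS).
by move=> w; rewrite mul1r; apply: gb.
Qed.

End Extension.

Section CompleteEmbedding.
Context {R : realType}.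

(** The inverse of [f] is extended: with [iota := f] and [f := id], points of [E] whose images
    approach [w] form a Cauchy filter of [E], and [f] maps its limit to [w]. *)
Lemma complete_embedding_closed (E F : tvsType R[i]) (f : E -> F) w :
  complete_lcs E -> hausdorff_space F -> continuous_linear f ->
  (forall r, cs r -> exists2 s, cs s & forall x, r x <= s (f x)) ->
  closure (range f) w -> range f w.
Proof.
move=> cE /hausdorff_csP hF cf h cw.
have [z L] := @limit_pair_exists _ _ _ _ f id (proj1 cf) (fun _ _ _ => erefl) cE h w cw.
exists z => //; apply/eqP; rewrite -subr_eq0; apply/eqP; apply: hF => p cp.
apply/eqP; rewrite eq_le (sn_ge0 (proj1 cp)) andbT; apply/ler_addgt0Pr => e e0.
have e2 : 0 < e / 2 by lra.
have [x [px sx]] := limit_pair_eps L (cs_comp cf cp) cp e2.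
rewrite /= (linB (proj1 cf)) in sx.
have := sn_tri (proj1 cp) (f x) (f z) w.
by rewrite [p (f z - f x)](snC (proj1 cp)); lra.
Qed.

End CompleteEmbedding.

(** * Completions *)

Section Subquotient.
Context {R : realType}.

Section Construction.
Variables (V : lmodType R[i]) (S N : set V).
Hypotheses (sS : linsub S) (sN : linsub N) (NS : N `<=` S).

Definition coset_rep (x : V) : V := choose (fun y => `[< N (x - y) >]) x.

Lemma coset_repP x : N (x - coset_rep x).
Proof.
apply/asboolP; apply: (@chooseP _ (fun y => `[< N (x - y) >]) x).
by apply/asboolP; rewrite subrr; case: sN.
Qed.

(** Congruent elements define extensionally equal predicates, so [choose] returns the same
    representative; cosets thereby get Leibniz equality. *)
Lemma coset_rep_eq x y : N (x - y) -> coset_rep x = coset_rep y.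
Proof.
move=> Nxy; rewrite /coset_rep.
have NP z : `[< N (x - z) >] = `[< N (y - z) >].
  apply: asbool_equiv_eq; split => h.
    have -> : y - z = (x - z) - (x - y) by rewrite opprB [RHS]addrC subrKA.
    exact: subspaceB.
  by rewrite -(subrKA y); apply: subspaceD.
rewrite -(eq_choose NP); apply: choose_id; apply/asboolP => //.
by rewrite subrr; case: sN.
Qed.

Lemma coset_rep_in x : S x -> S (coset_rep x).
Proof.
move=> Sx; have -> : coset_rep x = x - (x - coset_rep x) by rewrite subKr.
by apply: subspaceB => //; apply/NS/coset_repP.
Qed.

(* Elements of [S / N] are represented by canonical representatives of cosets. *)
Definition subquotient_pred (x : V) : bool := `[< S x /\ coset_rep x = x >].

Definition subquotient of linsub S & linsub N & N `<=` S : Type :=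
  {x : V | subquotient_pred x}.

Local Notation T := (subquotient sS sN NS).

HB.instance Definition _ := Choice.copy T {x : V | subquotient_pred x}.

Definition sq_val (u : T) : V := sval u.

Lemma sq_valS u : S (sq_val u).
Proof. by case: u => x /= /asboolP []. Qed.

Lemma sq_val_rep u : coset_rep (sq_val u) = sq_val u.
Proof. by case: u => x /= /asboolP []. Qed.

Lemma sq_pi_subproof x : subquotient_pred (coset_rep (if `[< S x >] then x else 0)).
Proof.
apply/asboolP; split; last first.
  set y := (if _ then _ else _); apply: coset_rep_eq.
  by rewrite -opprB; apply: subspaceN => //; apply: coset_repP.
by apply: coset_rep_in; case: asboolP => //; case: sS.
Qed.

(** Made total on [V]: vectors outside [S] are sent to the class of 0. *)
Definition sq_pi (x : V) : T :=
  exist (fun x : V => is_true (subquotient_pred x)) _ (sq_pi_subproof x).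

Lemma sq_val_pi x : S x -> N (x - sq_val (sq_pi x)).
Proof. by move=> Sx; rewrite /sq_val /= asboolT//; apply: coset_repP. Qed.

Lemma sq_pi_eq x y : S x -> S y -> N (x - y) -> sq_pi x = sq_pi y.
Proof.
move=> Sx Sy Nxy; apply/eqP; rewrite -val_eqE /= !asboolT//; apply/eqP.
exact: coset_rep_eq.
Qed.

Lemma sq_valK : cancel sq_val sq_pi.
Proof.
move=> u; apply/eqP; rewrite -val_eqE /= asboolT; last exact: sq_valS.
by apply/eqP; apply: sq_val_rep.
Qed.

Definition sq_add (u v : T) : T := sq_pi (sq_val u + sq_val v).
Definition sq_scale (a : R[i]) (u : T) : T := sq_pi (a *: sq_val u).

Lemma sq_addE x y : S x -> S y -> sq_add (sq_pi x) (sq_pi y) = sq_pi (x + y).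
Proof.
move=> Sx Sy; apply: sq_pi_eq.
- by apply: subspaceD => //; apply: sq_valS.
- exact: subspaceD.
rewrite opprD addrACA; apply: subspaceD => //.
  by rewrite -opprB; apply: subspaceN => //; apply: sq_val_pi.
by rewrite -opprB; apply: subspaceN => //; apply: sq_val_pi.
Qed.

Lemma sq_scaleE a x : S x -> sq_scale a (sq_pi x) = sq_pi (a *: x).
Proof.
move=> Sx; apply: sq_pi_eq.
- by apply: subspaceZ => //; apply: sq_valS.
- exact: subspaceZ.
rewrite -scalerBr; apply: subspaceZ => //.
by rewrite -opprB; apply: subspaceN => //; apply: sq_val_pi.
Qed.

Let SD x y (Sx : S x) (Sy : S y) : S (x + y). Proof. exact: subspaceD. Qed.
Let SZ a x (Sx : S x) : S (a *: x). Proof. exact: subspaceZ. Qed.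
Let sqP (u : T) : exists2 x, S x & u = sq_pi x.
Proof. by exists (sq_val u); [exact: sq_valS|rewrite sq_valK]. Qed.

Fact sq_addA : associative sq_add.
Proof.
move=> u v w; have [x Sx ->] := sqP u; have [y Sy ->] := sqP v.
by have [z Sz ->] := sqP w; rewrite !sq_addE ?addrA//; exact: SD.
Qed.
Fact sq_addC : commutative sq_add.
Proof. by move=> u v; rewrite /sq_add addrC. Qed.
Fact sq_add0 : left_id (sq_pi 0) sq_add.
Proof.
move=> u; have [x Sx ->] := sqP u; rewrite sq_addE ?add0r//; by case: sS.
Qed.
Fact sq_addN : left_inverse (sq_pi 0) (sq_scale (-1)) sq_add.
Proof.
move=> u; have [x Sx ->] := sqP u.
rewrite sq_scaleE// sq_addE//; last exact: SZ.
by rewrite scaleN1r addNr.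
Qed.

HB.instance Definition _ := GRing.isZmodule.Build T sq_addA sq_addC sq_add0 sq_addN.

Fact sq_scaleA a b u : sq_scale a (sq_scale b u) = sq_scale (a * b) u.
Proof.
have [x Sx ->] := sqP u; rewrite !sq_scaleE ?scalerA//; exact: SZ.
Qed.
Fact sq_scale1 : left_id 1 sq_scale.
Proof. by move=> u; have [x Sx ->] := sqP u; rewrite sq_scaleE ?scale1r. Qed.
Fact sq_scaleDr : right_distributive sq_scale +%R.
Proof.
move=> a u v; have [x Sx ->] := sqP u; have [y Sy ->] := sqP v.
rewrite /GRing.add /=.
by rewrite sq_addE// !sq_scaleE ?sq_addE ?scalerDr//; [exact: SZ..|exact: SD].
Qed.
Fact sq_scaleDl u : {morph sq_scale^~ u : a b / a + b}.
Proof.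
move=> a b; have [x Sx ->] := sqP u.
rewrite [RHS]/GRing.add /=.
by rewrite !sq_scaleE ?sq_addE ?scalerDl//; exact: SZ.
Qed.

HB.instance Definition _ :=
  GRing.Zmodule_isLmodule.Build R[i] T sq_scaleA sq_scale1 sq_scaleDr sq_scaleDl.

(** Hides the representatives: only these three properties of [S / N] are used below, and [pi] is
    controlled on [S] only. *)
Lemma subquotient_exists : exists (U : lmodType R[i]) (pi : V -> U),
  [/\ forall a x y, S x -> S y -> pi (a *: x + y) = a *: pi x + pi y,
      forall u, exists2 x, S x & pi x = u &
      forall x, S x -> pi x = 0 <-> N x].
Proof.
exists T, sq_pi; split.
- move=> a x y Sx Sy.
  by rewrite -sq_addE; [rewrite -sq_scaleE|exact: SZ|].
- by move=> u; exists (sq_val u); [exact: sq_valS|exact: sq_valK].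
- have S0 : S 0 by case: sS.
  move=> x Sx; split => [/(congr1 sq_val) x0|Nx]; last first.
    by apply: sq_pi_eq => //; rewrite subr0.
  have N0 := sq_val_pi S0; rewrite sub0r -x0 in N0.
  by rewrite -(subrK (sq_val (sq_pi x)) x) -[X in _ + X]opprK; apply: subspaceB => //; exact: sq_val_pi.
Qed.

End Construction.

(** The subquotient with [N = 0]; [i] sends a class to its only element in [S]. *)
Lemma submodule_exists (V : lmodType R[i]) (S : set V) : linsub S ->
  exists (U : lmodType R[i]) (i : U -> V), [/\ linear i, injective i & range i = S].
Proof.
move=> sS; have s0 : linsub [set (0 : V)].
  by split => // a x y /= -> ->; rewrite scaler0 addr0.
have S0 : [set 0] `<=` S by move=> _ ->; case: sS.
have [U [pi [piL piS pi0]]] := subquotient_exists sS s0 S0.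
have [i iP] := choice (fun u => let: ex_intro2 x Sx xu := piS u in ex_intro _ x (conj Sx xu)).
have pi_inj x y : S x -> S y -> pi x = pi y -> x = y.
  move=> Sx Sy xy; apply/eqP; rewrite -subr_eq0; apply/eqP; apply/pi0.
    exact: subspaceB.
  by rewrite addrC -scaleN1r piL// xy scaleN1r addNr.
exists U, i; split.
- move=> a u v; have [Su iu] := iP u; have [Sv iv] := iP v.
  have [Sw iw] := iP (a *: u + v).
  by apply: pi_inj => //; [exact: sS.2|rewrite piL// iw iu iv].
- by move=> u v uv; rewrite -(iP u).2 -(iP v).2 uv.
- apply/seteqP; split => [_ [u _ <-]|x Sx]; first by case: (iP u).
  by have [Sy yx] := iP (pi x); exists (pi x) => //; apply: pi_inj.
Qed.

End Subquotient.

(** * The locally convex space defined by a family of seminorms *)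

Section SeminormTopology.
Context {R : realType}.

(** Closure under sums and multiples up to domination: the unit balls alone then form a base at 0,
    with no finite intersections or radii. *)
Definition dominating_family (U : lmodType R[i]) (Q : set (U -> R)) :=
  [/\ forall p, Q p -> seminorm p, Q !=set0,
      forall p q, Q p -> Q q -> exists2 r, Q r & forall x, p x + q x <= r x &
      forall c p, 0 <= c -> Q p -> exists2 r, Q r & forall x, c * p x <= r x].

Section Construction.
Variables (U : lmodType R[i]) (Q : set (U -> R)) (hQ : dominating_family Q).

(** An alias of [U] carrying the proof [hQ], so that the topology declared on it can depend on
    [Q]. *)
Definition sntvs of dominating_family Q : Type := U.
Local Notation T := (sntvs hQ).

HB.instance Definition _ := GRing.Lmodule.on T.

Definition sn_nbhs (x : T) : set_system T :=
  [set A | exists2 p, Q p & forall y : T, p (y - x) < 1 -> A y].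

HB.instance Definition _ := hasNbhs.Build T sn_nbhs.

Let Qsn p (Qp : Q p) : seminorm p. Proof. by case: hQ => h _ _ _; apply: h. Qed.
Let Q_ge0 p (Qp : Q p) x : 0 <= p x. Proof. exact: sn_ge0 (Qsn Qp) x. Qed.

Fact sn_nbhs_filter (x : T) : ProperFilter (nbhs x).
Proof.
have [_ [q0 Qq0] QD _] := hQ; split.
  move=> [p Qp /(_ x)]; rewrite subrr (sn0 (Qsn Qp)); apply; exact: ltr01.
split; first by exists q0.
- move=> A B [p Qp pA] [q Qq qB]; have [r Qr pqr] := QD _ _ Qp Qq.
  exists r => // y ry; have := pqr (y - x).
  have := Q_ge0 Qp (y - x); have := Q_ge0 Qq (y - x).
  by split; [apply: pA|apply: qB]; lra.
- by move=> A B AB [p Qp pA]; exists p => // y /pA /AB.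
Qed.

Fact sn_nbhs_singleton (x : T) (A : set T) : nbhs x A -> A x.
Proof. by move=> [p Qp]; apply; rewrite subrr (sn0 (Qsn Qp)) ltr01. Qed.

Let Qeps p (e : R) : Q p -> 0 < e -> exists2 r, Q r & forall x, r x < 1 -> p x < e.
Proof.
have [_ _ _ QZ] := hQ; move=> Qp e0; have e1 : 0 <= e^-1 by rewrite invr_ge0 ltW.
have [r Qr er] := QZ _ _ e1 Qp; exists r => // x rx.
by have := le_lt_trans (er x) rx; rewrite mulrC ltr_pdivrMr// mul1r.
Qed.

Fact sn_nbhs_nbhs (x : T) (A : set T) : nbhs x A -> nbhs x (nbhs^~ A).
Proof.
move=> [p Qp pA]; exists p => // y py.
have e0 : 0 < 1 - p (y - x) by lra.
have [r Qr rp] := Qeps Qp e0; exists r => // z /rp pz; apply: pA.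
by have := sn_tri (Qsn Qp) y z x; lra.
Qed.

HB.instance Definition _ :=
  Nbhs_isNbhsTopological.Build T sn_nbhs_filter sn_nbhs_singleton sn_nbhs_nbhs.

Fact sn_add_continuous : continuous (fun x : T * T => x.1 + x.2).
Proof.
move=> [x y] A [p Qp pA].
have h : 0 < (2^-1 : R) by lra.
have [r Qr rp] := Qeps Qp h.
exists ([set z | r (z - x) < 1], [set z | r (z - y) < 1]).
  by split; exists r.
move=> [a b] [/= /rp ax /rp bx]; apply: pA; rewrite opprD addrACA.
apply: le_lt_trans (snD (Qsn Qp) _ _) _.
by apply: lt_le_trans (ltrD ax bx) _; lra.
Qed.

Fact sn_scale_continuous : continuous (fun z : R[i]^o * T => z.1 *: z.2).
Proof.
move=> [a x] A [p Qp pA].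
have P0 := Q_ge0 Qp; have n0 := @normc_ge0 R.
pose e := (Normc.normc a + p x + 2)^-1.
have e0 : 0 < e by rewrite invr_gt0; have := P0 x; have := n0 a; lra.
have e1 : e * (Normc.normc a + p x + 2) = 1.
  by rewrite mulVf// gt_eqF//; have := P0 x; have := n0 a; lra.
have [r Qr rp] := Qeps Qp e0.
exists ([set b | Normc.normc (a - b) < e], [set y | r (y - x) < 1]).
  by split; [apply/nbhs_complexP; exists e|exists r].
move=> [b y] [/= ab /rp yx]; apply: pA.
have -> : b *: y - a *: x = (b - a) *: (y - x) + (b - a) *: x + a *: (y - x).
  by rewrite -scalerDr subrK scalerBl scalerBr subrKA.
have ba : Normc.normc (b - a) < e by rewrite -normcN opprB.
apply: le_lt_trans (snD (Qsn Qp) _ _) _.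
apply: le_lt_trans (lerD (snD (Qsn Qp) _ _) (lexx _)) _.
rewrite !(snZ (Qsn Qp)).
have a1 : Normc.normc (b - a) * p (y - x) <= e * e.
  by apply: ler_pM => //; apply: ltW.
have a2 : Normc.normc (b - a) * p x <= e * p x by rewrite ler_wpM2r// ltW.
have a3 : Normc.normc a * p (y - x) <= Normc.normc a * e.
  by rewrite ler_wpM2l// ltW.
have a4 : e * e <= e * 1.
  rewrite ler_wpM2l ?(ltW e0)// -e1 -[leLHS]mulr1 ler_wpM2l ?(ltW e0)//.
  by have := P0 x; have := n0 a; lra.
move: e1 a1 a2 a3 a4; rewrite !mulrDr [Normc.normc a * e]mulrC; lra.
Qed.

Fact sn_locally_convex : exists2 B : set_system T,
  (forall b, b \in B -> convex_set b) & basis B.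
Proof.
exists [set A | exists x p, Q p /\ A = [set y : T | p (y - x) < 1]].
  move=> A; rewrite inE => -[x [p [Qp ->]]].
  apply/convex_setW => y z; rewrite !inE /= => py pz k k0 k1.
  rewrite inE /= /conv /= /unstable.onem.
  have [t t01 ->] : exists2 t : R, 0 < t < 1 & k%:num = t%:C.
    case: (k%:num) k0 k1 => t s; rewrite !ltcE /= => /andP[/eqP -> t0] /andP[_ t1].
    by exists t => //; apply/andP.
  have -> : t%:C *: y + (1 - t%:C) *: z - x = t%:C *: (y - x) + (1 - t)%:C *: (z - x).
    rewrite rmorphB /= !scalerBr addrACA -opprD -scalerDl addrC.
    by rewrite [t%:C + _]addrC subrK scale1r addrC.
  move: t01 => /andP[t0 t1].
  apply: le_lt_trans (snD (Qsn Qp) _ _) _; rewrite !(snZr (Qsn Qp)); [|lra|lra].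
  have : t * p (y - x) < t * 1 by rewrite ltr_pM2l.
  have : (1 - t) * p (z - x) < (1 - t) * 1 by rewrite ltr_pM2l//; lra.
  lra.
split => [_ [x [p [Qp ->]]]|x A [p Qp pA]].
  rewrite openE => y /= py.
  have e0 : 0 < 1 - p (y - x) by lra.
  have [r Qr rp] := Qeps Qp e0; exists r => // z /rp pz /=.
  by have := sn_tri (Qsn Qp) y z x; lra.
exists [set y : T | p (y - x) < 1]; last by move=> y /pA.
by split; [exists x, p|rewrite /= subrr (sn0 (Qsn Qp)) ltr01].
Qed.

(* This factory only installs the uniform structure; the other mixins of
   [tvsType] have to be declared separately. *)
HB.instance Definition _ := PreTopologicalLmod_isTvs.Build R[i] T
  sn_add_continuous sn_scale_continuous sn_locally_convex.
HB.instance Definition _ :=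
  PreTopologicalNmodule_isTopologicalNmodule.Build T sn_add_continuous.
HB.instance Definition _ :=
  TopologicalNmodule_isTopologicalLmodule.Build R[i] T sn_scale_continuous.
HB.instance Definition _ := Uniform_isTvs.Build R[i] T sn_locally_convex.

(** The maps are identities underneath; exporting them as mutually inverse isomorphisms keeps the
    structure of the alias apart from that of [U]. *)
Lemma sntvs_exists : exists (W : tvsType R[i]) (phi : U -> W) (psi : W -> U),
  [/\ linear phi, linear psi, cancel phi psi, cancel psi phi &
    (forall p, Q p -> cs (p \o psi)) /\
    (forall s, cs s -> exists2 p, Q p & forall u, s (phi u) <= p u)].
Proof.
exists T, id, id; split => //; split => [p Qp|s [ss [p Qp ps]]].
  by split; [exact: Qsn|exists p => // y; rewrite subr0].
exists p => //; apply: (@sn_le_of_ball _ _ _ s p id) => //; first exact: Qsn.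
by move=> x px; apply: ltW; apply: ps; rewrite subr0.
Qed.

End Construction.
End SeminormTopology.

(** * Completion by Cauchy nets *)

Section Completion.
Context {R : realType}.

(** The Hausdorff completion of [V] for the topology given by [P]: [iota] kills exactly the vectors
    on which all of [P] vanishes. *)
Definition is_completion (V : lmodType R[i]) (P : set (V -> R)) (W : tvsType R[i])
    (iota : V -> W) :=
  [/\ complete_lcs W, linear iota, dense (range iota),
      forall s, cs s -> exists2 p, P p & forall x, s (iota x) <= p x &
      forall p, P p -> exists2 s, cs s & forall x, s (iota x) = p x].

Section Nets.
Variables (V : lmodType R[i]) (P : set (V -> R)) (hP : dominating_family P).

(* The completion consists of the Cauchy nets indexed by the directed set [P]
   itself, modulo the null nets. *)
Local Notation net := ((V -> R) -> V).

Definition eventually_P (A : set (V -> R)) :=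
  exists2 p, P p & forall q, P q -> (forall x, p x <= q x) -> A q.

Definition cauchy_net : set net := [set x | forall p e, P p -> 0 < e ->
  exists2 r, P r & eventually_P [set q | p (x q - x r) < e] ].

Definition null_net : set net := [set x | forall p e, P p -> 0 < e ->
  eventually_P [set q | p (x q) < e] ].

Let Psn p (Pp : P p) : seminorm p. Proof. by case: hP => h _ _ _; apply: h. Qed.
Let P_ge0 p (Pp : P p) x : 0 <= p x. Proof. exact: sn_ge0 (Psn Pp) x. Qed.

Lemma eventuallyI A B : eventually_P A -> eventually_P B -> eventually_P (A `&` B).
Proof.
case: hP => _ _ PD _ [p Pp pA] [q Pq qB]; have [r Pr pqr] := PD _ _ Pp Pq.
exists r => // s Ps rs; split; [apply: pA => // x|apply: qB => // x].
  by have := rs x; have := pqr x; have := P_ge0 Pq x; lra.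
by have := rs x; have := pqr x; have := P_ge0 Pp x; lra.
Qed.

Lemma eventuallyS A B : (forall q, P q -> A q -> B q) -> eventually_P A -> eventually_P B.
Proof. by move=> AB [p Pp pA]; exists p => // q Pq /(pA q Pq); apply: AB. Qed.

Lemma eventually_ex A : eventually_P A -> exists2 q, P q & A q.
Proof. by move=> [p Pp pA]; exists p => //; apply: pA. Qed.

Lemma eventuallyT (A : set (V -> R)) : (forall q, A q) -> eventually_P A.
Proof. by case: hP => _ [p Pp] _ _ h; exists p. Qed.

Lemma null_net_subspace : linsub null_net.
Proof.
split => [p e Pp e0|a x y xN yN p e Pp e0].
  by apply: eventuallyT => q /=; rewrite (sn0 (Psn Pp)).
have a1 : 0 < Normc.normc a + 1 by rewrite ltr_wpDl// normc_ge0.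
have ea : 0 < e / 2 / (Normc.normc a + 1) by rewrite !divr_gt0.
have e2 : 0 < e / 2 by lra.
apply: eventuallyS (eventuallyI (xN p _ Pp ea) (yN p _ Pp e2)) => q Pq [/= xq yq].
apply: le_lt_trans (snD (Psn Pp) _ _) _; rewrite (snZ (Psn Pp)).
have : Normc.normc a * p (x q) <= (Normc.normc a + 1) * p (x q).
  by rewrite ler_wpM2r ?(P_ge0 Pp)//; lra.
by move: xq; rewrite ltr_pdivlMr// mulrC; lra.
Qed.

Lemma cauchy_net_subspace : linsub cauchy_net.
Proof.
split => [p e Pp e0|a x y xN yN p e Pp e0].
  case: hP => _ [r Pr] _ _; exists r => //; apply: eventuallyT => q /=.
  by rewrite subrr (sn0 (Psn Pp)).
have a1 : 0 < Normc.normc a + 1 by rewrite ltr_wpDl// normc_ge0.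
have ea : 0 < e / 4 / (Normc.normc a + 1).
  by rewrite divr_gt0//; lra.
have e2 : 0 < e / 4 by lra.
have [r1 Pr1 xr1] := xN p _ Pp ea; have [r2 Pr2 yr2] := yN p _ Pp e2.
have E := eventuallyI xr1 yr2.
have [r Pr [/= xr yr]] := eventually_ex E.
exists r => //; apply: eventuallyS E => q Pq [/= xq yq].
have -> : (a *: x + y) q - (a *: x + y) r = a *: (x q - x r) + (y q - y r).
  by rewrite scalerBr addrACA -opprD.
apply: le_lt_trans (snD (Psn Pp) _ _) _; rewrite (snZ (Psn Pp)).
have := sn_tri (Psn Pp) (y r2) (y q) (y r).
have := sn_tri (Psn Pp) (x r1) (x q) (x r).
rewrite [p (x r1 - _)](snC (Psn Pp)) [p (y r2 - _)](snC (Psn Pp)) => h1 h2.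
have : Normc.normc a * p (x q - x r) <= (Normc.normc a + 1) * p (x q - x r).
  by rewrite ler_wpM2r ?(P_ge0 Pp)//; lra.
have : (Normc.normc a + 1) * p (x q - x r) <=
   (Normc.normc a + 1) * (p (x q - x r1) + p (x r - x r1)) by rewrite ler_pM2l.
have hxq : (Normc.normc a + 1) * p (x q - x r1) < e / 4 by rewrite mulrC -ltr_pdivlMr.
have hxr : (Normc.normc a + 1) * p (x r - x r1) < e / 4 by rewrite mulrC -ltr_pdivlMr.
by rewrite [_ * (_ + _)](mulrDr (Normc.normc a + 1)); lra.
Qed.

Lemma null_net_cauchy : null_net `<=` cauchy_net.
Proof.
move=> x xN p e Pp e0; have e2 : 0 < e / 2 by lra.
have [r Pr xr] := eventually_ex (xN p _ Pp e2).
exists r => //; apply: eventuallyS (xN p _ Pp e2) => q Pq /= xq.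
by have := snB (Psn Pp) (x q) (x r); move: xr => /=; lra.
Qed.

(** The seminorm induced by [p] on Cauchy nets, where it equals the limit of [p (x q)]; working with
    eventual upper bounds avoids proving convergence. *)
Definition net_limsup (p : V -> R) (x : net) : R :=
  inf [set t | eventually_P [set q | p (x q) <= t] ].

Section Limsup.
Variables (p : V -> R) (Pp : P p).

Let lb (x : net) : has_lbound [set t | eventually_P [set q | p (x q) <= t] ].
Proof.
exists 0 => t /eventually_ex [q Pq /= h].
exact: le_trans (P_ge0 Pp _) h.
Qed.

Let ne (x : net) : cauchy_net x -> [set t | eventually_P [set q | p (x q) <= t] ] !=set0.
Proof.
move=> xC; have [r Pr xr] := xC p 1 Pp ltr01.
exists (p (x r) + 1); apply: eventuallyS xr => q Pq /= xq.
by have := sn_le_sub (Psn Pp) (x q) (x r); lra.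
Qed.

Lemma limsup_le x t : eventually_P [set q | p (x q) <= t] -> net_limsup p x <= t.
Proof. by move=> h; apply: ge_inf. Qed.

Lemma limsup_lt x t : cauchy_net x -> net_limsup p x < t ->
  eventually_P [set q | p (x q) < t].
Proof.
move=> xC xt; have d0 : 0 < t - net_limsup p x by lra.
have [s Es] := inf_adherent d0 (conj (ne xC) (@lb x)).
rewrite -/(net_limsup p x) addrC subrK => st.
by apply: eventuallyS Es => q Pq /= h; apply: le_lt_trans st.
Qed.

Lemma limsup_ge0 x : cauchy_net x -> 0 <= net_limsup p x.
Proof.
by move=> xC; apply: lb_le_inf => [|t /eventually_ex [q Pq /=]]; [exact: ne|exact: le_trans (P_ge0 Pp _)].
Qed.

Lemma limsupD x y : cauchy_net x -> cauchy_net y ->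
  net_limsup p (x + y) <= net_limsup p x + net_limsup p y.
Proof.
move=> xC yC; apply/ler_addgt0Pr => e e0; apply: limsup_le.
have hx : net_limsup p x < net_limsup p x + e / 2 by lra.
have hy : net_limsup p y < net_limsup p y + e / 2 by lra.
apply: eventuallyS (eventuallyI (limsup_lt xC hx) (limsup_lt yC hy)) => q Pq [/= xq yq].
by apply: le_trans (snD (Psn Pp) (x q) (y q)) _; lra.
Qed.

Lemma limsupZ a x : cauchy_net x ->
  net_limsup p (a *: x) <= Normc.normc a * net_limsup p x.
Proof.
move=> xC; apply/ler_addgt0Pr => e e0; apply: limsup_le.
have a1 : 0 < Normc.normc a + 1 by rewrite ltr_wpDl// normc_ge0.
have hx : net_limsup p x < net_limsup p x + e / (Normc.normc a + 1).
  by rewrite ltrDl divr_gt0.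
apply: eventuallyS (limsup_lt xC hx) => q Pq /= xq.
rewrite (snZ (Psn Pp)).
have : Normc.normc a * p (x q) <= Normc.normc a * (net_limsup p x + e / (Normc.normc a + 1)).
  by rewrite ler_wpM2l ?normc_ge0// ltW.
have : Normc.normc a * (e / (Normc.normc a + 1)) <= e.
  by rewrite mulrCA ger_pMr// ler_pdivrMr// mul1r; lra.
by rewrite mulrDr; lra.
Qed.

Lemma limsup_null x : null_net x -> net_limsup p x <= 0.
Proof.
move=> xN; apply/ler_addgt0Pr => e e0; rewrite add0r; apply: limsup_le.
by apply: eventuallyS (xN p e Pp e0) => q Pq /= /ltW.
Qed.

Lemma limsup_const v : net_limsup p (fun=> v) = p v.
Proof.
apply/eqP; rewrite eq_le limsup_le/=; last by apply: eventuallyT => q /=.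
apply: lb_le_inf; first by exists (p v); apply: eventuallyT => q /=.
by move=> t /eventually_ex [].
Qed.

End Limsup.

Lemma const_cauchy v : cauchy_net (fun=> v).
Proof.
move=> p e Pp e0; case: hP => _ [r Pr] _ _; exists r => //.
by apply: eventuallyT => q /=; rewrite subrr (sn0 (Psn Pp)).
Qed.

Lemma completion_exists :
  exists (W : tvsType R[i]) (iota : V -> W), is_completion P iota.
Proof.
have [U [pi [piL piS pi0]]] :=
  subquotient_exists cauchy_net_subspace null_net_subspace null_net_cauchy.
have [r rP] := choice (fun u => let: ex_intro2 x Sx xu := piS u in
   ex_intro _ x (conj Sx xu)).
have rC u : cauchy_net (r u) by case: (rP u).
have rK u : pi (r u) = u by case: (rP u).
have CD x y : cauchy_net x -> cauchy_net y -> cauchy_net (x + y).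
  exact: subspaceD cauchy_net_subspace.
have CZ a x : cauchy_net x -> cauchy_net (a *: x).
  exact: subspaceZ cauchy_net_subspace.
have CB x y : cauchy_net x -> cauchy_net y -> cauchy_net (x - y).
  exact: subspaceB cauchy_net_subspace.
have piD x y : cauchy_net x -> cauchy_net y -> pi (x + y) = pi x + pi y.
  by move=> xC yC; rewrite -[x]scale1r piL// !scale1r.
have pi00 : pi 0 = 0.
  have C0 : cauchy_net 0 by case: cauchy_net_subspace.
  by apply: (addIr (pi 0)); rewrite -piD// !add0r.
have piZ a x : cauchy_net x -> pi (a *: x) = a *: pi x.
  move=> xC; rewrite -[a *: x]addr0 piL// ?pi00 ?addr0//.
  by case: cauchy_net_subspace.
have piB x y : cauchy_net x -> cauchy_net y -> pi (x - y) = pi x - pi y.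
  by move=> xC yC; rewrite -(scaleN1r y) (piD _ _ xC (CZ _ _ yC)) piZ// scaleN1r.
pose hat (p : V -> R) (u : U) := net_limsup p (r u).
have hat_le p x : P p -> cauchy_net x -> hat p (pi x) <= net_limsup p x.
  move=> Pp xC; rewrite /hat.
  have : null_net (r (pi x) - x).
    by apply/pi0; [exact: CB|rewrite piB// rK subrr].
  move=> /(limsup_null Pp) h.
  have := limsupD Pp (CB _ _ (rC (pi x)) xC) xC; rewrite subrK; lra.
have hat0 p u : P p -> 0 <= hat p u by move=> Pp; apply: limsup_ge0.
have hat_sn p : P p -> seminorm (hat p).
  move=> Pp; split => [u v|].
    have -> : u + v = pi (r u + r v) by rewrite piD// !rK.
    apply: le_trans (hat_le _ _ Pp (CD _ _ (rC u) (rC v))) _.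
    exact: limsupD.
  apply: sn_homog => [u|a u]; first exact: hat0.
  have -> : a *: u = pi (a *: r u) by rewrite piZ// rK.
  by apply: le_trans (hat_le _ _ Pp (CZ _ _ (rC u))) _; exact: limsupZ.
have hat_mono p q (c : R) u : P p -> P q -> (forall x, c * p x <= q x) -> 0 < c ->
    c * hat p u <= hat q u.
  move=> Pp Pq pq c0; rewrite -ler_pdivlMl//; apply/ler_addgt0Pr => e e0.
  apply: limsup_le => //.
  have h : net_limsup q (r u) < net_limsup q (r u) + c * e.
    by rewrite ltrDl mulr_gt0.
  apply: eventuallyS (limsup_lt Pq (rC u) h) => s Ps /= sq.
  rewrite -(ler_pM2l c0); apply: le_trans (pq _) _; apply: le_trans (ltW sq) _.
  by rewrite mulrDr mulVKf// gt_eqF.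
have hQ : dominating_family [set hat p | p in P].
  case: (hP) => _ [p0 Pp0] PD PZ; split.
  - by move=> _ [p Pp <-]; apply: hat_sn.
  - by exists (hat p0); exists p0.
  - move=> _ _ [p Pp <-] [q Pq <-]; have [s Ps pqs] := PD _ _ Pp Pq.
    have c2 : 0 <= (2 : R) by lra.
    have [t Pt st] := PZ 2 s c2 Ps; exists (hat t); first by exists t.
    have h2 : 0 < (2 : R) by lra.
    have pt x : 2 * p x <= t x by have := pqs x; have := st x; have := P_ge0 Pq x; lra.
    have qt x : 2 * q x <= t x by have := pqs x; have := st x; have := P_ge0 Pp x; lra.
    move=> u; have := hat_mono p t 2 u Pp Pt pt h2.
    by have := hat_mono q t 2 u Pq Pt qt h2; lra.
  - move=> c _ c0 [p Pp <-]; have [s Ps cps] := PZ c p c0 Pp.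
    exists (hat s); first by exists s.
    move=> u; have [->|cn0] := eqVneq c 0; first by rewrite mul0r; apply: hat0.
    by apply: hat_mono => //; rewrite lt_neqAle eq_sym cn0.
have [W [phi [psi [lphi lpsi phiK psiK [Wcs Wdom]]]]] := sntvs_exists hQ.
pose iota v := phi (pi (fun=> v)).
have hat_const p v : P p -> hat p (pi (fun=> v)) = p v.
  move=> Pp; apply/eqP; rewrite eq_le; apply/andP; split.
    by rewrite -[leRHS]limsup_const//; apply: hat_le => //; apply: const_cauchy.
  have CC := const_cauchy v; rewrite /hat; apply/ler_addgt0Pr => e e0.
  have NN : null_net (r (pi (fun=> v)) - (fun=> v)).
    by apply/pi0; [exact: CB|rewrite piB// rK subrr].
  have h1 : net_limsup p (r (pi (fun=> v))) < net_limsup p (r (pi (fun=> v))) + e / 2.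
    by lra.
  have e2 : 0 < e / 2 by lra.
  have [q Pq [/= q1 q2]] := eventually_ex (eventuallyI (limsup_lt Pp (rC _) h1) (NN p _ Pp e2)).
  have := sn_le_sub (Psn Pp) v (r (pi (fun=> v)) q).
  have q2' : p (r (pi (fun=> v)) q - v) < e / 2 := q2.
  by rewrite (snC (Psn Pp)); lra.
have liota : linear iota.
  move=> a x y; rewrite /iota -lphi; congr phi.
  by rewrite -piL//; exact: const_cauchy.
have hatP p : P p -> cs (hat p \o psi) by move=> Pp; apply: Wcs; exists p.
have csP s : cs s -> exists2 p, P p & forall w, s w <= hat p (psi w).
  by move=> /Wdom [_ [p Pp <-] sp]; exists p => // w; rewrite -[in s w](psiK w).
(* Density of constant nets: the Cauchy net [r u] is within [e] of its own member [r u s] taken as a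
   constant net. *)
have half p u (e : R) : P p -> 0 < e -> exists2 v, True & hat p (u - pi (fun=> v)) <= e.
  move=> Pp e0; have [s Ps Es] := rC u p e Pp e0.
  exists (r u s) => //; have CC := const_cauchy (r u s).
  rewrite -[u in u - _]rK -piB//; apply: le_trans (hat_le _ _ Pp (CB _ _ (rC u) CC)) _.
  by apply: limsup_le => //; apply: eventuallyS Es => q Pq /= /ltW.
exists W, iota; split => //.
- split.
    apply/hausdorff_csP => w w0; rewrite -[w]psiK.
    suff -> : psi w = 0 by rewrite (lin0 lphi).
    rewrite -[psi w]rK; apply/pi0 => // p e Pp e0.
    by apply: limsup_lt => //; have := w0 _ (hatP p Pp); rewrite /= /hat => ->.
  move=> Fi FF cF.
  (* For each [p] in [P] pick a vector whose [p]-unit ball belongs to the filter. This choice is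
     itself a net indexed by [P], which is why nets with that index set suffice for completeness. *)
  have [p|y yP] := @choice _ _ (fun p v =>
      P p -> Fi [set w | hat p (psi w - pi (fun=> v)) < 1]).
    have [Pp|nPp] := pselect (P p); last by exists 0.
    have h : 0 < (2^-1 : R) by lra.
    have [A FA Ad] := cF _ (cs_ball (hatP p Pp) h).
    have [w0 Aw0] := filter_ex FA.
    have [v _ wv] := half p (psi w0) _ Pp h.
    exists v => _; apply: filterS FA => w Aw /=.
    have := Ad w w0 Aw Aw0; rewrite /= (linB lpsi) => dw.
    by have := sn_tri (hat_sn p Pp) (psi w0) (psi w) (pi (fun=> v)); lra.
  (* The factor 4 leaves room: for [p], both vectors are within 1/4 of a common point. *)
  have ydist p s q q' : P p -> P s -> P q -> P q' -> (forall x, 4 * p x <= s x) ->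
      (forall x, s x <= q x) -> (forall x, s x <= q' x) -> p (y q - y q') <= 2^-1.
    move=> Pp Ps Pq Pq' ps sq sq'.
    have [w [/= wq wq']] := filter_ex (filterI (yP q Pq) (yP q' Pq')).
    have h4 : 0 < (4 : R) by lra.
    have m u t : P t -> (forall x, s x <= t x) -> 4 * hat p u <= hat t u.
      by move=> Pt st; apply: hat_mono => // x; apply: le_trans (ps x) (st x).
    have mq := m (psi w - pi (fun=> y q)) q Pq sq.
    have mq' := m (psi w - pi (fun=> y q')) q' Pq' sq'.
    rewrite -(hat_const p) //.
    have -> : pi (fun=> y q - y q') = pi (fun=> y q) - pi (fun=> y q').
      by rewrite -piB//; exact: const_cauchy.
    have := sn_tri (hat_sn p Pp) (psi w) (pi (fun=> y q)) (pi (fun=> y q')).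
    by rewrite [hat p (_ - psi w)](snC (hat_sn p Pp)); lra.
  have [_ _ _ PZ] := hP.
  have yC : cauchy_net y.
    move=> p e Pp e0; have ei : 0 <= e^-1 by rewrite invr_ge0 ltW.
    have c4 : 0 <= (4 : R) by lra.
    have [t Pt et] := PZ _ p ei Pp; have [s Ps ts] := PZ _ t c4 Pt.
    exists s => //; exists s => // q Pq sq /=.
    have := ydist t s q s Pt Ps Pq Ps ts sq (fun=> lexx _).
    have := et (y q - y s); rewrite ler_pdivrMl// => h h'.
    apply: le_lt_trans h _; rewrite gtr_pMr//; lra.
  (* The class of the net is the limit: at most 1/4 from the filter to [y t], at most 1/2 from [y t]
     to the class. *)
  exists (phi (pi y)) => B /nbhs_csP [s /csP [p Pp sp] sB].
  have c4 : 0 <= (4 : R) by lra.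
  have [t Pt pt] := PZ 4 p c4 Pp.
  apply: filterS (yP t Pt) => w /= wt; apply: sB; apply: le_lt_trans (sp _) _.
  rewrite (linB lpsi) phiK.
  have h4 : 0 < (4 : R) by lra.
  have h1 : hat p (psi w - pi (fun=> y t)) <= 4^-1.
    by have := hat_mono p t 4 (psi w - pi (fun=> y t)) Pp Pt pt h4; lra.
  have h2 : hat p (pi (fun=> y t) - pi y) <= 2^-1.
    have CC := const_cauchy (y t).
    rewrite -piB//; apply: le_trans (hat_le _ _ Pp (CB _ _ CC yC)) _.
    apply: limsup_le => //; exists t => // q Pq tq /=.
    by apply: (ydist p t t q).
  by have := sn_tri (hat_sn p Pp) (pi (fun=> y t)) (psi w) (pi y); lra.
- apply/dense_closureP => w; apply/closure_csP => s /csP [p Pp sp].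
  have h : 0 < (2^-1 : R) by lra.
  have [v _ uv] := half p (psi w) _ Pp h.
  exists (iota v); first by exists v.
  apply: le_lt_trans (sp _) _; rewrite (linB lpsi) phiK (snC (hat_sn p Pp)); lra.
- move=> s /csP [p Pp sp]; exists p => // x.
  by rewrite -hat_const// -[pi _]phiK; apply: sp.
- move=> p Pp; exists (hat p \o psi); first exact: hatP.
  by move=> x; rewrite /= phiK hat_const.
Qed.

End Nets.
(** [n] alone defines the topology of [E]; on a Hausdorff space it is then a norm. *)
Definition norming (E : tvsType R[i]) (n : E -> R) :=
  cs n /\ forall s, cs s -> exists2 c, 0 <= c & forall x, s x <= c * n x.

Lemma normed_completion_exists (V : lmodType R[i]) (N : V -> R) : seminorm N ->
  exists (W : tvsType R[i]) (iota : V -> W) (n : W -> R),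
    [/\ complete_lcs W, linear iota, dense (range iota), norming n &
        forall v, n (iota v) = N v].
Proof.
move=> sN.
pose P : set (V -> R) := [set p | exists2 c : R, 0 <= c & p = (fun y => c * N y)].
have PN : P N by exists 1 => //; apply/funext => y; rewrite mul1r.
have hP : dominating_family P.
  split.
  - by move=> _ [c c0 ->]; apply: seminormZ.
  - by exists N.
  - move=> _ _ [c c0 ->] [d d0 ->]; exists (fun y => (c + d) * N y).
      by exists (c + d) => //; rewrite addr_ge0.
    by move=> y; rewrite mulrDl.
  - move=> c _ c0 [d d0 ->]; exists (fun y => (c * d) * N y).
      by exists (c * d) => //; rewrite mulr_ge0.
    by move=> y; rewrite mulrA.
have [W [iota [cW li di id ie]]] := completion_exists hP.
have [n cn nN] := ie N PN; exists W, iota, n; split => //; split => // s cS.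
have [_ [c c0 ->] sc] := id s cS; exists c => //.
by apply: (dense_le di cS (csZ c0 cn)) => _ [v _ <-]; rewrite nN.
Qed.

End Completion.

(** * Projective tensor products *)

Section FreeModule.
Context {R : realType}.

(** Finitely supported functions on [S]. The linear extension of [b] is a sum over the support,
    computed over any duplicate-free list containing it; two vectors can thus share a list. *)
Lemma free_module_exists (S : choiceType) :
  exists (V : lmodType R[i]) (delta : S -> V),
    (forall x, linspan (range delta) x) /\
    forall (Z : lmodType R[i]) (b : S -> Z),
      exists2 g : V -> Z, linear g & forall s, g (delta s) = b s.
Proof.
pose d (s : S) : S -> R[i] := fun t => (t == s)%:R.
have [V [i [li ii ri]]] := submodule_exists (linspan_subspace (range d)).
have [s|delta deltaE] := @choice _ _ (fun s v => i v = d s).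
  have : range i (d s) by rewrite ri; apply: sub_linspan; exists s.
  by move=> [v _ iv]; exists v.
exists V, delta; split => [x|Z b].
  have sub : linsub (i @` linspan (range delta)).
    have sp := linspan_subspace (range delta); split.
      by exists 0; [case: sp|rewrite (lin0 li)].
    by move=> a _ _ [u Su <-] [v Sv <-]; exists (a *: u + v); rewrite ?li//; apply: sp.2.
  have : range i (i x) by exists x.
  rewrite ri => /(_ _ (conj sub _)) [|v Sv /ii <- //].
  by move=> _ [s _ <-]; exists (delta s); [apply: sub_linspan; exists s|].
pose supp (f : S -> R[i]) := [set r : seq S | uniq r /\ forall s, s \notin r -> f s = 0].
have suppU (f g : S -> R[i]) : supp f !=set0 -> supp g !=set0 ->
    exists r, supp f r /\ supp g r.
  move=> [r [_ fr]] [r' [_ gr']]; exists (undup (r ++ r')).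
  split; split; rewrite ?undup_uniq// => s; rewrite mem_undup mem_cat negb_or.
    by move=> /andP[/fr].
  by move=> /andP[_ /gr'].
have supp0 a (f g : S -> R[i]) s : f s = 0 -> g s = 0 -> (a *: f + g) s = 0.
  by move=> fs gs; rewrite -[LHS]/(a * f s + g s) fs gs mulr0 addr0.
have suppE f : linspan (range d) f -> supp f !=set0.
  apply: (@linspan_min _ _ _ [set f | supp f !=set0]); last first.
    move=> _ [s _ <-]; exists [:: s]; split => // t; rewrite inE /d.
    by move=> /negbTE ->.
  split; first by exists [::].
  move=> a f1 f2 s1 s2; have [r [[ur h1] [_ h2]]] := suppU _ _ s1 s2.
  by exists r; split => // s sr; apply: supp0; [exact: h1|exact: h2].
have irange v : supp (i v) !=set0 by apply: suppE; rewrite -ri; exists v.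
pose L (f : S -> R[i]) : Z := \sum_(s \in [set: S]) f s *: b s.
have LE f r : supp f r -> L f = \sum_(s <- r) f s *: b s.
  move=> [ur fr]; rewrite /L (fsbigE r)//; last by move=> s _ /fr ->; rewrite scale0r.
  by apply: eq_bigl => s; rewrite in_setT.
exists (L \o i) => [a u v|s] /=.
  have [r [su sv]] := suppU _ _ (irange u) (irange v).
  rewrite li (LE _ r su) (LE _ r sv) (LE _ r); last first.
    case: su sv => ur h1 [_ h2]; split => // s sr.
    by apply: supp0; [exact: h1|exact: h2].
  rewrite scaler_sumr -big_split /=; apply: eq_bigr => s _.
  by rewrite scalerA -scalerDl.
rewrite deltaE (LE _ [:: s]); first by rewrite big_seq1 /d eqxx scale1r.
by split => // t; rewrite inE /d => /negbTE ->.
Qed.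

End FreeModule.

Section TensorProduct.
Context {R : realType}.
Implicit Types E F G W : tvsType R[i].

Lemma cs_dominating E (N : set E) :
  dominating_family [set p : E -> R | cs p /\ forall x, N x -> p x = 0].
Proof.
split.
- by move=> p [[]].
- by exists (fun=> 0); split; [exact: cs0|].
- move=> p q [cp pN] [cq qN]; exists (fun x => p x + q x) => //.
  by split; [exact: csD|move=> x Nx; rewrite pN// qN// addr0].
- move=> c p c0 [cp pN]; exists (fun x => c * p x) => //.
  by split; [exact: csZ|move=> x Nx; rewrite pN// mulr0].
Qed.

Lemma completion_continuous E W (P : set (E -> R)) (iota : E -> W) :
  (forall p, P p -> cs p) -> is_completion P iota -> continuous_linear iota.
Proof.
move=> Pcs [_ li _ h _]; apply: continuous_of_cs => // s cS.
have [p Pp sp] := h s cS; apply: (cs_of_le _ ler01 (Pcs p Pp)).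
  exact: seminorm_comp (proj1 cS).
by move=> x; rewrite mul1r; apply: sp.
Qed.

(** Complete [E] for the continuous seminorms that vanish on [N]. Distances to [N] are among them,
    and as [N] is closed they show that the kernel is no larger. *)
Lemma quotient_completion_exists E (N : set E) : linsub N -> closed N ->
  exists (W : tvsType R[i]) (q : E -> W), completes_quotient N q.
Proof.
move=> sN cN; have [W [q Wq]] := completion_exists (cs_dominating N).
have cq : continuous_linear q by apply: completion_continuous Wq => p [].
case: (Wq) => cW lq dq qd qe; exists W, q.
have N0 x : N x -> q x = 0.
  move=> Nx; have /hausdorff_csP hW := proj1 cW; apply: hW => s cS.
  have [p [cp pN] sp] := qd s cS; apply/eqP; rewrite eq_le (sn_ge0 (proj1 cS)) andbT.
  by apply: le_trans (sp x) _; rewrite pN.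
split => //.
  apply/seteqP; split => x /=; last exact: N0.
  move=> qx; apply: cN; apply/closure_csP => p cp.
  have [|s cS sq] := qe (qsn N p).
    by split; [exact: cs_qsn|move=> y; apply: qsn_null => //; case: cp].
  have := sq x; rewrite qx (sn0 (proj1 cS)) => h.
  have [m Nm pm] := qsn_approx sN (proj1 cp) x ltr01.
  exists (- m); first exact: subspaceN.
  by rewrite -(snN (proj1 cp)) opprB opprK; rewrite -h add0r in pm.
apply: (open_onto_range_of_cs lq sN N0) => r cr.
have [|s cS sq] := qe (qsn N r); last by exists s => // x; rewrite sq.
by split; [exact: cs_qsn|move=> y; apply: qsn_null => //; case: cr].
Qed.

Lemma tensor_exists E F :
  exists (G : tvsType R[i]) (t : E -> F -> G), is_tensor t.
Proof.
have [V [delta [Vspan Vuniv]]] := @free_module_exists R (E * F)%type.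
pose d x y := delta (x, y).
(* These seminorms kill the bilinearity relations and are bounded on pure tensors by products. The
   Hausdorff completion of the free module for them imposes the relations and the projective
   topology at once. *)
pose P : set (V -> R) := [set s | [/\ seminorm s,
  forall a x x' y, s (d (a *: x + x') y - (a *: d x y + d x' y)) = 0,
  forall a x y y', s (d x (a *: y + y') - (a *: d x y + d x y')) = 0 &
  exists p q, [/\ cs p, cs q & forall x y, s (d x y) <= p x * q y]]].
have hP : dominating_family P.
  split.
  - by move=> p [].
  - exists (fun=> 0); split => //; first by split => *; rewrite ?addr0 ?mulr0.
    by exists (fun=> 0), (fun=> 0); split; [exact: cs0|exact: cs0|move=> x y; rewrite mulr0].
  - move=> s s' [ss sl sr [p [q [cp cq pq]]]] [ss' sl' sr' [p' [q' [cp' cq' pq']]]].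
    exists (fun v => s v + s' v) => //; split => [||*|].
    + exact: seminormD.
    + by move=> *; rewrite sl sl' addr0.
    + by rewrite sr sr' addr0.
    exists (fun x => p x + p' x), (fun x => q x + q' x); split; try exact: csD.
    move=> x y; rewrite mulrDr !mulrDl.
    have := pq x y; have := pq' x y.
    have : 0 <= p' x * q y by rewrite mulr_ge0 ?(sn_ge0 (proj1 cp')) ?(sn_ge0 (proj1 cq)).
    have : 0 <= p x * q' y by rewrite mulr_ge0 ?(sn_ge0 (proj1 cp)) ?(sn_ge0 (proj1 cq')).
    lra.
  - move=> c s c0 [ss sl sr [p [q [cp cq pq]]]].
    exists (fun v => c * s v) => //; split => [||*|].
    + exact: seminormZ.
    + by move=> *; rewrite sl mulr0.
    + by rewrite sr mulr0.
    exists (fun x => c * p x), q; split => //; first exact: csZ.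
    by move=> x y; rewrite -mulrA ler_wpM2l.
have [G [iota [cG li di id ie]]] := completion_exists hP.
have /hausdorff_csP hG := proj1 cG.
have iota0 v : (forall s, P s -> s v = 0) -> iota v = 0.
  move=> h; apply: hG => s cS; have [p Pp sp] := id s cS.
  apply/eqP; rewrite eq_le (sn_ge0 (proj1 cS)) andbT.
  by apply: le_trans (sp v) _; rewrite h.
pose t x y := iota (d x y).
have tb : bilinear_map t.
  split => [x a y y'|y a x x']; apply/eqP; rewrite -subr_eq0 -li -(linB li); apply/eqP.
    by apply: iota0 => s [_ _ h _]; apply: h.
  by apply: iota0 => s [_ h _ _]; apply: h.
exists G, t; split => //.
  apply/(jointly_continuous_csP tb) => r cr; have [s [_ _ _ [p [q [cp cq pq]]]] rs] := id r cr.
  by exists p, q; split => // x y; apply: le_trans (rs _) (pq x y).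
move=> Z b cZ bb jb.
have [f lf fd] := Vuniv Z (fun xy => b xy.1 xy.2).
have [|g [cg gi _]] := @extension _ V G Z iota f li lf cZ _ di.
  move=> s cS; have [|t' ct' t'i] := ie (s \o f); last by exists t' => // x; rewrite t'i.
  split => //; first exact: seminorm_comp (proj1 cS).
  - move=> a x x' y; rewrite /= (linB lf) lf !fd /= (proj2 bb) subrr.
    exact: sn0 (proj1 cS).
  - move=> a x y y'; rewrite /= (linB lf) lf !fd /= (proj1 bb) subrr.
    exact: sn0 (proj1 cS).
  - have [p [q [cp cq pq]]] := (jointly_continuous_csP bb).1 jb s cS.
    by exists p, q; split => // x y /=; rewrite fd.
exists g; split; first by split => // x y; rewrite /t gi fd.
move=> g' [cg' g't]; apply/funext; apply: (dense_eq (proj1 cZ) di cg cg').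
move=> _ [v _ <-].
have : linsub [set v | g (iota v) = g' (iota v)].
  split; first by rewrite /= (lin0 li) (lin0 (proj1 cg)) (lin0 (proj1 cg')).
  by move=> a u w /= e1 e2; rewrite li (proj1 cg) (proj1 cg') e1 e2.
move=> /linspan_min /(_ _ v (Vspan v)); apply.
by move=> _ [[x y] _ <-] /=; rewrite gi fd -g't.
Qed.

(** The quotient map modulo the closed span of the pure tensors and the map 0 induce the same
    bilinear map, so uniqueness in the universal property makes them equal. *)
Lemma tensor_dense E F G (t : E -> F -> G) : is_tensor t ->
  dense (linspan (range (fun xy : E * F => t xy.1 xy.2))).
Proof.
move=> [cG tb tc tu]; set S := linspan _; have sS : linsub S := linspan_subspace _.
have scl := subspace_closure sS.
have [W [q [cW cq qN _ _]]] := quotient_completion_exists scl (@closed_closure _ S).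
have q0 x y : q (t x y) = 0.
  have : closure S (t x y) by apply: subset_closure; apply: sub_linspan; exists (x, y).
  by rewrite -qN.
have z_bil : bilinear_map (fun (_ : E) (_ : F) => 0 : W).
  by split => [_ a u v|_ a u v]; rewrite scaler0 addr0.
have z_cont : jointly_continuous (fun (_ : E) (_ : F) => 0 : W).
  by move=> x; apply: cvg_cst.
have [g [_ gu]] := tu W _ cW z_bil z_cont.
have e1 : g = q by apply: gu.
have e2 : g = (fun=> 0).
  apply: gu; split => //; split; first by move=> a x y; rewrite scaler0 addr0.
  by move=> x; apply: cvg_cst.
apply/dense_closureP => x; rewrite -qN /=; by rewrite -e1 e2.
Qed.

End TensorProduct.

(** * Tensor products with a cyclic module *)

Section QuotientFactor.
Context {R : realType}.
Implicit Types E F G Z : tvsType R[i].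

Lemma completes_quotient_factor E F Z (N : set E) (q : E -> F) (h : E -> Z) :
  completes_quotient N q -> complete_lcs Z -> continuous_linear h ->
  (forall x, N x -> h x = 0) ->
  exists g : F -> Z, [/\ continuous_linear g, forall x, g (q x) = h x &
    forall s t, cs s -> cs t -> (forall x, s (h x) <= t (q x)) ->
      forall w, s (g w) <= t w].
Proof.
move=> [cF [lq cq] qN oq dq] cZ ch hN; apply: extension => //; first by case: ch.
move=> s cS; apply: (open_onto_range_descend lq oq (cs_comp ch cS)).
move=> x qx /=; rewrite hN ?(sn0 (proj1 cS))//.
by rewrite -qN.
Qed.

Lemma closed_span_null E F (S : set E) (g : E -> F) :
  hausdorff_space F -> continuous_linear g -> (forall x, S x -> g x = 0) ->
  forall x, closed_span S x -> g x = 0.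
Proof.
move=> /hausdorff_csP hF cg gS x Sx; apply: hF => p cp.
apply: (closure_sn0 (cs_comp cg cp) _ Sx) => y Sy /=.
have : (g @^-1` [set 0]) y.
  by apply: (linspan_min _ _ Sy) => //; apply: kernel_subspace; case: cg.
by move=> /= ->; rewrite (sn0 (proj1 cp)).
Qed.

Lemma cs_normc : cs (@Normc.normc R : R[i]^o -> R).
Proof.
split; first by split => [x y|a x]; [exact: le_normcD|exact: Normc.normcM].
by apply/nbhs_complexP; exists 1 => // c; rewrite sub0r normcN.
Qed.

Lemma fst_continuous_linear E F : continuous_linear (fst : E * F -> E).
Proof. by split => // x; apply: cvg_fst. Qed.

Lemma snd_continuous_linear E F : continuous_linear (snd : E * F -> F).
Proof. by split => // x; apply: cvg_snd. Qed.

End QuotientFactor.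

(** * The unitization and its seminorms *)

Section Unitization.
Context {R : realType} (A : arens_michael R).
Local Notation Ap := (unitization A).
Local Notation mulp := (@unitization_mul R A).

Definition unitp : Ap := (0, 1).

Local Notation mA := (@am_mul R A).
Let mAr x : linear (mA x). Proof. exact: (proj1 (am_bilinear A)). Qed.
Let mAl y : linear (mA^~ y). Proof. exact: (proj2 (am_bilinear A)). Qed.

Lemma mulp_linr u : linear (mulp u).
Proof.
move=> a v w; rewrite /unitization_mul /=; congr pair; last first.
  by rewrite /= mulrDr; congr (_ + _); rewrite mulrCA.
rewrite /= mAr !scalerDr scalerDl !scalerA [u.2 * a]mulrC !addrA.
by rewrite [LHS](ACl (1 * 3 * 5 * 2 * 4 * 6))%AC.
Qed.

Lemma mulp_linl v : linear (mulp^~ v).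
Proof.
move=> a u w; rewrite /unitization_mul /=; congr pair; last first.
  by rewrite /= mulrDl; congr (_ + _); apply: (esym (mulrA a u.2 v.2)).
rewrite /= mAl !scalerDr scalerDl !scalerA [v.2 * a]mulrC !addrA.
by rewrite [LHS](ACl (1 * 3 * 5 * 2 * 4 * 6))%AC.
Qed.

Lemma mulpA : associative mulp.
Proof.
move=> u v w; rewrite /unitization_mul /=; congr pair; last by rewrite /= mulrA.
rewrite !(linD (mAl _)) !(linD (mAr _)) !(linZ (mAl _)) !(linZ (mAr _)).
rewrite !scalerDr !scalerA am_assoc !addrA.
rewrite [RHS](ACl (1 * 3 * 5 * 2 * 4 * 6 * 7))%AC.
by rewrite [u.2 * w.2]mulrC [v.2 * w.2]mulrC.
Qed.

Lemma mulp1 u : mulp u unitp = u.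
Proof.
case: u => u1 u2; rewrite /unitization_mul /= (lin0 (mAr _)) scaler0 scale1r mulr1.
by rewrite !add0r.
Qed.

Lemma mul1p u : mulp unitp u = u.
Proof.
case: u => u1 u2; rewrite /unitization_mul /= (lin0 (mAl _)) scaler0 scale1r mul1r.
by rewrite add0r addr0.
Qed.

(** The l1 norm on [A_+]: it inherits submultiplicativity from [p] and gives the identity norm 1. *)
Definition normp (p : A -> R) (u : Ap) : R := p u.1 + Normc.normc u.2.

Lemma normp_cs p : cs p -> cs (normp p).
Proof.
move=> cp; apply: (@csD _ Ap (p \o fst) (@Normc.normc R \o snd)).
  by apply: (@cs_comp _ Ap A fst) => //; apply: fst_continuous_linear.
apply: (@cs_comp _ Ap R[i]^o snd); first exact: snd_continuous_linear.
exact: cs_normc.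
Qed.

Lemma normp_submul p : seminorm p -> (forall a b, p (am_mul a b) <= p a * p b) ->
  forall u v, normp p (mulp u v) <= normp p u * normp p v.
Proof.
move=> sp pm u v; rewrite /normp /= Normc.normcM mulrDr !mulrDl.
have := snD sp (am_mul u.1 v.1 + u.2 *: v.1) (v.2 *: u.1).
have := snD sp (am_mul u.1 v.1) (u.2 *: v.1).
rewrite !(snZ sp); have := pm u.1 v.1.
rewrite [Normc.normc v.2 * _]mulrC; lra.
Qed.

(** Finitely many submultiplicative seminorms are dominated by their sum, which is again
    submultiplicative. *)
Lemma submul_seminorm (U : set Ap) : nbhs 0 U -> exists p : A -> R,
  [/\ cs p, forall a b, p (am_mul a b) <= p a * p b &
    exists2 e : R, 0 < e & [set u | normp p u < e] `<=` U].
Proof.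
move=> [[U1 U2] /= [nU1 nU2] U12].
have [P Psub Ptop] := am_submul A.
have [S [e [fS SP e0 SU]]] := (Ptop U1).1 nU1.
have [d d0 dU] := (nbhs_complexP 0 U2).1 nU2.
have Pcs p : P p -> cs p.
  move=> Pp; split; first by case: (Psub p Pp).
  apply/Ptop; exists [set p], 1; split => //.
  - by move=> _ ->.
  - by move=> x; apply.
have [r rS] := (finite_seqP S).1 fS.
have [p [cp pm pS]] : exists p : A -> R, [/\ cs p,
    forall a b, p (am_mul a b) <= p a * p b & forall s, s \in r -> forall a, s a <= p a].
  have : forall s, s \in r -> P s by move=> s sr; apply: SP; rewrite rS.
  elim: (r) => [|s r' IH] rP.
    by exists (fun=> 0); split => [|a b|s]; [exact: cs0|rewrite mulr0|rewrite in_nil].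
  have rP' t : t \in r' -> P t by move=> tr; apply: rP; rewrite inE tr orbT.
  have [p [cp pm pr]] := IH rP'.
  have Ps : P s by apply: rP; rewrite inE eqxx.
  have [cS sm] := (Pcs s Ps, proj2 (Psub s Ps)).
  have s0 := sn_ge0 (proj1 cS); have p0 := sn_ge0 (proj1 cp).
  exists (fun a => s a + p a); split; first exact: csD.
    move=> a b; rewrite mulrDr !mulrDl; have := sm a b; have := pm a b.
    have := mulr_ge0 (p0 a) (s0 b); have := mulr_ge0 (s0 a) (p0 b); lra.
  move=> t; rewrite inE => /orP[/eqP -> a|/pr tp a]; first by rewrite lerDl.
  by apply: le_trans (tp a) _; rewrite lerDr.
exists p; split => //; exists (Num.min e d); first by rewrite lt_min e0.
move=> u /=; rewrite lt_min => /andP[ue ud].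
apply: U12; split => /=.
  apply: SU => s; rewrite rS => /pS /(_ u.1) su.
  apply: le_lt_trans su _; apply: le_lt_trans ue.
  by rewrite lerDl normc_ge0.
apply: dU; rewrite sub0r normcN; apply: le_lt_trans ud.
by rewrite lerDr sn_ge0//; case: cp.
Qed.

End Unitization.

(** * The unital action of the unitization on right modules *)

Section RightAction.
Context {R : realType} (A : arens_michael R).
Local Notation Ap := (unitization A).

Definition actp (Y : rmodule A) (y : Y) (u : Ap) : Y := ract y u.1 + u.2 *: y.

Lemma actp_bilinear (Y : rmodule A) : bilinear_map (@actp Y).
Proof.
have [rb lb] := @ract_bilinear R A Y; split => [y a u v|u a y z].
  rewrite /actp /= rb scalerDl !scalerDr !scalerA addrACA.
  by rewrite -!addrA.
by rewrite /actp lb !scalerDr !scalerA [u.2 * a]mulrC addrACA.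
Qed.

Lemma actp_linr (Y : rmodule A) (y : Y) : linear (actp y).
Proof. exact: (proj1 (actp_bilinear Y)). Qed.

Lemma actp_linl (Y : rmodule A) u : linear (fun y : Y => actp y u).
Proof. exact: (proj2 (actp_bilinear Y)). Qed.

Lemma actp_mul (Y : rmodule A) (y : Y) u v :
  actp y (unitization_mul u v) = actp (actp y u) v.
Proof.
have [rb lb] := @ract_bilinear R A Y.
rewrite /actp /unitization_mul /= !(linD (rb _)) !(linZ (rb _)) (linD (lb _)).
rewrite (linZ (lb _)) ract_assoc scalerDr scalerA -!addrA [u.2 * v.2]mulrC.
by [].
Qed.

Lemma actp1 (Y : rmodule A) (y : Y) : actp y (unitp A) = y.
Proof.
have [rb lb] := @ract_bilinear R A Y.
by rewrite /actp /unitp /= (lin0 (rb _)) add0r scale1r.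
Qed.

Lemma actp_ract (Y : rmodule A) (y : Y) a : actp y ((a, 0) : Ap) = ract y a.
Proof. by rewrite /actp /= scale0r addr0. Qed.

Lemma actp_bound (Y : rmodule A) (r : Y -> R) : cs r -> exists p w,
  [/\ cs p, cs w & forall (y : Y) (u : Ap), r (actp y u) <= p y * w u].
Proof.
move=> cr.
have [p [s [cp cS ps]]] :=
  (jointly_continuous_csP (@ract_bilinear R A Y)).1 (@ract_continuous R A Y) r cr.
(* The summand [r y] pays for the scalar part [u.2 *: y]. *)
exists (fun y => p y + r y), (normp s); split; first exact: csD.
  exact: normp_cs.
move=> y u; apply: le_trans (snD (proj1 cr) _ _) _; rewrite (snZ (proj1 cr)).
rewrite /normp mulrDr !mulrDl; have := ps y u.1.
have := mulr_ge0 (sn_ge0 (proj1 cr) y) (sn_ge0 (proj1 cS) u.1).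
have := mulr_ge0 (sn_ge0 (proj1 cp) y) (normc_ge0 u.2).
rewrite [r y * Normc.normc _]mulrC; lra.
Qed.

Lemma actp_continuousr (Y : rmodule A) (y : Y) : continuous_linear (actp y).
Proof.
apply: continuous_of_cs; first exact: actp_linr.
move=> r cr; have [p [w [cp cw rw]]] := actp_bound cr.
apply: (cs_of_le _ (sn_ge0 (proj1 cp) y) cw); last exact: rw.
by apply: seminorm_comp; [exact: actp_linr|case: cr].
Qed.

Lemma actp_continuousl (Y : rmodule A) u : continuous_linear (fun y : Y => actp y u).
Proof.
apply: continuous_of_cs; first exact: actp_linl.
move=> r cr; have [p [w [cp cw rw]]] := actp_bound cr.
apply: (cs_of_le _ (sn_ge0 (proj1 cw) u) cp).
  exact: (seminorm_comp (actp_linl u) (proj1 cr)).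
by move=> y; rewrite mulrC; apply: rw.
Qed.

Lemma morphism_actp (Y Z : rmodule A) (f : Y -> Z) y u :
  rmodule_morphism f -> f (actp y u) = actp (f y) u.
Proof.
by move=> [[lf _] fa]; rewrite /actp (linD lf) (linZ lf) fa.
Qed.

End RightAction.

Section CyclicTensor.
Context {R : realType} (A : arens_michael R) (I : set (unitization A)).
Variables (X : lmodule A) (q : unitization A -> X).
Hypotheses (hI : closed_left_ideal I) (hX : is_cyclic_completion I q).
Local Notation Ap := (unitization A).

Let lq : linear q. Proof. by case: hX => [[_ []]]. Qed.
Let cq : continuous_linear q. Proof. by case: hX => [[]]. Qed.
Let oq : open_onto_range q. Proof. by case: hX => [[]]. Qed.
Let dq : dense (range q). Proof. by case: hX => [[]]. Qed.

Lemma cyclic_kernel u : I u <-> q u = 0.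
Proof. by case: hX => [[_ _ qI _ _] _]; rewrite -qI. Qed.

Lemma cyclic_gen u : q u = lact u.1 (q (unitp A)) + u.2 *: q (unitp A).
Proof.
rewrite -(proj2 hX) -(linZ lq) -(linD lq) mulp1; congr q.
case: u => a c; rewrite /unitp; congr pair => /=.
  by rewrite scaler0 addr0.
by rewrite add0r -[RHS]/(c * 1) mulr1.
Qed.

Section OneModule.
Variables (Y : rmodule A) (T : tensor_over Y X).

Lemma pure_bilinear : bilinear_map (pure T).
Proof.
have [_ [rb lb] _ _] := to_tensorP T; have [_ [lt _] _ _ _] := to_quotP T.
by split => [y a x x'|x a y y']; rewrite /pure ?rb ?lb lt.
Qed.

Lemma pure_balanced y a x : pure T (ract y a) x = pure T y (lact a x).
Proof.
apply/eqP; rewrite -subr_eq0; apply/eqP.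
have [_ [lt _] ker _ _] := to_quotP T.
rewrite /pure -(linB lt).
have : closed_span (balanced_relations (to_pure T))
   (to_pure T (ract y a) x - to_pure T y (lact a x)).
  by apply: subset_closure; apply: sub_linspan; exists y, a, x.
by rewrite -ker.
Qed.

Lemma pure_continuous : jointly_continuous (pure T).
Proof.
have [_ tb tc _] := to_tensorP T; have [_ ct _ _ _] := to_quotP T.
apply/(jointly_continuous_csP pure_bilinear) => r cr.
exact: (jointly_continuous_csP tb).1 tc _ (cs_comp ct cr).
Qed.

Definition pure_gen (y : Y) : T := pure T y (q (unitp A)).

(** Balancing moves [u] to the left factor, so that one vector of [X], the class of 1, suffices on
    the right. *)
Lemma pure_q y u : pure T y (q u) = pure_gen (actp y u).
Proof.
have [rb lb] := pure_bilinear.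
by rewrite cyclic_gen (linD (rb y)) (linZ (rb y)) -pure_balanced /pure_gen /actp
  (linD (lb _)) (linZ (lb _)).
Qed.

Lemma pure_gen_continuous : continuous_linear pure_gen.
Proof.
have [rb lb] := pure_bilinear.
apply: continuous_of_cs; first exact: lb.
move=> s cS; have [p [r [cp cr pr]]] :=
  (jointly_continuous_csP pure_bilinear).1 pure_continuous s cS.
apply: (cs_of_le _ (sn_ge0 (proj1 cr) (q (unitp A))) cp).
  exact: (seminorm_comp (lb _) (proj1 cS)).
by move=> y; rewrite mulrC; apply: pr.
Qed.

Lemma pure_gen_null y u : I u -> pure_gen (actp y u) = 0.
Proof.
move=> /cyclic_kernel qu; rewrite -pure_q qu.
by have [rb _] := pure_bilinear; rewrite (lin0 (rb y)).
Qed.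

(** Tensors [y (x) q u] have the form [pure_gen (y u)]. Density of [range q] in [X] and of the span
    of the pure tensors does the rest, as the closure of a subspace is a subspace. *)
Lemma pure_gen_dense : dense (range pure_gen).
Proof.
have [tc tb tj _] := to_tensorP T; have [cT [lt ct] ker ot dt] := to_quotP T.
have td := tensor_dense (to_tensorP T).
have [rb lb] := pure_bilinear.
have lg : linear pure_gen by case: pure_gen_continuous.
have scl := subspace_closure (range_subspace lg).
have purecl y x : closure (range pure_gen) (pure T y x).
  apply/closure_csP => s cS.
  have [p [r [cp cr pr]]] :=
    (jointly_continuous_csP pure_bilinear).1 pure_continuous s cS.
  have p1 : 0 < (p y + 1)^-1 by rewrite invr_gt0 ltr_wpDl// sn_ge0//; case: cp.
  have [_ [u _ <-] ru] := closure_cs_ball ((dense_closureP _).1 dq x) cr p1.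
  exists (pure T y (q u)); first by rewrite pure_q; exists (actp y u).
  rewrite -(linB (rb y)); apply: le_lt_trans (pr _ _) _.
  apply: (@le_lt_trans _ _ (p y * (p y + 1)^-1)).
    by rewrite ler_wpM2l ?(ltW ru)// sn_ge0//; case: cp.
  by rewrite ltr_pdivrMr ?mul1r ?ltrDl// ltr_wpDl// sn_ge0//; case: cp.
apply/dense_closureP => z; apply/closure_csP => s cS.
have e2 : 0 < (2^-1 : R) by lra.
have [_ [w _ <-] sw] := closure_cs_ball ((dense_closureP _).1 dt z) cS e2.
have [w' Sw' sw'] := closure_cs_ball ((dense_closureP _).1 td w)
  (cs_comp (conj lt ct) cS) e2.
have /closure_cs_ball : closure (range pure_gen) (to_quot w').
  apply: (linspan_min (preimage_subspace lt scl) _ Sw').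
  by move=> _ [[y x] _ <-]; apply: purecl.
move=> /(_ _ (1 - s (to_quot w' - z)) cS) [|v Vv sv].
  have := sn_tri (proj1 cS) (to_quot w) (to_quot w') z.
  by rewrite -(linB lt); move: sw' => /=; lra.
exists v => //; have := sn_tri (proj1 cS) (to_quot w') v z; lra.
Qed.

(* Maps out of [Y / Y I] factor through [T] by the universal property; applied
   to the completion of [Y] for the single seminorm [r], this shows that [T] is
   the completion of [Y / Y I]. *)
Lemma pure_gen_seminorm (r : Y -> R) : cs r ->
  (forall y u, I u -> r (actp y u) = 0) ->
  exists2 s : T -> R, cs s & forall y, s (pure_gen y) = r y.
Proof.
move=> cr rI.
(* [Z] is a complete target whose norm restricts to [r]; since [r] kills the products [y u] with [u]
   in [I], so does [j]. *)
have [Z [j [n [cZ lj _ nn nr]]]] := normed_completion_exists (proj1 cr).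
have hZ := proj1 cZ.
have cj : continuous_linear j.
  apply: continuous_of_cs => // s cS; have [c c0 sc] := (proj2 nn) s cS.
  apply: (cs_of_le _ c0 cr); first exact: seminorm_comp (proj1 cS).
  by move=> y; rewrite -nr; apply: sc.
have jI y u : I u -> j (actp y u) = 0.
  move=> Iu; apply: (hausdorff_csP Z).1 => // s cS.
  have [c c0 sc] := (proj2 nn) s cS.
  apply/eqP; rewrite eq_le (sn_ge0 (proj1 cS)) andbT.
  by apply: le_trans (sc _) _; rewrite nr rI// mulr0.
(* [b y] extends the map from [q u] to [j (y u)], well defined because [j] kills [y I]. *)
have fex y : exists g : X -> Z, [/\ continuous_linear g,
    forall u, g (q u) = j (actp y u) &
    forall s t, cs s -> cs t -> (forall u, s (j (actp y u)) <= t (q u)) ->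
      forall w, s (g w) <= t w].
  apply: (completes_quotient_factor (proj1 hX) cZ (h := j \o actp y)).
    by apply: continuous_linear_comp => //; apply: actp_continuousr.
  by move=> u Iu /=; apply: jI.
have [b bP] := choice fex.
have bq y u : b y (q u) = j (actp y u) by have [_ + _] := bP y; apply.
have bl y : continuous_linear (b y) by case: (bP y).
have bb : bilinear_map b.
  split => [y|x a y y']; first by case: (bl y).
  have cl : continuous_linear (fun x => a *: b y x + b y' x).
    apply: continuous_of_cs => [c x1 x2|s cS].
      rewrite (proj1 (bl y)) (proj1 (bl y')) !scalerDr !scalerA [a * c]mulrC.
      by rewrite addrACA.
    have na := normc_ge0 a.
    apply: (cs_of_le _ ler01 (csD (csZ na (cs_comp (bl y) cS)) (cs_comp (bl y') cS))).
      apply: (@seminorm_comp _ _ _ (fun x => a *: b y x + b y' x)); last by case: cS.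
      move=> c x1 x2; rewrite (proj1 (bl y)) (proj1 (bl y')) !scalerDr !scalerA [a * c]mulrC.
      by rewrite addrACA.
    move=> x1; rewrite mul1r /= -(snZ (proj1 cS)); exact: snD (proj1 cS) _ _.
  apply: (dense_eq hZ dq (bl _) cl) => _ [u _ <-].
  by rewrite !bq -lj; congr j; apply: actp_linl.
have bc : jointly_continuous b.
  apply/(jointly_continuous_csP bb) => s cS.
  have [p [w [cp cw pw]]] := actp_bound (cs_comp cj cS).
  have sI : linsub I by case: hI.
  (* The bound may depend only on the class of [u]: [w] is replaced by its distance to [I], which is
     dominated by a continuous seminorm of [q u]. *)
  have cwI := cs_qsn sI cw.
  have [u0|t ct wt] := open_onto_range_descend lq oq cwI.
    by move=> /cyclic_kernel Iu; apply: qsn_null => //; case: cw.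
  exists p, t; split => // y x; have [_ _ /(_ s (fun x => p y * t x) cS)] := bP y.
  apply; first by apply: csZ => //; apply: sn_ge0; case: cp.
  have p0 := sn_ge0 (proj1 cp) y.
  move=> u; apply: le_trans (ler_wpM2l p0 (wt u)).
  apply: (qsn_ge_mul sI) => // m Im.
  apply: le_trans (pw y (u + m)); rewrite /= (linD (actp_linr y)) (linD lj).
  by rewrite (jI y m Im) addr0.
have [cG tb tj tu] := to_tensorP T.
have [g [[cg gt] _]] := tu Z b cZ bb bc.
have g0 z : closed_span (balanced_relations (to_pure T)) z -> g z = 0.
  apply: closed_span_null => // _ [y [a [x ->]]].
  rewrite (linB (proj1 cg)) !gt; apply/eqP; rewrite subr_eq0; apply/eqP.
  have cl : continuous_linear (fun x => b y (lact a x)).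
    apply: (continuous_linear_comp _ (bl y)).
    have [rb lb] := @lact_bilinear R A X.
    apply: continuous_of_cs; first exact: rb.
    move=> s cS; have [p1 [p2 [cp1 cp2 p12]]] :=
      (jointly_continuous_csP (@lact_bilinear R A X)).1 (@lact_continuous R A X) s cS.
    apply: (cs_of_le _ (sn_ge0 (proj1 cp1) a) cp2); last by move=> z1; apply: p12.
    exact: (seminorm_comp (rb a) (proj1 cS)).
  apply: (dense_eq hZ dq (bl _) cl) => _ [u _ <-].
  by rewrite -(proj2 hX) !bq actp_mul actp_ract.
have [h [ch hq _]] := completes_quotient_factor (to_quotP T) cZ cg g0.
exists (n \o h); first by apply: cs_comp => //; case: nn.
by move=> y; rewrite /= /pure_gen /pure hq gt bq actp1 nr.
Qed.

End OneModule.
End CyclicTensor.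

Section TensorExists.
Context {R : realType} (A : arens_michael R) (X : lmodule A).

Lemma tensor_over_exists (Y : rmodule A) : inhabited (tensor_over Y X).
Proof.
have [G [t tG]] := tensor_exists Y X.
have sub : linsub (closed_span (balanced_relations t)).
  by apply: subspace_closure; apply: linspan_subspace.
have [W [p pW]] := quotient_completion_exists sub (@closed_closure _ _).
by apply: inhabits; apply: (TensorOver tG pW).
Qed.

Lemma tensor_map_exists (Y Z : rmodule A) (T : tensor_over Y X) (T' : tensor_over Z X)
    (f : Y -> Z) : rmodule_morphism f -> exists g : T -> T', is_tensor_map f g.
Proof.
move=> [cf fa].
have [rb lb] := pure_bilinear T'.
have [cT' _ _ _ _] := to_quotP T'.
have bb : bilinear_map (fun y x => pure T' (f y) x).
  by split => [y|x a y y']; [exact: rb|rewrite (proj1 cf) lb].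
have bc : jointly_continuous (fun y x => pure T' (f y) x).
  apply/(jointly_continuous_csP bb) => r cr; have [p [s [cp cS ps]]] :=
    (jointly_continuous_csP (pure_bilinear T')).1 (pure_continuous (T := T')) r cr.
  by exists (p \o f), s; split; [exact: cs_comp|by []|by move=> x y; apply: ps].
have [_ _ _ tu] := to_tensorP T.
have [g [[cg gt] _]] := tu T' _ cT' bb bc.
have g0 z : closed_span (balanced_relations (to_pure T)) z -> g z = 0.
  apply: closed_span_null => //; first by case: cT'.
  move=> _ [y [a [x ->]]].
  rewrite (linB (proj1 cg)) !gt fa pure_balanced subrr //.
have [h [ch hq _]] := completes_quotient_factor (to_quotP T) cT' cg g0.
by exists h; split => // y x; rewrite /pure hq gt.
Qed.

End TensorExists.

(** * From approximate identities to exactness *)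

Section StrictExactness.
Context {R : realType}.
Variables (E F G : tvsType R[i]) (i : E -> F) (p : F -> G).

Lemma closure_of_qsn0 (N : set F) y : linsub N ->
  (forall r, cs r -> qsn N r y = 0) -> closure N y.
Proof.
move=> sN h; apply/closure_csP => r cr.
have [m Nm rm] := qsn_approx sN (proj1 cr) y ltr01.
exists (- m); first exact: subspaceN.
by rewrite -(snN (proj1 cr)) opprB opprK; rewrite h// add0r in rm.
Qed.

(** A kernel element has distance 0 to [range i] for every [r], hence lies in its closure; the range
    is closed because [E] is complete and [i] an embedding. *)
Lemma exact_pair_maps_of_cs : complete_lcs E -> hausdorff_space F ->
  continuous_linear i -> continuous_linear p -> (forall x, p (i x) = 0) ->
  (forall r, cs r -> exists2 s, cs s & forall x, r x <= s (i x)) ->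
  (forall r, cs r -> exists2 s, cs s & forall y, qsn (range i) r y <= s (p y)) ->
  dense (range p) -> exact_pair_maps i p.
Proof.
move=> cE hF ci cp pi0 hi hp dp.
have s0 : linsub [set (0 : E)].
  by split => // a x y /= -> ->; rewrite scaler0 addr0.
have sr := range_subspace (proj1 ci).
split => //.
- move=> x y ixy; apply/eqP; rewrite -subr_eq0; apply/eqP.
  have /hausdorff_csP hE := proj1 cE; apply: hE => r cr; have [s cS rs] := hi r cr.
  apply/eqP; rewrite eq_le (sn_ge0 (proj1 cr)) andbT.
  by apply: le_trans (rs _) _; rewrite (linB (proj1 ci)) ixy subrr (sn0 (proj1 cS)).
- apply: (open_onto_range_of_cs (proj1 ci) s0) => [x ->|r cr].
    exact: lin0 (proj1 ci).
  have [s cS rs] := hi r cr; exists s => // x.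
  by apply: le_trans (qsn_le_sn s0 (proj1 cr) x) (rs x).
- apply/seteqP; split => [_ [x _ <-] //|y /= py]; first exact: pi0.
  apply: (complete_embedding_closed cE hF ci hi).
  apply: (closure_of_qsn0 sr) => r cr; have [s cS rs] := hp r cr.
  apply/eqP; rewrite eq_le (sn_ge0 (qsn_seminorm sr (proj1 cr))) andbT.
  by apply: le_trans (rs y) _; rewrite py (sn0 (proj1 cS)).
- apply: (open_onto_range_of_cs (proj1 cp) sr) => // _ [x _ <-].
  exact: pi0.
Qed.

Lemma exact_pair_embedding r : continuous_linear i -> exact_pair_maps i p -> cs r ->
  exists2 s, cs s & forall x, r x <= s (i x).
Proof.
move=> ci [inj oi _ _ _] cr; apply: (open_onto_range_descend (proj1 ci) oi cr).
move=> x; rewrite -(lin0 (proj1 ci)) => /inj ->.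
exact: sn0 (proj1 cr).
Qed.

Lemma exact_pair_quotient r : continuous_linear p -> exact_pair_maps i p -> cs r ->
  exists2 s, cs s & forall y, qsn (range i) r y <= s (p y).
Proof.
by move=> cp [_ _ -> op _] cr; apply: (open_onto_range_cs (proj1 cp) op cr).
Qed.

End StrictExactness.

Section TensorExactness.
Context {R : realType} (A : arens_michael R) (I : set (unitization A)).
Variables (X : lmodule A) (q : unitization A -> X).
Hypotheses (hI : closed_left_ideal I) (hX : is_cyclic_completion I q).
Local Notation Ap := (unitization A).

(** The algebraic span [Y I]; distances for continuous seminorms do not distinguish it from its
    closure. *)
Definition action_span (Y : rmodule A) : set Y :=
  linspan [set z | exists y u, I u /\ z = actp y u].
Arguments action_span Y _ : clear implicits.

Let sI : linsub I. Proof. by case: hI. Qed.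

Lemma action_span_subspace (Y : rmodule A) : linsub (action_span Y).
Proof. exact: linspan_subspace. Qed.

Lemma action_span_null (Y : rmodule A) (T : tensor_over Y X) z :
  action_span Y z -> pure_gen q T z = 0.
Proof.
apply: (linspan_min (kernel_subspace (proj1 (pure_gen_continuous q T)))).
by move=> _ [y [u [Iu ->]]]; apply: (pure_gen_null hX).
Qed.

(** Together with the dense range of [pure_gen] this describes the topology of [T] by distances to
    [Y I]. *)
Lemma pure_gen_qsn (Y : rmodule A) (T : tensor_over Y X) r : cs r ->
  exists2 s : T -> R, cs s & forall y, s (pure_gen q T y) = qsn (action_span Y) r y.
Proof.
move=> cr; have sY := action_span_subspace Y.
apply: (pure_gen_seminorm hI hX); first exact: cs_qsn.
move=> y u Iu; apply: qsn_null => //; first by case: cr.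
by apply: sub_linspan; exists y, u.
Qed.

Section OneMap.
Variables (Y Z : rmodule A) (f : Y -> Z) (T : tensor_over Y X) (T' : tensor_over Z X).
Variable (g : T -> T').
Hypotheses (mf : rmodule_morphism f) (mg : is_tensor_map f g).

Lemma tensor_map_gen y : g (pure_gen q T y) = pure_gen q T' (f y).
Proof. exact: (proj2 mg). Qed.

(** Since [f] has dense range, [z u] is a limit of elements [(f y) u = f (y u)]. *)
Lemma action_span_dense s l (e : R) : dense (range f) -> cs s -> 0 < e ->
  action_span Z l -> exists2 m, action_span Y m & s (l - f m) < e.
Proof.
move=> df cS e0 Zl.
have sY := action_span_subspace Y; have lf := proj1 (proj1 mf).
have sfY : linsub (closure (f @` action_span Y)).
  apply: subspace_closure; split; first by exists 0; [case: sY|exact: lin0].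
  move=> a _ _ [u Yu <-] [v Yv <-]; exists (a *: u + v); last exact: lf.
  exact: sY.2.
have /closure_cs_ball : closure (f @` action_span Y) l.
  apply: (linspan_min sfY _ Zl) => _ [z [u [Iu ->]]].
  apply/closure_csP => t ct.
  have [_ [y _ <-] ty] := closure_cs_ball ((dense_closureP _).1 df z)
    (cs_comp (actp_continuousl _ u) ct) ltr01.
  exists (f (actp y u)).
    by exists (actp y u) => //; apply: sub_linspan; exists y, u.
  by rewrite morphism_actp// -(linB (actp_linl u)).
move=> /(_ s e cS e0) [_ [m Ym <-] sm]; exists m => //.
by rewrite (snC (proj1 cS)).
Qed.

End OneMap.

Section OnePair.
Variables (Y1 Y2 Y3 : rmodule A) (i : Y1 -> Y2) (p : Y2 -> Y3).
Hypotheses (mi : rmodule_morphism i) (mp : rmodule_morphism p).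
Hypothesis ip : exact_pair_maps i p.
Variables (T1 : tensor_over Y1 X) (T2 : tensor_over Y2 X) (T3 : tensor_over Y3 X).
Variables (iX : T1 -> T2) (pX : T2 -> T3).
Hypotheses (miX : is_tensor_map i iX) (mpX : is_tensor_map p pX).

Let ciX : continuous_linear iX := proj1 miX.
Let cpX : continuous_linear pX := proj1 mpX.

Lemma tensor_complete (Y : rmodule A) (T : tensor_over Y X) : complete_lcs T.
Proof. by case: (to_quotP T). Qed.

Lemma tensor_pair_null x : pX (iX x) = 0.
Proof.
have c0 : continuous_linear ((fun=> 0) : T1 -> T3).
  split; first by move=> a u v; rewrite scaler0 addr0.
  by move=> u; apply: cvg_cst.
suff h : pX \o iX =1 (fun=> 0) by exact: h x.
apply: (dense_eq (proj1 (tensor_complete T3)) (pure_gen_dense hX (T := T1))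
  (continuous_linear_comp ciX cpX) c0) => _ [y _ <-] /=.
rewrite (tensor_map_gen miX) (tensor_map_gen mpX).
have -> : p (i y) = 0.
  by have [_ _ e _ _] := ip; have : range i (i y) by []; rewrite e.
by apply: lin0; case: (pure_gen_continuous q T3).
Qed.

Lemma tensor_pair_dense : dense (range pX).
Proof.
apply/dense_closureP => z; apply/closure_csP => s cS.
have e2 : 0 < (2^-1 : R) by lra.
have [_ [y _ <-] sy] := closure_cs_ball ((dense_closureP _).1 (pure_gen_dense hX (T := T3)) z) cS e2.
have [_ _ _ _ dp] := ip.
have ct := pure_gen_continuous q T3.
have [_ [x _ <-] sx] := closure_cs_ball ((dense_closureP _).1 dp y) (cs_comp ct cS) e2.
exists (pX (pure_gen q T2 x)); first by exists (pure_gen q T2 x).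
rewrite (tensor_map_gen mpX).
have := sn_tri (proj1 cS) (pure_gen q T3 y) (pure_gen q T3 (p x)) z.
by move: sx; rewrite /= (linB (proj1 ct)); lra.
Qed.

(** For [l] in [Y3 I], approximate [l] by [p m] with [m] in [Y2 I] and lift [p (y + m)] to some
    [y + m + i x]: it still represents the class of [y] modulo [range iX], and its size is
    controlled by [p y + l]. *)
Lemma tensor_pair_quotient r : cs r -> exists2 s, cs s &
  forall z, qsn (range iX) r z <= s (pX z).
Proof.
move=> cr; have ct2 := pure_gen_continuous q T2.
have cr2 := cs_comp ct2 cr.
have [s3 cs3 rs3] := exact_pair_quotient (proj1 mp) ip cr2.
have [s cS sE] := pure_gen_qsn T3 cs3.
exists s => //.
have sr := range_subspace (proj1 ciX).
have sri := range_subspace (proj1 (proj1 mi)).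
apply: (dense_le (pure_gen_dense hX (T := T2))).
- exact: cs_qsn.
- exact: cs_comp.
move=> _ [y _ <-]; rewrite /= (tensor_map_gen mpX) sE.
apply: qsn_ge; first exact: action_span_subspace.
move=> l Yl; apply/ler_addgt0Pr => e e0.
have e2 : 0 < e / 2 by lra.
have [_ _ _ _ dp] := ip.
have [m Ym sm] := action_span_dense mp dp cs3 e2 Yl.
have [_ [x _ <-] rk] := qsn_approx sri (proj1 cr2) (y + m) e2.
have rle : qsn (range iX) r (pure_gen q T2 y) <= r (pure_gen q T2 (y + m + i x)).
  rewrite (linD (proj1 ct2)) (linD (proj1 ct2)) (action_span_null _ Ym) addr0.
  by apply: qsn_le; [case: cr|exists (pure_gen q T1 x); rewrite ?(tensor_map_gen miX)].
apply: le_trans rle _; have := rs3 (y + m).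
have := sn_le_sub (proj1 cs3) (p (y + m)) (p y + l).
rewrite (linD (proj1 (proj1 mp))) opprD addrACA subrr add0r (snC (proj1 cs3)).
by move: rk => /=; lra.
Qed.

Lemma exact_pair_of_embedding :
  (forall r, cs r -> exists2 s, cs s & forall x, r x <= s (iX x)) ->
  exact_pair_lcs iX pX.
Proof.
move=> h; split; first by split; apply: tensor_complete.
split => //; apply: exact_pair_maps_of_cs => //.
- exact: tensor_complete.
- by case: (tensor_complete T2).
- exact: tensor_pair_null.
- exact: tensor_pair_quotient.
- exact: tensor_pair_dense.
Qed.

(* For [b] in [I], the element [y b] dies in the tensor product, while
   [i y - i y b] is close to [(i y + m) - (i y + m) b] when [b] is close to a
   right unit for the elements of [I] that occur in [m]. *)
Lemma tensor_pair_embedding : right_locally_bounded_ai (@unitization_mul R A) I ->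
  forall r, cs r -> exists2 s, cs s & forall x, r x <= s (iX x).
Proof.
move=> hb r cr; have ct1 := pure_gen_continuous q T1.
have [s2 cs2 rs2] := exact_pair_embedding (proj1 mi) ip (cs_comp ct1 cr).
have [s' [w [cs' cw sw]]] := actp_bound cs2.
pose U : set Ap := [set u | I u /\ w u < 1].
have [||c c0 hc] := hb U.
- by move=> u [].
- apply: filterS (proj2 cw) => u wu Iu; split => //.
(* This seminorm bounds [s2 (z - z b)] for every [b] in [c U], and it is fixed before [m] and [e]
   are. *)
have ct : cs (fun z => s2 z + c * s' z) by apply: csD => //; apply: csZ => //; exact: ltW.
have [s cS sE] := pure_gen_qsn T2 ct; exists s => //.
apply: (dense_le (pure_gen_dense hX (T := T1)) cr (cs_comp ciX cS)).
move=> _ [y _ <-]; rewrite /= (tensor_map_gen miX) sE.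
apply: qsn_ge; first exact: action_span_subspace.
move=> m Ym; apply/ler_addgt0Pr => e e0.
(* The finite set depends on [m] and [e], whereas [U] and hence [c] do not. *)
have key : exists S : set Ap, [/\ finite_set S, S `<=` I &
    forall b, (forall a, S a -> U (a - unitization_mul a b)) -> s2 (m - actp m b) <= e].
  move: m e e0 {c c0 hc ct s cS sE} Ym => m e e0 Ym; move: e e0.
  (* The elements [m] that have this property for all [e] form a subspace containing the products
     [z u]. *)
  pose Q := [set m : Y2 | forall e : R, 0 < e -> exists S : set Ap,
    [/\ finite_set S, S `<=` I &
    forall b, (forall a, S a -> U (a - unitization_mul a b)) -> s2 (m - actp m b) <= e]].
  suff : Q m by [].
  have ss := proj1 cs2.
  apply: (linspan_min _ _ Ym) => {m Ym}; last first.
    move=> _ [z [u [Iu ->]]] e e0.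
    have z0 := sn_ge0 (proj1 cs') z.
    (* Shrinking [U] would change [c]; putting [k u] instead of [u] into the finite set gives
       [w (u - u b) < 1 / k] with the same [U]. *)
    pose k := (s' z + 1) / e.
    have k0 : 0 < k by rewrite divr_gt0// ltr_wpDl.
    exists [set k%:C *: u]; split; first exact: finite_set1.
      by move=> _ ->; apply: subspaceZ.
    move=> b /(_ _ erefl) [_].
    have -> : k%:C *: u - unitization_mul (k%:C *: u) b =
        k%:C *: (u - unitization_mul u b).
      by rewrite (linZ (mulp_linl b)) scalerBr.
    rewrite (snZr (proj1 cw)) ?(ltW k0)// => wk.
    rewrite -actp_mul -(linB (actp_linr z)); apply: le_trans (sw _ _) _.
    set t := w _ in wk *.
    have t0 : 0 <= t by apply: sn_ge0; case: cw.
    have : (s' z + 1) * t <= e.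
      by move: wk; rewrite /k mulrAC ltr_pdivrMr// mul1r => /ltW.
    by apply: le_trans; rewrite ler_wpM2r//; lra.
  split.
    move=> e e0; exists set0; split => [||b _]; [exact: finite_set0|by move=> ?|].
    by rewrite (lin0 (actp_linl b)) subrr (sn0 ss) ltW.
  move=> a x1 x2 Q1 Q2 e e0.
  have a1 : 0 < Normc.normc a + 1 by rewrite ltr_wpDl// normc_ge0.
  have ea : 0 < e / 2 / (Normc.normc a + 1) by rewrite !divr_gt0.
  have e2 : 0 < e / 2 by lra.
  have [S1 [f1 I1 h1]] := Q1 _ ea; have [S2 [f2 I2 h2]] := Q2 _ e2.
  exists (S1 `|` S2); split; first by rewrite finite_setU.
    by move=> u [/I1|/I2].
  move=> b Sb.
  have -> : a *: x1 + x2 - actp (a *: x1 + x2) b =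
      a *: (x1 - actp x1 b) + (x2 - actp x2 b).
    by rewrite (actp_linl b) opprD addrACA scalerBr.
  apply: le_trans (snD ss _ _) _; rewrite (snZ ss).
  have := h2 b (fun u Su => Sb u (or_intror Su)).
  have := h1 b (fun u Su => Sb u (or_introl Su)).
  rewrite ler_pdivlMr// => hh1 hh2.
  have : Normc.normc a * s2 (x1 - actp x1 b) <= s2 (x1 - actp x1 b) * (Normc.normc a + 1).
    by rewrite mulrC ler_wpM2l ?(sn_ge0 ss)//; lra.
  lra.
have [S [fS SI hS]] := key.
have [b [Ib [u [Iu wu] bE]] Sb] := hc S fS SI.
have sb := hS b Sb.
have ri : r (pure_gen q T1 y) <= s2 (i y - actp (i y) b).
  apply: (@le_trans _ _ (r (pure_gen q T1 (y - actp y b)))).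
    by rewrite (linB (proj1 ct1)) (pure_gen_null hX T1 y Ib) subr0.
  apply: le_trans (rs2 _) _.
  by rewrite (linB (proj1 (proj1 mi))) morphism_actp.
have hz z : s2 (z - actp z b) <= s2 z + c * s' z.
  apply: le_trans (snB (proj1 cs2) _ _) _; rewrite lerD2l.
  apply: le_trans (sw z b) _; rewrite mulrC ler_wpM2r ?(sn_ge0 (proj1 cs'))//.
  rewrite bE (snZr (proj1 cw)) ?(ltW c0)//.
  by rewrite ger_pMr// ltW.
apply: le_trans ri _; apply: le_trans (lerD (hz (i y + m)) sb).
have -> : i y - actp (i y) b = (i y + m - actp (i y + m) b) - (m - actp m b).
  rewrite -[LHS](addrK (m - actp m b)); congr (_ - _).
  have e1 : _ = _ := linD (actp_linl b) (i y) m; rewrite e1.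
  by move: (actp (i y) b) (actp m b) => u1 u2; rewrite opprD addrACA.
exact: snB (proj1 cs2) _ _.
Qed.

End OnePair.

Lemma bounded_ai_tensor_exact :
  right_locally_bounded_ai (@unitization_mul R A) I -> tensor_exact X.
Proof.
move=> hb Y1 Y2 Y3 i p [mi mp ip] T1 T2 T3 iX pX miX mpX.
apply: (exact_pair_of_embedding mi mp ip miX mpX).
exact: (tensor_pair_embedding mi ip miX hb).
Qed.

End TensorExactness.

(** * Banach spaces and the open mapping theorem *)

Section Banach.
Context {R : realType}.
Implicit Types E F : tvsType R[i].

Lemma banach_norming E : is_banach E <-> complete_lcs E /\ exists n : E -> R, norming n.
Proof.
split => [[cE [n [sn nd tn]]]|[cE [n [cn nn]]]]; split => //; exists n.
  have cn : cs n.
    split; first by case: sn.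
    by apply/tn; exists [set n], 1; split => // x; apply.
  split => // s cS; have [S [e [_ Sn e0 Ss]]] := (tn _).1 (proj2 cS).
  have ei : 0 <= e^-1 by rewrite invr_ge0 ltW.
  exists e^-1 => //; apply: (@sn_le_of_ball _ _ _ s (fun x => e^-1 * n x) id) => //.
  - by case: cS.
  - exact: seminormZ.
  move=> x; rewrite mulrC ltr_pdivrMr// mul1r => nx; apply: ltW; apply: Ss => p /Sn -> //.
split; first by case: cn.
  move=> x nx; have /hausdorff_csP hE := proj1 cE; apply: hE => s cS.
  have [c c0 sc] := nn s cS; apply/eqP; rewrite eq_le (sn_ge0 (proj1 cS)) andbT.
  by apply: le_trans (sc x) _; rewrite nx mulr0.
move=> U; split => [/gauge [s cS sU]|[S [e [fS Sn e0 SU]]]].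
  have [c c0 sc] := nn s cS.
  exists [set n], (c + 1)^-1; split => //; first by rewrite invr_gt0; lra.
  move=> x /(_ n erefl) nx; apply: sU; apply: le_lt_trans (sc x) _.
  apply: le_lt_trans (ler_wpM2l c0 (ltW nx)) _.
  by rewrite ltr_pdivrMr; lra.
by apply: filterS (cs_ball cn e0) => x nx; apply: SU => p /Sn ->.
Qed.

Section Sequences.
Variables (E : tvsType R[i]) (n : E -> R).
Hypotheses (cE : complete_lcs E) (nn : norming n).

Let sn : seminorm n. Proof. by case: nn => [[]]. Qed.

Lemma norm_cauchy_cvg (x : nat -> E) :
  (forall e : R, 0 < e -> exists N, forall k l, (N <= k)%N -> (N <= l)%N ->
     n (x k - x l) < e) ->
  exists y, forall e : R, 0 < e -> exists N, forall k, (N <= k)%N -> n (x k - y) < e.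
Proof.
move=> xC; have cF : add_cauchy (x @ \oo).
  move=> U /gauge [s cS sU]; have [c c0 sc] := (proj2 nn) s cS.
  have c1 : 0 < (c + 1)^-1 by rewrite invr_gt0; lra.
  have [N hN] := xC _ c1.
  exists [set z | exists2 k, (N <= k)%N & z = x k].
    by exists N => // k /= Nk; exists k.
  move=> _ _ [k Nk ->] [l Nl ->]; apply: sU; apply: le_lt_trans (sc _) _.
  apply: le_lt_trans (ler_wpM2l c0 (ltW (hN k l Nk Nl))) _.
  by rewrite ltr_pdivrMr; lra.
have [y xy] := proj2 cE _ _ cF; exists y => e e0.
have [N _ hN] := xy _ (nbhs_cs_ball y (proj1 nn) e0).
by exists N => k Nk; apply: hN.
Qed.

Lemma geometric_cvg (x : nat -> E) (C : R) : 0 <= C ->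
  (forall k, n (x k.+1 - x k) <= C * 2^-1 ^+ k) ->
  exists2 y, n (y - x 0%N) <= 2 * C &
    forall e : R, 0 < e -> exists N, forall k, (N <= k)%N -> n (x k - y) < e.
Proof.
move=> C0 xk.
have h m : forall k, n (x (k + m)%N - x k) <= 2 * C * 2^-1 ^+ k.
  elim: m => [|m IH] k.
    by rewrite addn0 subrr (sn0 sn) !mulr_ge0// exprn_ge0// invr_ge0.
  rewrite addnS -addSn; apply: le_trans (sn_tri sn (x k.+1) _ _) _.
  have := IH k.+1; have := xk k; rewrite exprS; lra.
have [e e0|y yx] := norm_cauchy_cvg (x := x).
  have [N hN] : exists N, 2 * C * 2^-1 ^+ N < e / 2.
    have : (fun k => 2 * C * 2^-1 ^+ k) @ \oo --> (2 * C * 0 : R).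
      by apply: cvgMr; apply: cvg_expr; rewrite ger0_norm; lra.
    rewrite mulr0 => /cvgrPdist_lt /(_ (e / 2)) [|N _ hN]; first lra.
    exists N; have /= := hN N (leqnn N); rewrite sub0r normrN ger0_norm//.
    by rewrite !mulr_ge0// exprn_ge0// invr_ge0.
  exists N => k l Nk Nl; have := h (k - N)%N N; have := h (l - N)%N N.
  rewrite !subnKC//; have := sn_tri sn (x N) (x k) (x l).
  by rewrite [n (x N - _)](snC sn); lra.
exists y => //; apply/ler_addgt0Pr => e e0; have [N hN] := yx e e0.
have := hN N (leqnn N); have := h N 0%N; rewrite add0n expr0.
have := sn_tri sn (x N) y (x 0%N); rewrite [n (y - x N)](snC sn); lra.
Qed.

End Sequences.

Section OpenMapping.
Variables (E F : tvsType R[i]) (n : E -> R) (m : F -> R) (f : E -> F).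
Hypotheses (cE : complete_lcs E) (nn : norming n) (nm : norming m).
Hypotheses (hF : hausdorff_space F) (cf : continuous_linear f).

Let sn : seminorm n. Proof. by case: nn => [[]]. Qed.
Let sm : seminorm m. Proof. by case: nm => [[]]. Qed.
Let lf : linear f := proj1 cf.

Lemma norming_eq0 y : m y = 0 -> y = 0.
Proof.
move=> my; have /hausdorff_csP := hF; apply => s cS.
have [c c0 sc] := (proj2 nm) s cS; apply/eqP; rewrite eq_le (sn_ge0 (proj1 cS)) andbT.
by apply: le_trans (sc y) _; rewrite my mulr0.
Qed.

(** Each correction [phi (r j)] halves the residual [r j], so the corrections form a geometric
    series with total at most [2 * (K * m y)]. The subspace [D] allows for both the whole space and
    [range f]. *)
Lemma successive_approximation (D : set F) (K : R) : linsub D -> 0 <= K ->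
  (forall y, D y -> exists x, [/\ D (f x), n x <= K * m y & m (y - f x) <= m y / 2]) ->
  forall y, D y -> exists2 x, f x = y & n x <= 2 * (K * m y).
Proof.
move=> sD K0 h y Dy.
have [y'|phi phiP] := @choice _ _ (fun y x => D y ->
    [/\ D (f x), n x <= K * m y & m (y - f x) <= m y / 2]).
  by have [/h [x hx]|nD] := pselect (D y'); [exists x|exists 0].
pose r k := iter k (fun z => z - f (phi z)) y.
have rS k : r k.+1 = r k - f (phi (r k)) by [].
have rD k : D (r k).
  elim: k => [//|k IH]; rewrite rS.
  by apply: subspaceB => //; case: (phiP _ IH).
have rm k : m (r k) <= m y * 2^-1 ^+ k.
  elim: k => [|k IH]; first by rewrite expr0 mulr1.
  rewrite rS; have [_ _] := phiP _ (rD k).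
  by rewrite exprS; lra.
pose x k := \sum_(j < k) phi (r j).
have xS k : x k.+1 - x k = phi (r k).
  by rewrite /x big_ord_recr /= addrAC subrr add0r.
have my0 := sn_ge0 sm y.
have [||z zx xz] := geometric_cvg cE nn (x := x) (C := K * m y).
- by rewrite mulr_ge0.
- move=> k; rewrite xS; have [_ h1 _] := phiP _ (rD k).
  by apply: le_trans h1 _; rewrite -mulrA ler_wpM2l.
have fx k : f (x k) = y - r k.
  elim: k => [|k IH]; first by rewrite /x big_ord0 (lin0 lf) /r /= subrr.
  rewrite -[x k.+1](subrK (x k)) xS (linD lf) IH rS.
  by rewrite opprB addrCA addrA.
exists z; last by rewrite /x big_ord0 subr0 in zx.
apply/eqP; rewrite -subr_eq0; apply/eqP; apply: norming_eq0.
apply/eqP; rewrite eq_le (sn_ge0 sm) andbT; apply/ler_addgt0Pr => e e0.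
have [c c0 fc] := (proj2 nn) _ (cs_comp cf (proj1 nm)).
have e1 : 0 < e / 2 / (c + 1) by rewrite !divr_gt0//; lra.
have [N hN] := xz _ e1.
have [M hM] : exists M, m y * 2^-1 ^+ M < e / 2.
  have : (fun k => m y * 2^-1 ^+ k) @ \oo --> (m y * 0 : R).
    by apply: cvgMr; apply: cvg_expr; rewrite ger0_norm; lra.
  rewrite mulr0 => /cvgrPdist_lt /(_ (e / 2)) [|M _ hM]; first lra.
  exists M; have /= := hM M (leqnn M); rewrite sub0r normrN ger0_norm//.
  by rewrite !mulr_ge0// exprn_ge0// invr_ge0.
pose k := maxn N M.
have h1 : m (f z - f (x k)) < e / 2.
  rewrite (snC sm) -(linB lf); apply: le_lt_trans (fc _) _.
  have nz := sn_ge0 sn (x k - z).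
  have : n (x k - z) < e / 2 / (c + 1) by apply: hN; apply: leq_maxl.
  rewrite ltr_pdivlMr; last lra.
  by rewrite mulrDr mulr1 mulrC; lra.
have h2 : m (r k) < e / 2.
  apply: le_lt_trans (rm k) _; apply: le_lt_trans hM; rewrite ler_wpM2l//.
  by apply: ler_wiXn2l; rewrite ?leq_maxr//; lra.
have := sn_tri sm (f (x k)) (f z) y; rewrite {2}fx addrAC subrr sub0r (snN sm).
lra.
Qed.

(** A map open onto a dense range hits every [y] up to [m y / 2], and successive approximation makes
    the hit exact. *)
Lemma dense_open_surjective (N : set E) (K : R) : linsub N -> 0 <= K ->
  (forall z, N z -> f z = 0) -> (forall x, qsn N n x <= K * m (f x)) ->
  dense (range f) -> range f = setT.
Proof.
move=> sN K0 Nf fK /dense_closureP df.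
have K1 : 0 <= 2 * K + 1 by lra.
have sT : linsub [set: F] by [].
apply/seteqP; split => // y _.
(* An approximant has [m (f x) <= 2 * m y], which gives [2 * K * m y]; the infimum in the distance
   costs another [m y]. *)
have [|x fx _] := @successive_approximation [set: F] (2 * K + 1) sT K1 _ y I; last by exists x.
move=> {}y _; have [my0|my0] := eqVneq (m y) 0.
  by exists 0; rewrite (lin0 lf) subr0 (sn0 sn) my0 mulr0 mul0r.
have my : 0 < m y by rewrite lt_neqAle eq_sym my0 sn_ge0.
have e2 : 0 < m y / 2 by lra.
have [_ [x _ <-] mx] := closure_cs_ball (df y) (proj1 nm) e2.
have [z Nz nz] := qsn_approx sN sn x my.
exists (x + z); rewrite (linD lf) (Nf z Nz) addr0; split => //; last first.
  by rewrite (snC sm) ltW.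
apply: (le_trans (ltW nz)); have := fK x; have := sn_le_sub sm (f x) y => h1 h2.
have : K * m (f x) <= K * (2 * m y) by rewrite ler_wpM2l//; lra.
lra.
Qed.

Section ClosedRange.
Hypotheses (cF : complete_lcs F) (clf : forall y, closure (range f) y -> range f y).

(* Baire's argument in the complete space [range f]. *)
Lemma range_ball : exists (k : nat) y0 (rho : R), [/\ range f y0, 0 < rho &
  forall y, range f y -> m (y - y0) < rho -> forall e : R, 0 < e ->
    exists2 x, n x < k%:R & m (y - f x) < e].
Proof.
apply: contrapT => nex.
(* Pairs are balls, given by centre and radius: [t] lies inside [s], has at most half its radius,
   and misses the image of the [k]-ball of [E]. *)
pose P (k : nat) (s t : F * R) := [/\ range f t.1, 0 < t.2, m (t.1 - s.1) + t.2 <= s.2,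
  t.2 <= s.2 / 2 & forall x, n x < k%:R -> t.2 < m (t.1 - f x)].
have step k s : exists t, range f s.1 -> 0 < s.2 -> P k s t.
  apply: contrapT => nt; apply: nex.
  have [rs|nrs] := pselect (range f s.1); last by case: nt; exists s.
  have [s0|ns0] := pselect (0 < s.2); last by case: nt; exists s.
  exists k, s.1, s.2; split => // y ry ys e e0; apply: contrapT => nx.
  (* [y] has distance at least [e] from the image of the [k]-ball. The three bounds on the radius
     avoid that image, halve the radius and keep the new ball inside the old one. *)
  apply: nt; exists (y, Num.min (e / 2) (Num.min (s.2 / 2) ((s.2 - m (y - s.1)) / 2))).
  move=> _ _; set t := Num.min _ _.
  have t1 : t <= e / 2 by rewrite ge_min lexx.
  have t2 : t <= s.2 / 2 by rewrite ge_min [X in _ || X]ge_min lexx orbT.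
  have t3 : t <= (s.2 - m (y - s.1)) / 2.
    by rewrite ge_min [X in _ || X]ge_min lexx !orbT.
  split => //=; first by rewrite /t !lt_min; apply/and3P; split; lra.
    by lra.
  move=> x nxk; rewrite ltNge; apply/negP => h; apply: nx; exists x => //; lra.
have [k|phi phiP] := @choice _ _ (fun k (g : F * R -> F * R) =>
   forall s, range f s.1 -> 0 < s.2 -> P k s (g s)).
  by have [g gP] := choice (step k); exists g.
pose s := fix s k : F * R := if k is k'.+1 then phi k' (s k') else (0, 1).
have sP k : range f (s k).1 /\ 0 < (s k).2.
  elim: k => [|k [r1 r2]]; first by split => //=; exists 0 => //; exact: lin0.
  by have [] := phiP k _ r1 r2.
have sS k : P k (s k) (s k.+1) by have [r1 r2] := sP k; apply: phiP.
have sdist k l : m ((s (k + l)%N).1 - (s k).1) + (s (k + l)%N).2 <= (s k).2.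
  elim: l => [|l IH]; first by rewrite addn0 subrr (sn0 sm) add0r.
  rewrite addnS; have [_ _ h _ _] := sS (k + l)%N.
  have := sn_tri sm (s (k + l)%N).1 (s (k + l).+1).1 (s k).1; lra.
have s2 k : (s k).2 <= 2^-1 ^+ k.
  elim: k => [|k IH]; first by rewrite expr0.
  by have [_ _ _ h _] := sS k; rewrite exprS; lra.
have [||y _ sy] := geometric_cvg cF nm (x := fun k => (s k).1) (C := 1) => //.
  move=> k; rewrite mul1r; apply: le_trans (s2 k).
  by have [_ h0 h _ _] := sS k; lra.
have ydist k : m (y - (s k).1) <= (s k).2.
  apply/ler_addgt0Pr => e e0; have [N hN] := sy e e0.
  have := hN (k + N)%N (leq_addl _ _); have := sdist k N.
  have := sn_tri sm (s (k + N)%N).1 y (s k).1.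
  have [_ +] := sP (k + N)%N.
  by rewrite (snC sm y (s (k + N)%N).1) /=; lra.
have [x _ fx] : range f y.
  apply: clf; apply/closure_csP => p cp; have [c c0 pc] := (proj2 nm) p cp.
  have c1 : 0 < (c + 1)^-1 by rewrite invr_gt0; lra.
  have [N hN] := sy _ c1; exists (s N).1; first by case: (sP N).
  apply: le_lt_trans (pc _) _.
  apply: le_lt_trans (ler_wpM2l c0 (ltW (hN N (leqnn N)))) _.
  by rewrite ltr_pdivrMr; lra.
(* The limit [y = f x] lies in every ball, but [x] belongs to the [k]-ball whose image is avoided by
   [s k.+1]. *)
pose k := (Num.truncn (n x)).+1.
have nk : n x < k%:R by rewrite truncnS_gt.
have [_ _ _ _ /(_ x nk)] := sS k; rewrite fx (snC sm).
by have := ydist k.+1; lra.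
Qed.

Lemma open_mapping : exists2 K : R, 0 <= K &
  forall y, range f y -> exists2 x, f x = y & n x <= K * m y.
Proof.
have [k [y0 [rho [ry0 rho0 hk]]]] := range_ball.
have K0 : 0 <= 4 * k%:R / rho by rewrite divr_ge0 ?mulr_ge0 ?ler0n// ltW.
exists (2 * (4 * k%:R / rho)); first by rewrite mulr_ge0.
have srf := range_subspace lf.
move=> y ry; have [|x fx nx] := successive_approximation srf K0 _ ry; last first.
  by exists x => //; apply: le_trans nx _; rewrite !mulrA.
move=> {ry}y ry; have [my0|my0] := eqVneq (m y) 0.
  exists 0; rewrite (lin0 lf) subr0 (sn0 sn) my0 mulr0 mul0r; split => //.
  by case: srf.
have my : 0 < m y by rewrite lt_neqAle eq_sym my0 sn_ge0.
(* [t y] has norm [rho / 2], so [y0 + t y] and [y0] both lie in the ball; subtracting their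
   approximants and dividing by [t] approximates [y] with error at most [m y / 2]. *)
pose t := rho / (2 * m y).
have t0 : 0 < t by rewrite divr_gt0//; lra.
have tmy : t * m y = rho / 2.
  by rewrite /t; field; rewrite gt_eqF.
have e0 : 0 < rho / 8 by lra.
have [||x1 nx1 mx1] := hk (y0 + t%:C *: y) _ _ _ e0.
- by apply: subspaceD => //; apply: subspaceZ.
- by rewrite addrC addKr (snZr sm) ?(ltW t0)// tmy; lra.
have [|x0 nx0 mx0] := hk y0 ry0 _ _ e0; first by rewrite subrr (sn0 sm).
have ti0 : 0 <= t^-1 by rewrite invr_ge0 ltW.
have tn : t%:C != 0 :> R[i] by rewrite real_complex_eq0 gt_eqF.
exists (t^-1%:C *: (x1 - x0)); split.
- by exists (t^-1%:C *: (x1 - x0)).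
- rewrite (snZr sn)//; apply: (@le_trans _ _ (t^-1 * (2 * k%:R))).
    by rewrite ler_wpM2l//; have := snB sn x1 x0; lra.
  by rewrite le_eqVlt; apply/orP; left; apply/eqP; rewrite /t; field; rewrite !gt_eqF.
- have -> : y - f (t^-1%:C *: (x1 - x0)) =
     t^-1%:C *: ((y0 + t%:C *: y - f x1) - (y0 - f x0)).
    rewrite (linZ lf) (linB lf).
    have -> : y0 + t%:C *: y - f x1 - (y0 - f x0) = t%:C *: y - (f x1 - f x0).
      move: (t%:C *: y) (f x1) (f x0) => z z1 z0.
      by rewrite !opprB [LHS]addrC -[y0 + z - z1]addrA subrKA addrCA.
    by rewrite [RHS]scalerBr scalerA -rmorphM mulVf ?gt_eqF// scale1r.
  rewrite (snZr sm)//; apply: (@le_trans _ _ (t^-1 * (rho / 4))).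
    rewrite ler_wpM2l//.
    by have := snB sm (y0 + t%:C *: y - f x1) (y0 - f x0); lra.
  rewrite (_ : rho / 4 = t * m y / 2); last by rewrite tmy; lra.
  by rewrite mulrA mulKf// gt_eqF.
Qed.

End ClosedRange.
End OpenMapping.

(** The open mapping theorem is applied twice: to [p], and to [i], whose range is closed as a
    kernel. *)
Lemma short_exact_strict E F (G : tvsType R[i]) (i : E -> F) (p : F -> G) :
  exact_pair_banach i p -> exact_pair_maps i p.
Proof.
move=> [[/banach_norming [cE [n1 nn1]] /banach_norming [cF [n2 nn2]]
  /banach_norming [cG [n3 nn3]]] [ci cp [inj rip rp]]].
have sri := range_subspace (proj1 ci).
apply: exact_pair_maps_of_cs => //; try by case: cF.
- by move=> x; have : range i (i x) by []; rewrite rip.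
- move=> r cr; have [c c0 rc] := (proj2 nn1) r cr.
  have [|K K0 hK] := open_mapping cE nn1 nn2 (proj1 cF) ci cF.
    move=> y; rewrite rip => cy /=.
    have /hausdorff_csP hG := proj1 cG; apply: hG => s cS.
    apply: (closure_sn0 (cs_comp cp cS) _ cy) => z /= ->.
    exact: sn0 (proj1 cS).
  exists (fun y => c * K * n2 y); first by apply: csZ; [exact: mulr_ge0|case: nn2].
  move=> x; have [x' /inj -> nx] := hK (i x) (ex_intro2 _ _ x I erefl).
  by apply: le_trans (rc x) _; rewrite -mulrA ler_wpM2l.
- move=> r cr; have [c c0 rc] := (proj2 nn2) r cr.
  have [|K K0 hK] := open_mapping cF nn2 nn3 (proj1 cG) cp cG; first by rewrite rp.
  exists (fun y => c * K * n3 y); first by apply: csZ; [exact: mulr_ge0|case: nn3].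
  move=> y; have [x' px nx] := hK (p y) (ex_intro2 _ _ y I erefl).
  have Nx : range i (x' - y) by rewrite rip /= (linB (proj1 cp)) px subrr.
  apply: le_trans (qsn_le (proj1 cr) y Nx) _; rewrite addrC subrK.
  by apply: le_trans (rc x') _; rewrite -mulrA ler_wpM2l.
- by rewrite rp => O [x Ox] _; exists x.
Qed.

End Banach.

Section BanachTensor.
Context {R : realType} (A : arens_michael R) (I : set (unitization A)).
Variables (X : lmodule A) (q : unitization A -> X).
Hypotheses (hI : closed_left_ideal I) (hX : is_cyclic_completion I q).

(** The distance to [Y I] for the norm of [Y] induces a norming seminorm on the tensor product. *)
Lemma tensor_banach (Y : rmodule A) (T : tensor_over Y X) : is_banach Y -> is_banach T.
Proof.
move=> /banach_norming [cY [n [cn nn]]]; apply/banach_norming; split.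
  exact: tensor_complete.
have [s cS sE] := pure_gen_qsn hI hX T cn; exists s; split => // t ct.
have cg := pure_gen_continuous q T.
have [c c0 tc] := nn _ (cs_comp cg ct); exists c => //.
apply: (dense_le (pure_gen_dense hX (T := T)) ct (csZ c0 cS)) => _ [y _ <-].
rewrite sE; apply: (qsn_ge_mul (action_span_subspace I Y)) => // m Ym.
have -> : pure_gen q T y = pure_gen q T (y + m).
  by rewrite (linD (proj1 cg)) (action_span_null hX T Ym) addr0.
exact: tc.
Qed.

(** Exactness makes [pX] open onto a dense range; between Banach spaces this gives surjectivity. *)
Lemma tensor_exact_tensor_exact_banach : tensor_exact X -> tensor_exact_banach X.
Proof.
move=> hx Y1 Y2 Y3 i p [[b1 b2 b3] [mi mp ip]] T1 T2 T3 iX pX miX mpX.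
have ipm : exact_pair_maps i p.
  by apply: short_exact_strict; split => //; split => //; [case: mi|case: mp].
have [_ [ciX cpX ex]] := hx _ _ _ i p (And3 mi mp ipm) T1 T2 T3 iX pX miX mpX.
have B1 := tensor_banach T1 b1; have B2 := tensor_banach T2 b2.
have B3 := tensor_banach T3 b3.
split => //; split => //; case: (ex) => inj oi rip op dp; split => //.
have /banach_norming [c2 [n2 nn2]] := B2; have /banach_norming [c3 [n3 nn3]] := B3.
have [s cS sb] := exact_pair_quotient cpX ex (proj1 nn2).
have [c c0 sc] := (proj2 nn3) s cS.
apply: (@dense_open_surjective _ _ _ n2 n3 pX c2 nn2 nn3 (proj1 c3) cpX (range iX) c) => //.
- by apply: range_subspace; case: ciX.
- by rewrite rip.
- by move=> x; apply: le_trans (sb x) (sc _).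
Qed.

End BanachTensor.

(** * From exactness on Banach modules to approximate identities *)

Section SeminormedModules.
Context {R : realType} (A : arens_michael R).
Local Notation Ap := (unitization A).

(** Data before completion: one continuous seminorm of [A] bounds the action, so the action extends
    to the completion and is jointly continuous there. *)
Definition seminormed_module (V : lmodType R[i]) (N : V -> R) (act : V -> A -> V) :=
  [/\ seminorm N, forall v, linear (act v), forall a, linear (act^~ a),
      forall v a b, act (act v a) b = act v (am_mul a b) &
      exists2 p, cs p & forall v a, N (act v a) <= N v * p a].

Lemma banach_module_exists V N act : @seminormed_module V N act ->
  exists (Y : rmodule A) (iota : V -> Y) (n : Y -> R),
    [/\ linear iota, dense (range iota), norming n,
        forall v, n (iota v) = N v & forall v a, ract (iota v) a = iota (act v a)].
Proof.
move=> [sN lr ll aa [p cp Np]].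
have [W [iota [n [cW li di nn nN]]]] := normed_completion_exists sN.
have hW := proj1 cW; have cn := proj1 nn.
have p0 := sn_ge0 (proj1 cp).
have aex a : exists g : W -> W, [/\ continuous_linear g,
    forall v, g (iota v) = iota (act v a) & forall w, n (g w) <= p a * n w].
  have b1 v : n (iota (act v a)) <= p a * n (iota v).
    by rewrite !nN mulrC; apply: Np.
  have [||g [cg gi gb]] := @extension _ V W W iota (fun v => iota (act v a)) li _ cW _ di.
  - by apply: lin_comp => //; apply: ll.
  - move=> s cS; have [c c0 sc] := (proj2 nn) s cS.
    exists (fun w => c * (p a * n w)); first by apply: csZ => //; apply: csZ.
    by move=> v; apply: le_trans (sc _) _; rewrite ler_wpM2l.
  - by exists g; split => // w; apply: (gb n (fun w => p a * n w)) => //; apply: csZ.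
have [r rP] := choice aex.
have rc a : continuous_linear (r a) by case: (rP a).
have ri a v : r a (iota v) = iota (act v a) by case: (rP a).
have rb a w : n (r a w) <= n w * p a by case: (rP a) => _ _ /(_ w); rewrite mulrC.
have rbil : bilinear_map (fun w a => r a w).
  split => [w c a b|a]; last by case: (rc a).
  have cl : continuous_linear (fun w => c *: r a w + r b w).
    have l : linear (fun w => c *: r a w + r b w).
      move=> d x y; rewrite (proj1 (rc a)) (proj1 (rc b)) !scalerDr !scalerA.
      by rewrite [d * c]mulrC addrACA.
    apply: continuous_of_cs => // s cS.
    have nc := normc_ge0 c.
    apply: (cs_of_le _ ler01 (csD (csZ nc (cs_comp (rc a) cS)) (cs_comp (rc b) cS))).
      exact: (seminorm_comp l (proj1 cS)).
    by move=> x; rewrite mul1r /= -(snZ (proj1 cS)); apply: snD (proj1 cS) _ _.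
  apply: (dense_eq hW di (rc _) cl) => _ [v _ <-].
  by rewrite !ri lr li.
have rj : jointly_continuous (fun w a => r a w).
  apply/(jointly_continuous_csP rbil) => s cS; have [c c0 sc] := (proj2 nn) s cS.
  exists (fun w => c * n w), p; split => //; first exact: csZ.
  by move=> w a; apply: le_trans (sc _) _; rewrite -mulrA ler_wpM2l.
have ra w a b : r b (r a w) = r (am_mul a b) w.
  apply: (dense_eq hW di (continuous_linear_comp (rc a) (rc b)) (rc _)) => _ [v _ <-].
  by rewrite /= !ri aa.
by exists (RModule cW rbil ra rj), iota, n; split => // v a; apply: ri.
Qed.

End SeminormedModules.

Section UniformBound.
Context {R : realType} (A : arens_michael R) (I : set (unitization A)).
Variables (X : lmodule A) (q : unitization A -> X).
Hypotheses (hI : closed_left_ideal I) (hX : is_cyclic_completion I q).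
Hypothesis hB : tensor_exact_banach X.
Local Notation Ap := (unitization A).

Let sI : linsub I. Proof. by case: hI. Qed.

(** The embedding property of [iX], read through distances to [Y1 I] and [Y2 I]; as [n2] is norming
    it amounts to one constant. *)
Lemma tensor_exact_bound (Y1 Y2 Y3 : rmodule A) (i : Y1 -> Y2) (p : Y2 -> Y3)
    (n1 : Y1 -> R) (n2 : Y2 -> R) :
  exact_pair_banach_rmodule i p -> cs n1 -> norming n2 ->
  exists2 K : R, 0 <= K & forall y,
    qsn (action_span I (Y := Y1)) n1 y <= K * qsn (action_span I (Y := Y2)) n2 (i y).
Proof.
move=> hip c1 nn2; have [_ [mi mp _]] := hip.
have [T1] := tensor_over_exists X Y1; have [T2] := tensor_over_exists X Y2.
have [T3] := tensor_over_exists X Y3.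
have [iX miX] := tensor_map_exists T1 T2 mi.
have [pX mpX] := tensor_map_exists T2 T3 mp.
have eB := hB hip miX mpX.
have ex := short_exact_strict eB.
have [s1 cs1 s1E] := pure_gen_qsn hI hX T1 c1.
have [s2 cs2 s12] := exact_pair_embedding (proj1 miX) ex cs1.
have ct := pure_gen_continuous q T2.
have [K K0 sK] := (proj2 nn2) _ (cs_comp ct cs2).
exists K => // y; rewrite -s1E; apply: le_trans (s12 _) _.
rewrite (tensor_map_gen q miX).
apply: (qsn_ge_mul (action_span_subspace I Y2)) => // m Ym.
have -> : pure_gen q T2 (i y) = pure_gen q T2 (i y + m).
  by rewrite (linD (proj1 ct)) (action_span_null hX T2 Ym) addr0.
exact: sK.
Qed.

(* The row [0 -> S -> V -> V / S -> 0] of seminormed modules completes to an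
   exact row of Banach modules. *)
Lemma seminormed_bound (V : lmodType R[i]) (N : V -> R) (act : V -> A -> V)
    (S K0 : set V) :
  seminormed_module N act -> linsub S -> (forall v a, S v -> S (act v a)) ->
  linsub K0 -> K0 `<=` S ->
  (forall v u, S v -> I u -> K0 (act v u.1 + u.2 *: v)) ->
  exists2 K : R, 0 <= K & forall v, S v -> qsn K0 N v <=
    K * qsn (linspan [set z | exists v u, I u /\ z = act v u.1 + u.2 *: v]) N v.
Proof.
move=> hV sS Sact sK KS SK; have [sN lr ll aa [p cp Np]] := hV.
have p0 := sn_ge0 (proj1 cp).
have [V1 [j [lj ij rj]]] := submodule_exists sS.
have jS v : S (j v) by rewrite -rj; exists v.
have actex v a : exists v', j v' = act (j v) a.
  have : S (act (j v) a) by apply: Sact.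
  by rewrite -rj => -[v' _ <-]; exists v'.
have [act1 act1E] := choice (fun va : V1 * A => actex va.1 va.2).
have act1j v a : j (act1 (v, a)) = act (j v) a := act1E (v, a).
have h1 : seminormed_module (N \o j) (fun v a => act1 (v, a)).
  split.
  - exact: seminorm_comp.
  - by move=> v c a b; apply: ij; rewrite lj !act1j lr.
  - by move=> a c v w; apply: ij; rewrite lj !act1j lj ll.
  - by move=> v a b; apply: ij; rewrite !act1j aa.
  - by exists p => // v a; rewrite /= act1j.
(* [V / S] is represented by [V] with the distance to [S]; its completion kills [S]. *)
have h3 : seminormed_module (qsn S N) act.
  split => //; first exact: qsn_seminorm.
  exists p => // v a; rewrite mulrC; apply: (qsn_ge_mul sS) => // m Sm.
  apply: le_trans (qsn_le sN (act v a) (Sact m a Sm)) _.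
  have e2 : _ = _ := linD (ll a) v m; rewrite -e2 mulrC; exact: Np.
have [Y1 [i1 [n1 [li1 di1 nn1 nN1 ra1]]]] := banach_module_exists h1.
have [Y2 [i2 [n2 [li2 di2 nn2 nN2 ra2]]]] := banach_module_exists hV.
have [Y3 [i3 [n3 [li3 di3 nn3 nN3 ra3]]]] := banach_module_exists h3.
have ext (Y Z : rmodule A) (U : lmodType R[i]) (iU : U -> Y) (f : U -> Z)
    (n : Y -> R) (m : Z -> R) : linear iU -> dense (range iU) -> linear f ->
    norming n -> norming m -> (forall u, m (f u) <= n (iU u)) ->
    exists2 g : Y -> Z, continuous_linear g & forall u, g (iU u) = f u.
  move=> lU dU lf nn nm fb.
  have [|g [cg gi _]] := @extension _ U Y Z iU f lU lf (rm_complete Z) _ dU.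
  - move=> s cS; have [c c0 sc] := (proj2 nm) s cS.
    exists (fun y => c * n y); first by apply: csZ => //; case: nn.
    by move=> u; apply: le_trans (sc _) _; rewrite ler_wpM2l.
  - by exists g.
have [i ci iE] := ext Y1 Y2 V1 i1 (i2 \o j) n1 n2 li1 di1 (lin_comp lj li2) nn1 nn2
  (fun u => eq_ind_r (fun t => t <= _) (eq_ind_r (fun t => _ <= t) (lexx _) (nN1 u)) (nN2 _)).
have q32 v : n3 (i3 v) <= n2 (i2 v) by rewrite nN3 nN2; apply: qsn_le_sn.
have [pr cpr prE] := ext Y2 Y3 V i2 i3 n2 n3 li2 di2 li3 nn2 nn3 q32.
have morph (Y Z : rmodule A) (g : Y -> Z) (U : set Y) : continuous_linear g -> dense U ->
    (forall y a, U y -> g (ract y a) = ract (g y) a) -> rmodule_morphism g.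
  move=> cg dU gU; split => // y a.
  have h0 (M : rmodule A) : continuous_linear (fun z : M => ract z a).
    have := @actp_continuousl R A M ((a, 0) : Ap).
    by congr (continuous_linear _); apply/funext => z; rewrite actp_ract.
  exact: (dense_eq (proj1 (rm_complete Z)) dU (continuous_linear_comp (h0 Y) cg)
    (continuous_linear_comp cg (h0 Z)) (fun y Uy => gU y a Uy)).
have mi : rmodule_morphism i.
  apply: (morph _ _ _ _ ci di1) => _ a [v _ <-].
  by rewrite ra1 !iE /= ra2 act1j.
have mpr : rmodule_morphism pr.
  by apply: (morph _ _ _ _ cpr di2) => _ a [v _ <-]; rewrite ra2 !prE ra3.
have B1 : is_banach Y1 by apply/banach_norming; split; [exact: rm_complete|exists n1].
have B2 : is_banach Y2 by apply/banach_norming; split; [exact: rm_complete|exists n2].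
have B3 : is_banach Y3 by apply/banach_norming; split; [exact: rm_complete|exists n3].
have n1i y : n1 y <= n2 (i y).
  apply: (dense_le di1 (proj1 nn1) (cs_comp ci (proj1 nn2))) => _ [v _ <-].
  by rewrite /= iE nN1 nN2.
have sri := range_subspace (proj1 ci).
have sn2 := proj1 (proj1 nn2).
have qp y : qsn (range i) n2 y <= n3 (pr y).
  apply: (dense_le di2 (cs_qsn sri (proj1 nn2)) (cs_comp cpr (proj1 nn3))) => _ [v _ <-].
  rewrite /= prE nN3; apply: (qsn_ge sS) => // m Sm.
  have [v' _ jv'] : range j m by rewrite rj.
  rewrite -nN2 (linD li2); apply: qsn_le => //.
  by exists (i1 v') => //; rewrite iE /= jv'.
have pi0 y : pr (i y) = 0.
  have c0 : continuous_linear ((fun=> 0) : Y1 -> Y3).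
    by split => [a u v|u]; [rewrite scaler0 addr0|apply: cvg_cst].
  suff e : pr \o i =1 (fun=> 0) by exact: e y.
  apply: (dense_eq (proj1 (rm_complete Y3)) di1 (continuous_linear_comp ci cpr) c0).
  move=> _ [v _ <-] /=; rewrite iE /= prE.
  apply: (norming_eq0 nn3 (proj1 (rm_complete Y3))).
  by rewrite nN3 qsn_null.
have dpr : dense (range pr).
  apply/dense_closureP => y; have := (dense_closureP _).1 di3 y.
  by apply: closure_subset => _ [v _ <-]; exists (i2 v).
have sn3 := proj1 (proj1 nn3).
have ex : exact_pair_maps i pr.
  apply: exact_pair_maps_of_cs => //; [exact: rm_complete|exact: (proj1 (rm_complete Y2))| |].
    move=> r cr; have [c c0 rc] := (proj2 nn1) r cr.
    exists (fun y => c * n2 y); first by apply: csZ => //; case: nn2.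
    by move=> x; apply: le_trans (rc x) _; rewrite ler_wpM2l.
  move=> r cr; have [c c0 rc] := (proj2 nn2) r cr.
  exists (fun y => c * n3 y); first by apply: csZ => //; case: nn3.
  move=> y; have sr := proj1 cr.
  apply: le_trans (qsn_le_mono y sri sri sr sn2 c0 (fun _ h => h) rc) _.
  by rewrite ler_wpM2l.
have hip : exact_pair_banach_rmodule i pr.
  split => //; split => //; case: (ex) => inj _ rip _ _; split => //.
  apply: (dense_open_surjective (rm_complete Y2) nn2 nn3 (proj1 (rm_complete Y3)) cpr
    sri ler01) => //; first by move=> _ [y _ <-]; apply: pi0.
  by move=> y; rewrite mul1r.
have [K K0' hK] := tensor_exact_bound hip (proj1 nn1) nn2.
exists K => // v Sv; have [v' _ jv'] : range j v by rewrite rj.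
have sn1 := proj1 (proj1 nn1).
have sY1 := action_span_subspace I Y1; have sY2 := action_span_subspace I Y2.
(* Back to [V]: the products [V I] are mapped into [Y2 I], which bounds the right side, while [Y1 I]
   lies in the closure of the image of [K0], which bounds the left side. *)
apply: (@le_trans _ _ (qsn (action_span I (Y := Y1)) n1 (i1 v'))); last first.
  apply: le_trans (hK _) _; rewrite ler_wpM2l// iE /= jv'.
  apply: (qsn_ge (linspan_subspace _)) => // m Vm.
  rewrite -nN2 (linD li2); apply: qsn_le => //.
  apply: (linspan_min (preimage_subspace li2 sY2) _ Vm) => _ [z [u [Iu ->]]] /=.
  apply: sub_linspan; exists (i2 z), u; split => //.
  by rewrite /actp ra2 (linD li2) (linZ li2).
apply: (qsn_ge sY1) => // m Ym; apply/ler_addgt0Pr => e e0.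
have sjK : linsub (j @^-1` K0) by apply: preimage_subspace.
have sjK1 : linsub (closure (i1 @` (j @^-1` K0))).
  apply: subspace_closure; split; first by exists 0; [case: sjK|exact: lin0].
  move=> a _ _ [u Ku <-] [w Kw <-]; exists (a *: u + w); last exact: li1.
  exact: sjK.2.
have /closure_cs_ball : closure (i1 @` (j @^-1` K0)) m.
  apply: (linspan_min sjK1 _ Ym) => _ [y [u [Iu ->]]].
  apply/closure_csP => t ct.
  have [_ [w _ <-] tw] := closure_cs_ball ((dense_closureP _).1 di1 y)
    (cs_comp (actp_continuousl Y1 u) ct) ltr01.
  exists (i1 (act1 (w, u.1) + u.2 *: w)).
    exists (act1 (w, u.1) + u.2 *: w) => //.
    by rewrite /= (linD lj) (linZ lj) act1j; apply: SK.
  rewrite (linD li1) (linZ li1) -ra1.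
  by move: tw; rewrite /= -(linB (actp_linl u)).
move=> /(_ n1 e (proj1 nn1) e0) [_ [w Kw <-] mw].
have := sn_tri sn1 (i1 v' + m) (i1 v' + i1 w) 0; rewrite !subr0 -(linD li1) nN1 /=.
rewrite (linD lj) jv' (linD li1) opprD addrACA subrr add0r => h.
by have := qsn_le sN v Kw; lra.
Qed.

End UniformBound.

(** * Sup-normed spaces of bounded functions *)

Section BoundedFunctions.
Context {R : realType}.
Variables (M : Type) (B : lmodType R[i]) (w : B -> R).
Hypothesis sw : seminorm w.

Definition bounded_fun : set (M -> B) := [set f | exists C, forall x, w (f x) <= C].

Lemma bounded_fun_subspace : linsub bounded_fun.
Proof.
split => [|a f g [C fC] [D gD]]; first by exists 0 => x; rewrite (sn0 sw).
exists (Normc.normc a * C + D) => x; apply: le_trans (snD sw _ _) _.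
by rewrite (snZ sw) lerD// ler_wpM2l// normc_ge0.
Qed.

Lemma bounded_fun_module : inhabited M ->
  exists (V : lmodType R[i]) (j : V -> M -> B) (N : V -> R),
  [/\ linear j, injective j, range j = bounded_fun, seminorm N &
    (forall v x, w (j v x) <= N v) /\
    forall v C, (forall x, w (j v x) <= C) -> N v <= C].
Proof.
move=> [x0]; have [V [j [lj ij rj]]] := submodule_exists bounded_fun_subspace.
pose N v := sup (range (fun x => w (j v x))).
have Nne v : (range (fun x => w (j v x))) !=set0 by exists (w (j v x0)); exists x0.
have Nub v : has_ubound (range (fun x => w (j v x))).
  have : bounded_fun (j v) by rewrite -rj; exists v.
  by move=> [C hC]; exists C => _ [x _ <-].
have Nle v x : w (j v x) <= N v by apply: ub_le_sup => //; exists x.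
have Nlub v C : (forall x, w (j v x) <= C) -> N v <= C.
  by move=> h; apply: ge_sup => // _ [x _ <-].
exists V, j, N; split => //; split => [u v|].
  apply: Nlub => x; rewrite (linD lj).
  by apply: le_trans (snD sw _ _) _; rewrite lerD.
apply: sn_homog => [v|a v]; first exact: le_trans (sn_ge0 sw (j v x0)) (Nle v x0).
apply: Nlub => x; rewrite (linZ lj).
by rewrite -[X in w X]/(a *: j v x) (snZ sw) ler_wpM2l// normc_ge0.
Qed.

End BoundedFunctions.

Section BoundedApproximateIdentity.
Context {R : realType} (A : arens_michael R) (I : set (unitization A)).
Variables (X : lmodule A) (q : unitization A -> X).
Hypotheses (hI : closed_left_ideal I) (hX : is_cyclic_completion I q).
Hypothesis hB : tensor_exact_banach X.
Local Notation Ap := (unitization A).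
Local Notation mulp := (@unitization_mul R A).

Let sI : linsub I. Proof. by case: hI. Qed.
Let Ileft u v : I v -> I (mulp u v). Proof. by case: hI => _ _; apply. Qed.

(* An index [(S, d)] stands for the requirement [d * |1 - b| <= K * d] and
   [|u - u b| <= K * d] for [u] in [S]; coordinate [None] controls the former
   and coordinate [Some u] the latter. *)
Local Notation index := (set Ap * R)%type.

Definition unit_defect (g : index -> Ap) : index * option Ap -> Ap := fun x =>
  match x.2 with
  | None => x.1.2%:C *: g x.1
  | Some u => if `[< x.1.1 u >] then mulp u (g x.1) else 0
  end.

Lemma unit_defect_linear : linear unit_defect.
Proof.
move=> a g h; apply/funext => -[[S d] [u|]]; rewrite /unit_defect /=.
  rewrite -[RHS]/(a *: (if `[< S u >] then mulp u (g (S, d)) else 0) +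
    (if `[< S u >] then mulp u (h (S, d)) else 0)).
  by case: asbool; [exact: mulp_linr|rewrite scaler0 addr0].
rewrite -[RHS]/(a *: (d%:C *: g (S, d)) + d%:C *: h (S, d)).
rewrite -[(a *: g + h) _]/(a *: g (S, d) + h (S, d)).
by rewrite scalerDr !scalerA mulrC.
Qed.

(** Right multiplication commutes with the left multiplications by [u], so families of this form are
    stable under the right action. *)
Lemma unit_defect_mul g b x :
  mulp (unit_defect g x) b = unit_defect (fun l => mulp (g l) b) x.
Proof.
case: x => -[S d] [u|]; rewrite /unit_defect /=; last exact: linZ (mulp_linl b) _ _.
by case: asbool; [rewrite mulpA|exact: lin0 (mulp_linl b)].
Qed.

Lemma mulp_split v u : mulp v ((u.1, 0) : Ap) + u.2 *: v = mulp v u.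
Proof.
rewrite -[X in _ *: X]mulp1 -(linZ (mulp_linr v)) -(linD (mulp_linr v)); congr mulp.
case: u => a c; rewrite /unitp; congr pair => /=; first by rewrite scaler0 addr0.
by rewrite add0r -[LHS]/(c * 1) mulr1.
Qed.

Lemma uniform_approximate_unit (p : A -> R) : cs p ->
  (forall a b, p (am_mul a b) <= p a * p b) ->
  exists2 K : R, 0 <= K & forall (r : seq Ap) (d : R), 0 < d -> [set` r] `<=` I ->
    exists2 b, I b & normp p (unitp A - b) <= K /\
      forall u, u \in r -> normp p (u - mulp u b) <= K * d.
Proof.
move=> cp pm; set w := normp p.
have cw : cs w := normp_cs cp.
have sw : seminorm w := proj1 cw.
have w0 := sn_ge0 sw; have p0 := sn_ge0 (proj1 cp).
have wM : forall u v, w (mulp u v) <= w u * w v := normp_submul (proj1 cp) pm.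
have w1 : w (unitp A) = 1 by rewrite -[LHS]/(p 0 + Normc.normc 1) (sn0 (proj1 cp)) add0r Normc.normc1.
have wa a : w ((a, 0) : Ap) = p a by rewrite -[LHS]/(p a + Normc.normc 0) Normc.normc0 addr0.
have [V [j [N [lj ij rj sN [Nle Nlub]]]]] :=
  bounded_fun_module sw (inhabits ((set0, 0), None) : inhabited (index * option Ap)).
have N0 := sn_ge0 sN.
have jex f : bounded_fun w f -> exists v, j v = f.
  by rewrite -rj => -[v _ <-]; exists v.
have actex v a : exists v', j v' = (fun x => mulp (j v x) ((a, 0) : Ap)).
  apply: jex; exists (N v * p a) => x; apply: le_trans (wM _ _) _.
  by rewrite wa ler_wpM2r.
have [act0 actE] := choice (fun va : V * A => actex va.1 va.2).
pose act v a := act0 (v, a).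
have jact v a x : j (act v a) x = mulp (j v x) ((a, 0) : Ap) by rewrite /act actE.
have jlin c u v x : j (c *: u + v) x = c *: j u x + j v x by rewrite lj.
have jmul v u x : j (act v u.1 + u.2 *: v) x = mulp (j v x) u.
  by rewrite (linD lj) (linZ lj) -[LHS]/(j (act v u.1) x + u.2 *: j v x) jact mulp_split.
have hV : seminormed_module N act.
  split => //.
  - move=> v c a b; apply: ij; apply/funext => x; rewrite jact jlin !jact -mulp_linr.
    by congr mulp; congr pair; rewrite /= scaler0 addr0.
  - by move=> a c u v; apply: ij; apply/funext => x; rewrite jact !jlin !jact mulp_linl.
  - move=> v a b; apply: ij; apply/funext => x; rewrite !jact -mulpA.
    by congr mulp; rewrite /unitization_mul /= !scale0r !addr0 mulr0.
  - exists p => // v a; apply: Nlub => x; rewrite jact.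
    by apply: le_trans (wM _ _) _; rewrite wa ler_wpM2r.
(* [S] plays the part of [Y1]. [K0] contains [S I] because [I] is a left ideal, so the distance to
   [K0] bounds the distance to [S I] from below. *)
pose S := [set v | exists g, j v = unit_defect g].
pose K0 := [set v | exists2 g, (forall l, I (g l)) & j v = unit_defect g].
have sS : linsub S.
  split; first by exists 0; rewrite (lin0 lj) (lin0 unit_defect_linear).
  by move=> a u v [g ug] [h vh]; exists (a *: g + h); rewrite lj ug vh unit_defect_linear.
have sK : linsub K0.
  split; first by exists 0; [move=> l; case: sI|rewrite (lin0 lj) (lin0 unit_defect_linear)].
  move=> a u v [g Ig ug] [h Ih vh]; exists (a *: g + h).
    by move=> l; apply: (proj2 sI).
  by rewrite lj ug vh unit_defect_linear.
have Sact v a : S v -> S (act v a).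
  move=> [g vg]; exists (fun l => mulp (g l) ((a, 0) : Ap)); apply/funext => x.
  by rewrite jact vg unit_defect_mul.
have KS : K0 `<=` S by move=> v [g _ vg]; exists g.
have SK v u : S v -> I u -> K0 (act v u.1 + u.2 *: v).
  move=> [g vg] Iu; exists (fun l => mulp (g l) u); first by move=> l; apply: Ileft.
  by apply/funext => x; rewrite jmul vg unit_defect_mul.
have [K K_ge0 hK] := seminormed_bound hI hX hB hV sS Sact sK KS SK.
(* The infimum defining the distance is attained only up to an error, here [d]; this adds 1. *)
exists (K + 1) => [|r d d0 rI]; first by rewrite addr_ge0.
pose l : index := ([set` r], d).
pose g l' : Ap := if `[< l' = l >] then unitp A else 0.
(* Boundedness rests on the finiteness of [r]: [d] bounds the coordinate [None], the sum bounds the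
   others. *)
have [v jv] : exists v, j v = unit_defect g.
  apply: jex; exists (d + \sum_(u <- r) w u) => -[l' [u|]]; rewrite /unit_defect /g /=.
    case: (asboolP (l' = l)) => [->|_]; last first.
      by rewrite (lin0 (mulp_linr u)) if_same (sn0 sw) addr_ge0 ?(ltW d0)// sumr_ge0.
    rewrite mulp1; case: (asboolP (l.1 u)) => [/= ur|_]; last first.
      by rewrite (sn0 sw) addr_ge0 ?(ltW d0)// sumr_ge0.
    rewrite (big_rem u ur) /= addrCA lerDl addr_ge0 ?(ltW d0)// sumr_ge0//.
  case: (asboolP (l' = l)) => [->|_]; last first.
    by rewrite scaler0 (sn0 sw) addr_ge0 ?(ltW d0)// sumr_ge0.
  by rewrite (snZr sw) ?(ltW d0)// w1 mulr1 lerDl sumr_ge0.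
set VI := linspan [set z | exists v u, I u /\ z = act v u.1 + u.2 *: v].
have sVI : linsub VI := linspan_subspace _.
(* In [V], unlike in [S], coordinates vary independently: if [e] is 1 at [(l, Some u)] and 0
   elsewhere, [e u] has the single value [u] there. Summing over [s] reproduces the values of [v] at
   the coordinates [Some u]. *)
have VIs s : uniq s -> [set` s] `<=` I -> exists2 m, VI m & forall x, j m x =
    if `[< x.1 = l >] then (if x.2 is Some u then if u \in s then u else 0 else 0) else 0.
  elim: s => [_ _|u s IH /= /andP[us uniqs] sI'].
    exists 0; first by case: sVI.
    by move=> [l' [u|]]; rewrite (lin0 lj) /= if_same.
  have sI2 : [set` s] `<=` I.
    by move=> z /= zs; have /= := sI' z; rewrite inE zs orbT; apply.
  have [m Vm mE] := IH uniqs sI2.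
  have Iu : I u by have /= := sI' u; rewrite inE eqxx; apply.
  have [e eE] : exists e, j e = fun x => if `[< x = (l, Some u) >] then unitp A else 0.
    apply: jex; exists 1 => x; case: asbool; first by rewrite w1.
    by rewrite (sn0 sw).
  exists ((act e u.1 + u.2 *: e) + m).
    by apply: (subspaceD sVI) => //; apply: sub_linspan; exists e, u.
  move=> [l' o]; rewrite (linD lj) -[LHS]/(j (act e u.1 + u.2 *: e) (l', o) + j m (l', o)).
  rewrite jmul mE eE /=.
  case: (asboolP (l' = l)) => [->|nl]; last first.
    rewrite asboolF; last by move=> [].
    by rewrite (lin0 (mulp_linl u)) addr0.
  case: o => [z|]; last by rewrite asboolF// (lin0 (mulp_linl u)) addr0.
  rewrite inE; have [->|zu] := eqVneq z u.
    by rewrite asboolT// mul1p (negbTE us) addr0.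
  rewrite asboolF; last by move=> [/eqP]; rewrite (negbTE zu).
  by rewrite (lin0 (mulp_linl u)) add0r.
have [|z|m Vm mE] := VIs (undup r); first exact: undup_uniq.
  by rewrite /= mem_undup => /rI.
(* Subtracting [m] leaves only the coordinate [None], of norm [d]. *)
have qd : qsn VI N v <= d.
  apply: le_trans (qsn_le sN v (subspaceN sVI Vm)) _; apply: Nlub => x.
  rewrite (linB lj) -[X in w X]/(j v x - j m x) mE jv /unit_defect /g.
  case: x => l' o /=; case: (asboolP (l' = l)) => [->|_]; last first.
    rewrite subr0; case: o => [u|]; rewrite ?scaler0 ?(lin0 (mulp_linr u)) ?if_same.
      by rewrite (sn0 sw) ltW.
    by rewrite (sn0 sw) ltW.
  case: o => [u|]; last by rewrite subr0 (snZr sw) ?(ltW d0)// w1 mulr1.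
  by rewrite mulp1 mem_undup asboolb subrr (sn0 sw) ltW.
have Sv : S v by exists g.
have qv : qsn K0 N v <= K * d.
  by apply: le_trans (hK v Sv) _; rewrite ler_wpM2l.
have [k [h Ih kh] Nk] := qsn_approx sK sN v d0.
have Nk' : N (v + k) <= (K + 1) * d by rewrite mulrDl mul1r; lra.
have jvk x : j (v + k) x = unit_defect g x + unit_defect h x.
  by rewrite (linD lj) -jv -kh.
have gl : g l = unitp A by rewrite /g asboolT.
(* [b = - h l] turns the coordinates of [v + k] at [l] into [d (1 - b)] and [u - u b]; in the first
   the factor [d] cancels. *)
exists (- h l); first exact: subspaceN.
split => [|u ur].
  have := le_trans (Nle (v + k) (l, None)) Nk'.
  rewrite jvk /unit_defect /= gl -scalerDr (snZr sw) ?(ltW d0)// mulrC.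
  by rewrite ler_pM2r// opprK.
apply: le_trans Nk'; have := Nle (v + k) (l, Some u).
rewrite jvk /unit_defect /= asboolT// gl mulp1.
by rewrite (linN (mulp_linr u)) opprK.
Qed.

Lemma tensor_exact_banach_bounded_ai : right_locally_bounded_ai mulp I.
Proof.
move=> U UI nU; have [p [cp pm [e e0 pU]]] := submul_seminorm nU.
have [K K0 hK] := uniform_approximate_unit cp pm.
have sw := proj1 (normp_cs cp).
have w1 : normp p (unitp A) = 1.
  by rewrite -[LHS]/(p 0 + Normc.normc 1) (sn0 (proj1 cp)) add0r Normc.normc1.
have K2 : 0 < K + 2 by lra.
(* From [|b| <= K + 1] the multiple [b / c] has norm less than [e], and the tolerance
   [d = e / (2 * (K + 2))] gives [K * d < e]. *)
pose c := 2 * (K + 2) / e; have c0 : 0 < c by rewrite divr_gt0//; lra.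
exists c => // S /finite_seqP [r ->] rI.
have d0 : 0 < e / (2 * (K + 2)) by rewrite divr_gt0//; lra.
have [b Ib [b1 br]] := hK r _ d0 rI.
have cn : c%:C != 0 :> R[i] by rewrite real_complex_eq0 gt_eqF.
exists b.
  split => //; exists (c^-1%:C *: b); last first.
    by rewrite scalerA -rmorphM mulfV ?gt_eqF// scale1r.
  apply: pU; last exact: subspaceZ.
  rewrite /= (snZr sw) ?invr_ge0 ?(ltW c0)//.
  have := sn_le_sub sw b (unitp A); rewrite w1 (snC sw) => nb.
  rewrite mulrC ltr_pdivrMr//; apply: (@lt_le_trans _ _ (2 * (K + 2))); first lra.
  by rewrite /c mulrCA divff ?gt_eqF// mulr1.
move=> u ur; apply: pU; last first.
  by apply: subspaceB => //; [exact: rI|exact: Ileft].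
apply: le_lt_trans (br u ur) _.
rewrite mulrA ltr_pdivrMr; last lra.
rewrite mulrC ltr_pM2l//; lra.
Qed.

End BoundedApproximateIdentity.

Theorem theorem7p2 (R : realType) (A : arens_michael R)
    (I : set (unitization A)) (hI : closed_left_ideal I)
    (X : lmodule A) (q : unitization A -> X)
    (hX : is_cyclic_completion I q) :
  (right_locally_bounded_ai (@unitization_mul R A) I <-> tensor_exact X) /\
  (tensor_exact X <-> tensor_exact_banach X).
Proof.
have iii_i := @tensor_exact_banach_bounded_ai R A I X q hI hX.
have i_ii := @bounded_ai_tensor_exact R A I X q hI hX.
have ii_iii := @tensor_exact_tensor_exact_banach R A I X q hI hX.
by split; split => h; auto.
Qed.
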